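(* Let $B$ be a body and let $P$ be the $G_{1B}$-structure on $B$, for $\gamma=0$ and $\alpha,\beta\neq0$, given by a two-dimensional distribution $D$, a vector field $X$ without zeros belonging to $D$, and a volume form $\Omega$. Then $P$ is integrable if and only if $D$ is involutive and $\mathcal{L}_X\Omega=0$.
   Context: A body is a $3$-dimensional smooth manifold which can be covered with one chart. In this case ($\gamma=0$, $\alpha=-\beta\neq0$) $G_{1B}\subset GL(3,\mathbb{R})$ is the isotropy group of the vector $e_3$, the subspace $\langle e_2,e_3\rangle$ and the tensor $e^1\wedge e^2\wedge e^3$, where $(e_i)$ is the canonical basis of $\mathbb{R}^3$ and $(e^i)$ its dual basis. The corresponding $G_{1B}$-structure $P$ is the set of linear frames $(v_1,v_2,v_3)$ at points $x\in B$ such that $v_3=X(x)$, $v_2,v_3$ span $D_x$ and $\Omega(v_1,v_2,v_3)=1$. A $G$-structure $P$ is integrable if around each point there are local coordinates $(x^1,x^2,x^3)$ whose coordinate frame is a section of $P$. $\mathcal{L}$ denotes the Lie derivative. *)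

(* Defs.v *)
From HB Require Import structures.
From mathcomp Require Import all_boot all_order all_algebra.
From mathcomp Require Import all_classical all_reals all_analysis.

Set Implicit Arguments.
Unset Strict Implicit.
Unset Printing Implicit Defensive.

Import Order.TTheory GRing.Theory Num.Theory.
Import numFieldNormedType.Exports.

Local Open Scope classical_set_scope.
Local Open Scope ring_scope.

Definition canon_basis (R : realType) (i : 'I_3) : 'cV[R]_3 := delta_mx i 0.

(* The indices 0, 1, 2 stand for the indices 1, 2, 3 of a basis. *)
Definition i1 : 'I_3 := inord 0.
Definition i2 : 'I_3 := inord 1.
Definition i3 : 'I_3 := inord 2.

Section Smooth.
Variables (R : realType) (W : normedModType R).

(* Meant for U open: f and all its iterated partial derivatives of order at
   most k exist and are continuous at each point of U. *)
Fixpoint is_Ck (k : nat) (U : set 'cV[R]_3) (f : 'cV[R]_3 -> W) : Prop :=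
  (forall x, U x -> {for x, continuous f}) /\
  match k with
  | 0%N => True
  | k'.+1 => forall i : 'I_3,
      (forall x, U x -> derivable f x (canon_basis R i)) /\
      is_Ck k' U ('D_(canon_basis R i) f)
  end.

Definition smooth (U : set 'cV[R]_3) (f : 'cV[R]_3 -> W) : Prop :=
  forall k, is_Ck k U f.

End Smooth.

(* A 3-manifold with a global chart, i.e. a homeomorphism onto an open subset
   of R^3; the smooth structure is the one for which this chart is a
   diffeomorphism. *)
Record body (R : realType) := Body {
  body_space :> topologicalType;
  chart : body_space -> 'cV[R]_3;
  chart_inj : injective chart;
  chart_continuous : continuous chart;
  chart_open : forall V : set body_space, open V -> open (chart @` V) }.

Arguments chart {R} b _.

Section Calculus.
Variables (R : realType) (B : body R).

(* f \o (chart B)^-1 on the open set range (chart B), and 0 elsewhere. *)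
Definition in_chart (W : zmodType) (f : B -> W) (x : 'cV[R]_3) : W :=
  match pselect (exists p, chart B p = x) with
  | left e => f (projT1 (cid e))
  | right _ => 0
  end.

Definition smooth_on (W : normedModType R) (V : set B) (f : B -> W) : Prop :=
  smooth (chart B @` V) (in_chart f).

(* Every tangent space of B is identified with 'cV[R]_3 by the differential of
   the global chart, so vector fields are functions B -> 'cV[R]_3. *)

Definition dir_derive (W : normedModType R) (p : B) (v : 'cV[R]_3)
    (f : B -> W) : W :=
  'D_v (in_chart f) (chart B p).

Definition lie_bracket (X Y : B -> 'cV[R]_3) (p : B) : 'cV[R]_3 :=
  dir_derive p (X p) Y - dir_derive p (Y p) X.

Definition distribution2 (D : B -> {vspace 'cV[R]_3}) : Prop :=
  (forall p, \dim (D p) = 2%N) /\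
  forall p, exists (V : set B) (Y Z : B -> 'cV[R]_3),
    [/\ open V, V p, smooth_on V Y, smooth_on V Z &
        forall q, V q -> D q = <<[:: Y q; Z q]>>%VS].

Definition involutive_distribution (D : B -> {vspace 'cV[R]_3}) : Prop :=
  forall (V : set B) (Y Z : B -> 'cV[R]_3),
    open V -> smooth_on V Y -> smooth_on V Z ->
    (forall q, V q -> Y q \in D q) -> (forall q, V q -> Z q \in D q) ->
    forall q, V q -> lie_bracket Y Z q \in D q.

Definition form3 := B -> 'cV[R]_3 -> 'cV[R]_3 -> 'cV[R]_3 -> R.

Definition volume_form (Omega : form3) : Prop :=
  [/\ (* trilinear *)
      forall p v w, (scalar (fun u => Omega p u v w) /\
                     scalar (fun u => Omega p v u w)) /\
                     scalar (fun u => Omega p v w u),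
      (* alternating *)
      forall p u v, [/\ Omega p u u v = 0, Omega p u v u = 0 &
                        Omega p v u u = 0],
      forall p, exists u v w, Omega p u v w != 0 &
      forall u v w, smooth_on setT (fun p => Omega p u v w)].

(* L_X Omega (U1, U2, U3) = X (Omega (U1, U2, U3)) - Omega ([X, U1], U2, U3)
   - Omega (U1, [X, U2], U3) - Omega (U1, U2, [X, U3]), where U1, U2, U3 are the
   extensions of u1, u2, u3 with constant components in the global chart. *)
Definition lie_derivative (X : B -> 'cV[R]_3) (Omega : form3) : form3 :=
  fun p u1 u2 u3 =>
    dir_derive p (X p) (fun q => Omega q u1 u2 u3)
    - Omega p (lie_bracket X (cst u1) p) u2 u3
    - Omega p u1 (lie_bracket X (cst u2) p) u3
    - Omega p u1 u2 (lie_bracket X (cst u3) p).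

(* A linear frame (v_1, v_2, v_3) is the invertible matrix with columns v_i;
   GL(3) acts on the right on linear frames. *)
Record G_structure (G : set 'M[R]_3) := GStructure {
  frames :> B -> set 'M[R]_3;
  frames_unitmx : forall p u, frames p u -> u \in unitmx;
  frames_orbit : forall p u w, frames p u ->
    (frames p w <-> exists2 g, G g & w = u *m g);
  frames_section : forall p, exists (V : set B) (sigma : B -> 'M[R]_3),
    [/\ open V, V p, smooth_on V sigma & forall q, V q -> frames q (sigma q)] }.

(* y is a diffeomorphism from the open set V of B onto the open set y @` V of
   R^3, and psi is chart B \o y^-1 on y @` V. *)
Definition local_coordinates (V : set B) (y : B -> 'cV[R]_3)
    (psi : 'cV[R]_3 -> 'cV[R]_3) : Prop :=
  [/\ open V, open (y @` V), smooth_on V y, smooth (y @` V) psi &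
      forall q, V q -> psi (y q) = chart B q].

(* The columns are the coordinate vector fields of the coordinates y at q. *)
Definition coordinate_frame (y : B -> 'cV[R]_3) (psi : 'cV[R]_3 -> 'cV[R]_3)
    (q : B) : 'M[R]_3 :=
  \matrix_(j, i) 'D_(canon_basis R i) psi (y q) j 0.

Definition integrable_G_structure (G : set 'M[R]_3) (P : G_structure G) : Prop :=
  forall p, exists (V : set B) (y : B -> 'cV[R]_3)
                   (psi : 'cV[R]_3 -> 'cV[R]_3),
    [/\ V p, local_coordinates V y psi &
        forall q, V q -> P q (coordinate_frame y psi q)].

Definition adapted_frame (D : B -> {vspace 'cV[R]_3}) (X : B -> 'cV[R]_3)
    (Omega : form3) (p : B) (u : 'M[R]_3) : Prop :=
  [/\ u \in unitmx,
      col i3 u = X p,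
      <<[:: col i2 u; col i3 u]>>%VS = D p &
      Omega p (col i1 u) (col i2 u) (col i3 u) = 1].

End Calculus.

Section G1B.
Variable R : realType.
Let e := canon_basis R.
Let e23 : {vspace 'cV[R]_3} := <<[:: e i2; e i3]>>%VS.

(* The tensor e^1 /\ e^2 /\ e^3 maps (v_1, v_2, v_3) to the determinant of the
   matrix m with columns v_i, and g *m m has columns g *m v_i. *)
Definition G1B : set 'M[R]_3 := [set g |
  [/\ g \in unitmx,
      g *m e i3 = e i3,
      forall v, (g *m v \in e23) = (v \in e23) &
      forall m : 'M[R]_3, \det (g *m m) = \det m]].

End G1B.

Arguments G1B R : clear implicits.

(* Main.v *)
(** Write [Omega = g dx1 dx2 dx3] in the chart; then [L_X Omega] is
    [(X g + g div X) dx1 dx2 dx3].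

    Given adapted coordinates, [D] is the kernel of the differential of the first
    one, which kills brackets of sections of [D] by symmetry of second derivatives;
    differentiating [Omega (d1, d2, d3) = 1] along [d3 = X] gives [X g + g div X = 0].

    Conversely, in the linear coordinates defined by an adapted frame at a point,
    [D] is spanned by two fields [e2 + f e1] and [e3 + h e1], which commute because
    [D] is involutive.  Two changes of the first coordinate make [D] the span of the
    last two coordinate fields, one change of the second and one of the third make
    [X] the last coordinate field, the density of [Omega] is then independent of the
    third coordinate, and a last change of the second one makes it equal to 1.

    Each of these five changes alters a single coordinate, by the solution of a
    scalar differential equation with parameters.  For scalar equations the
    derivatives of the solution with respect to initial value and parameters are
    explicit (exponentials and primitives of functions of the solution), so that a
    C^k solution is C^(k+1) on the same neighbourhood. *)

Require Import Defs.
From HB Require Import structures.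
From mathcomp Require Import all_boot all_order all_algebra.
From mathcomp Require Import all_classical all_reals all_analysis.
From mathcomp Require Import ring lra.

Import Order.TTheory GRing.Theory Num.Theory.
Import numFieldNormedType.Exports.

Local Open Scope classical_set_scope.
Local Open Scope ring_scope.
Set Implicit Arguments.
Unset Strict Implicit.
Unset Printing Implicit Defensive.

(** * Differential calculus on R^3 *)

(** Smoothness is defined by iterated partial derivatives, so the estimates run along coordinate
    segments with the one-variable mean value theorem; differentiability in the usual sense comes
    from continuity of the partial derivatives. The general inverse function theorem is replaced by
    the intermediate value theorem on coordinate lines, which suffices because each nonlinear change
    alters one coordinate. Keeping the neighbourhood fixed while the order of differentiability
    grows is what yields smoothness: neighbourhoods shrinking with [k] could have no common
    interior. The maps constructed are parametrizations, from new coordinates to old ones: each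
    differential equation prescribes a column of their Jacobian, and the coordinates themselves are
    recovered by inversion. *)

Lemma is_derive_epsP (R : realType) (V : normedModType R) (f : V -> R) x v d :
  is_derive x v f d <-> forall eps : R, 0 < eps ->
    \forall h \near (0 : R), `|f (x + h *: v) - f x - h * d| <= eps * `|h|.
Proof.
split=> [[fx <-] eps eps0|H].
  move/cvgrPdist_le: fx => /(_ _ eps0); rewrite near_withinE => fx.
  near=> h; have [->|h0] := eqVneq h 0.
    by rewrite scale0r addr0 subrr mul0r subrr normr0 mulr0.
  have : `|lim (h^-1 *: (f (h *: v + x) - f x) @[h --> 0^']) -
     h^-1 *: (f (h *: v + x) - f x)| <= eps.
    exact: (near fx h _ h0).
  rewrite -(ler_pM2r (_ : 0 < `|h|)) ?normr_gt0// -normrM -normrN.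
  rewrite -[lim _]/('D_v f x).
  have -> : - (('D_v f x - h^-1 *: (f (h *: v + x) - f x)) * h) =
     f (x + h *: v) - f x - h * 'D_v f x; last by [].
  by rewrite (addrC x) /GRing.scale /=; field.
have K : h^-1 *: (f (h *: v + x) - f x) @[h --> 0^'] --> d.
  apply/cvgrPdist_le => e e0; have He := H _ e0.
  rewrite near_withinE; near=> h => h0.
  have Hh : `|f (x + h *: v) - f x - h * d| <= e * `|h| by near: h.
  rewrite -(ler_pM2r (_ : 0 < `|h|)) ?normr_gt0// -normrM.
  have -> : (d - h^-1 *: (f (h *: v + x) - f x)) * h =
            - (f (x + h *: v) - f x - h * d).
    by rewrite (addrC x) /GRing.scale /=; field.
  by rewrite normrN.
by split; [apply/cvg_ex; exists d|exact/cvg_lim].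
Unshelve. all: by end_near. Qed.

Lemma cvg_mxP (R : realType) m n (T : Type) (F : set_system T)
    (FF : Filter F) (f : T -> 'M[R]_(m, n)) (l : 'M[R]_(m, n)) :
  f @ F --> l <-> forall r s, (fun z => f z r s) @ F --> l r s.
Proof.
split=> [fl r s|fl].
  exact: (cvg_comp _ _ fl (@coord_continuous _ _ _ _ _ _)).
apply/cvg_ballP => eps eps0.
have : \forall z \near F, forall r s, `|l r s - f z r s| < eps.
  apply: filter_forall => r; apply: filter_forall => s.
  by move/cvgrPdist_lt: (fl r s) => /(_ _ eps0).
by apply: filterS => z.
Qed.

Section Coordinates.
Variable R : realType.
Local Notation V3 := 'cV[R]_3.
Local Notation e := (canon_basis R).
Implicit Types (x y a : V3) (i j k : 'I_3) (s t r h : R).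

(** As a function of [t] this is the coordinate line through [x]; each of the five nonlinear changes
    of coordinates has the form [x |-> upd x j (f x)]. *)
Definition upd x i t : V3 := \col_k (if k == i then t else x k 0).

Lemma updE x i t k : upd x i t k 0 = if k == i then t else x k 0.
Proof. by rewrite mxE. Qed.

Lemma upd_same x i t : upd x i t i 0 = t.
Proof. by rewrite updE eqxx. Qed.

Lemma upd_id x i : upd x i (x i 0) = x.
Proof. by apply/colP => k; rewrite updE; case: eqP => [->|]. Qed.

Lemma upd_upd x i s t : upd (upd x i s) i t = upd x i t.
Proof. by apply/colP => k; rewrite !updE; case: eqP. Qed.

Lemma updC x i j s t : i != j -> upd (upd x i s) j t = upd (upd x j t) i s.
Proof.
move=> ij; apply/colP => k; rewrite !updE.
by case: eqP => [->|//]; rewrite eq_sym (negbTE ij).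
Qed.

Lemma add_basis x i h : x + h *: e i = upd x i (x i 0 + h).
Proof.
apply/colP => k; rewrite updE !mxE eqxx andbT.
by case: eqP => [->|]; rewrite ?mulr1 // mulr0 addr0.
Qed.

Lemma upd_add x i t h : upd x i t + h *: e i = upd x i (t + h).
Proof. by rewrite add_basis upd_upd upd_same. Qed.

(** Balls of the sup norm, written by coordinates so that stability under [upd] is immediate; empty
    for [r <= 0]. *)
Definition box a r : set V3 := [set x | forall k, `|x k 0 - a k 0| < r].

Lemma box_center a r : 0 < r -> box a r a.
Proof. by move=> r0 k; rewrite subrr normr0. Qed.

Lemma sub_box a r s : r <= s -> box a r `<=` box a s.
Proof. by move=> rs x xr k; exact: lt_le_trans (xr k) rs. Qed.

Lemma box_upd a r x i t :
  box a r x -> `|t - a i 0| < r -> box a r (upd x i t).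
Proof. by move=> xr tr k; rewrite updE; case: eqP => [->|]. Qed.

Lemma ball_box a r : 0 < r -> ball a r = box a r.
Proof.
move=> r0; apply/seteqP; split => x.
  by move=> [_ xr] k; have := xr k 0; rewrite /ball/= distrC.
by move=> xr; split => // k l; rewrite (ord1 l) /ball/= distrC.
Qed.

Lemma nbhs_boxP a (P : set V3) :
  nbhs a P <-> exists2 r, 0 < r & box a r `<=` P.
Proof.
split=> [/nbhs_ballP[r /= r0 rP]|[r r0 rP]].
  by exists r => //; rewrite -ball_box.
by apply/nbhs_ballP; exists r => //; rewrite ball_box.
Qed.

Lemma nbhs_box a r : 0 < r -> nbhs a (box a r).
Proof. by move=> r0; apply/nbhs_boxP; exists r. Qed.

Lemma open_box a r : open (box a r).
Proof.
have [r0|r0] := ltP 0 r.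
  by rewrite -ball_box//; exact: ball_open.
suff -> : box a r = set0 by exact: open0.
apply/seteqP; split => // x /(_ ord0) /(le_lt_trans (normr_ge0 _)).
by rewrite ltNge r0.
Qed.

Lemma cvg_colP (T : Type) (F : set_system T) (f : T -> V3) (l : V3) :
  Filter F -> (f @ F --> l) <-> forall k, (fun z : T => f z k 0) @ F --> l k 0.
Proof.
move=> FF; rewrite cvg_mxP; split=> [H k|H k m]; first exact: H.
by rewrite (ord1 m).
Qed.

Lemma near_coord x i (eps : R) : 0 < eps ->
  \forall y \near x, `|(y : V3) i 0 - x i 0| < eps.
Proof. by move=> e0; apply/nbhs_boxP; exists eps => // y; exact. Qed.

Lemma upd_continuous (T : topologicalType) (f : T -> V3) (g : T -> R) i p :
  {for p, continuous f} -> {for p, continuous g} ->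
  {for p, continuous (fun q => upd (f q) i (g q))}.
Proof.
move=> cf cg; apply/cvg_colP => k; rewrite updE.
have -> : (fun z : T => upd (f z) i (g z) k 0) =
          (fun z : T => if k == i then g z else f z k 0).
  by apply/funext => z; rewrite updE.
by case: ifP => // _; move/cvg_colP: cf; exact.
Qed.

(** The segment with unordered ends: primitives and solutions are followed on both sides of the base
    value. *)
Definition btw s t r := (s <= r <= t) || (t <= r <= s).

Lemma btwC s t r : btw s t r = btw t s r.
Proof. by rewrite /btw orbC. Qed.

Lemma btw_l s t : btw s t s.
Proof. by rewrite /btw !lexx /=; case: ltP => // /ltW ->; rewrite orbT. Qed.

Lemma btw_r s t : btw s t t.
Proof. by rewrite btwC btw_l. Qed.

Lemma btw_dist s t r : btw s t r -> `|r - s| <= `|t - s|.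
Proof.
case/orP => /andP[H1 H2].
  by rewrite !ger0_norm ?subr_ge0 ?(le_trans H1) // lerB.
by rewrite !ler0_norm ?subr_le0 ?(le_trans H1) // lerN2 lerB.
Qed.

Lemma btw_ltr s t r c d : btw s t r -> `|s - c| < d -> `|t - c| < d ->
  `|r - c| < d.
Proof. by case/orP => /andP[H1 H2]; rewrite !ltr_norml; lra. Qed.

Lemma btw_trans s t r u : btw s t r -> btw s r u -> btw s t u.
Proof. by rewrite /btw => /orP[]/andP[H1 H2] /orP[]/andP[H3 H4]; lra. Qed.

Lemma MVT_btw (f df : R -> R) s t :
  (forall u, btw s t u -> is_derive u 1 f (df u)) ->
  exists2 c, btw s t c & f t - f s = df c * (t - s).
Proof.
have K (a b : R) : a <= b -> (forall u, a <= u <= b -> is_derive u 1 f (df u)) ->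
    exists2 c, a <= c <= b & f b - f a = df c * (b - a).
  move=> ab H.
  have [||c cab ->] := @MVT_segment R f df a b ab.
  - by move=> u; rewrite in_itv/= => /andP[H1 H2]; apply: H; rewrite !ltW.
  - apply: derivable_within_continuous => u; rewrite in_itv/= => uab.
    by have [] := H _ uab.
  - by exists c.
move=> H; have [st|/ltW ts] := leP s t.
  have [u ust|c cst ->] := K _ _ st; first by apply: H; rewrite /btw ust.
  by exists c => //; rewrite /btw cst.
have [u ust|c cst E] := K _ _ ts; first by apply: H; rewrite /btw ust orbT.
by exists c; [rewrite /btw cst orbT|rewrite -opprB E -mulrN opprB].
Qed.

(** Turns a partial derivative into a derivative in one variable, to which the mean value theorem
    applies. *)
Lemma is_derive_line (f : V3 -> R) x i t d :
  is_derive (upd x i t) (e i) f d <->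
  is_derive t 1 (fun t => f (upd x i t)) d.
Proof.
split=> /is_derive_epsP H; apply/is_derive_epsP => eps /H;
  by apply: filterS => h; rewrite upd_add [h *: 1]mulr1.
Qed.

Lemma MVT_upd (f : V3 -> R) (df : V3 -> R) x i s t :
  (forall u, btw s t u -> is_derive (upd x i u) (e i) f (df (upd x i u))) ->
  exists2 c, btw s t c &
    f (upd x i t) - f (upd x i s) = df (upd x i c) * (t - s).
Proof.
move=> H; apply: (@MVT_btw (fun t => f (upd x i t)) (fun t => df (upd x i t))).
by move=> u /H /is_derive_line.
Qed.

End Coordinates.

Lemma I3P (P : 'I_3 -> Prop) : P i1 -> P i2 -> P i3 -> forall i, P i.
Proof.
move=> P1 P2 P3 [[|[|[|//]]] lt3].
- by have -> : Ordinal lt3 = i1 by apply/val_inj; rewrite /= inordK.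
- by have -> : Ordinal lt3 = i2 by apply/val_inj; rewrite /= inordK.
- by have -> : Ordinal lt3 = i3 by apply/val_inj; rewrite /= inordK.
Qed.

(** The indices are [inord] terms, whose comparison does not compute; this tuple of equations serves
    as one rewriting rule. *)
Lemma I3E : ((i1 == i2) = false) * ((i1 == i3) = false) * ((i2 == i1) = false)
  * ((i2 == i3) = false) * ((i3 == i1) = false) * ((i3 == i2) = false).
Proof. by rewrite -!(inj_eq val_inj) /= !inordK. Qed.

Lemma sum3E (V : nmodType) (F : 'I_3 -> V) :
  \sum_i F i = F i1 + F i2 + F i3.
Proof.
rewrite !big_ord_recl big_ord0 addr0 addrA.
by congr (F _ + F _ + F _); apply/val_inj; rewrite /= ?inordK.
Qed.

(** * Chain rule for functions with continuous partial derivatives *)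

Section Chain.
Variable R : realType.
Local Notation V3 := 'cV[R]_3.
Local Notation e := (canon_basis R).

(** Go from [p] to [y] along three coordinate segments, through [q1] and [q2]. On each, the mean
    value theorem gives a partial derivative at a nearby point, within [eps] of its value at [p] by
    continuity. *)
Lemma taylor1 (f : V3 -> R) (df : 'I_3 -> V3 -> R) (p : V3) :
  (\forall x \near p, forall i, is_derive x (e i) f (df i x)) ->
  (forall i, {for p, continuous (df i)}) ->
  forall eps : R, 0 < eps -> \forall y \near p,
    `|f y - f p - \sum_i df i p * ((y : V3) i 0 - p i 0)| <=
    eps * \sum_i `|(y : V3) i 0 - p i 0|.
Proof.
move=> fD fC eps eps0.
have : \forall y \near p, forall i,
    is_derive y (e i) f (df i y) /\ `|df i y - df i p| <= eps.
  apply: (@filter_forall _ _ _ (nbhs p)) => i; apply: filterI.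
    by apply: filterS fD => y; exact.
  move/cvgrPdist_le: (fC i) => /(_ _ eps0).
  by apply: filterS => y; rewrite distrC.
move=> /nbhs_boxP[r r0 rP]; apply/nbhs_boxP; exists r => // y yr.
have st (q : V3) i : box p r q -> q i 0 = p i 0 ->
    `|f (upd q i (y i 0)) - f q - df i p * (y i 0 - p i 0)| <=
    eps * `|y i 0 - p i 0|.
  move=> qr qi; have qb u : btw (q i 0) (y i 0) u -> box p r (upd q i u).
    by move=> ub; apply: box_upd => //; apply: (btw_ltr ub); rewrite ?yr ?qr.
  have [u|c cb] := @MVT_upd _ f (df i) q i (q i 0) (y i 0).
    by move=> /qb/rP/(_ i)[].
  rewrite upd_id qi => ->; rewrite -mulrBl normrM ler_wpM2r//.
  by have [] := rP _ (qb _ cb) i.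
pose q1 := upd p i1 (y i1 0); pose q2 := upd q1 i2 (y i2 0).
have q1r : box p r q1 by apply: box_upd => //; exact: box_center.
have q2r : box p r q2 by apply: box_upd.
have yE : y = upd q2 i3 (y i3 0).
  by apply/colP; apply: I3P; rewrite !updE !I3E ?eqxx.
have s1 := st p i1 (box_center _ r0) erefl.
have s2 := st q1 i2 q1r; have s3 := st q2 i3 q2r.
rewrite -/q1 in s1; rewrite -/q2 updE I3E in s2.
rewrite -yE !updE !I3E in s3.
rewrite !sum3E [leRHS]mulrDr [X in _ <= X + _]mulrDr.
have -> : f y - f p - (df i1 p * (y i1 0 - p i1 0) +
    df i2 p * (y i2 0 - p i2 0) + df i3 p * (y i3 0 - p i3 0)) =
    (f q1 - f p - df i1 p * (y i1 0 - p i1 0)) +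
    (f q2 - f q1 - df i2 p * (y i2 0 - p i2 0)) +
    (f y - f q2 - df i3 p * (y i3 0 - p i3 0)) by ring.
apply: le_trans (ler_normD _ _) _; rewrite lerD ?s3//.
by apply: le_trans (ler_normD _ _) _; rewrite lerD ?s1 ?s2.
Qed.

Lemma is_derive_comp3 (V : normedModType R) (f : V3 -> R)
    (df : 'I_3 -> V3 -> R) (c : V -> V3) (x v : V) (dc : 'I_3 -> R) :
  (\forall y \near c x, forall i, is_derive y (e i) f (df i y)) ->
  (forall i, {for c x, continuous (df i)}) ->
  (forall i, is_derive x v (fun z => c z i 0) (dc i)) ->
  is_derive x v (f \o c) (\sum_i df i (c x) * dc i).
Proof.
move=> fD fC cD; apply/is_derive_epsP => eps eps0.
pose A : R := \sum_i `|df i (c x)|; pose B : R := \sum_i `|dc i|.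
have A0 : 0 <= A by apply: sumr_ge0.
have B0 : 0 <= B by apply: sumr_ge0.
(* The errors add up to [d * (A + B + d) * |h|]: the remainder of [f] on an increment of size
   [(B + d) * |h|], and [A] times the linearization error of [c]. *)
pose d : R := Num.min 1 (eps / (A + B + 3)).
have d0 : 0 < d by rewrite lt_min ltr01 divr_gt0//; lra.
have d1 : d <= 1 by rewrite ge_min lexx.
have dE : d * (A + B + 3) <= eps.
  by rewrite -ler_pdivlMr ?ge_min ?lexx ?orbT//; lra.
have cl i := (is_derive_epsP _ _ _ _).1 (cD i).
have ccl : \forall h \near (0 : R), forall i,
    `|c (x + h *: v) i 0 - c x i 0 - h * dc i| <= d / 3 * `|h|.
  by apply: (@filter_forall _ _ _ (nbhs (0 : R))) => i; apply: cl; rewrite divr_gt0.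
have cx : c (x + h *: v) @[h --> (0 : R)] --> c x.
  apply/cvg_colP => i; apply/cvgrPdist_le => t t0.
  have s0 : 0 < t / (`|dc i| + d / 3).
    by rewrite divr_gt0// ltr_wpDl// divr_gt0.
  apply: filterS2 (nbhs0_le s0) ccl => h.
  rewrite ler_pdivlMr; last by rewrite ltr_wpDl// divr_gt0.
  move=> ht hc.
  rewrite distrC; apply: le_trans ht.
  have -> : c (x + h *: v) i 0 - c x i 0 =
    (c (x + h *: v) i 0 - c x i 0 - h * dc i) + h * dc i by ring.
  apply: le_trans (ler_normD _ _) _; rewrite mulrDr addrC lerD//.
    by rewrite normrM.
  by rewrite [leRHS]mulrC; exact: hc.
have T : \forall h \near (0 : R), `|f (c (x + h *: v)) - f (c x) -
     \sum_i df i (c x) * (c (x + h *: v) i 0 - c x i 0)| <=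
    d * \sum_i `|c (x + h *: v) i 0 - c x i 0|.
  exact: cx _ (taylor1 fD fC d0).
apply: filterS2 T ccl => h T hc.
set D := fun i => c (x + h *: v) i 0 - c x i 0 in T *.
have D1 : \sum_i `|D i| <= (B + d) * `|h|.
  have -> : d = \sum_(i < 3) (d / 3) by rewrite sum3E; field.
  rewrite -big_split/= mulr_suml; apply: ler_sum => i _.
  have -> : D i = h * dc i + (D i - h * dc i) by ring.
  apply: le_trans (ler_normD _ _) _; rewrite mulrDl lerD ?hc//.
  by rewrite normrM mulrC.
have D2 : `|\sum_i df i (c x) * (D i - h * dc i)| <= A * d * `|h|.
  apply: le_trans (ler_norm_sum _ _ _) _.
  rewrite -mulrA mulr_suml; apply: ler_sum => i _.
  rewrite normrM ler_wpM2l//; apply: le_trans (hc i) _.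
  by rewrite ler_wpM2r// ler_pdivrMr//; lra.
rewrite /=.
have -> : f (c (x + h *: v)) - f (c x) - h * (\sum_i df i (c x) * dc i) =
   (f (c (x + h *: v)) - f (c x) - \sum_i df i (c x) * D i)
   + \sum_i df i (c x) * (D i - h * dc i).
  by rewrite !sum3E; ring.
apply: le_trans (ler_normD _ _) _; apply: (@le_trans _ _ (d * (A + B + 3) * `|h|)).
  apply: le_trans (lerD T D2) _.
  have : d * (\sum_i `|D i|) <= d * ((B + d) * `|h|) by rewrite ler_wpM2l// ltW.
  have : d * (d * `|h|) <= d * (3 * `|h|).
    rewrite ler_wpM2l ?(ltW d0)// ler_wpM2r//; lra.
  lra.
by rewrite ler_wpM2r.
Qed.

End Chain.

Lemma is_derive_ray (R : realType) (V : normedModType R) (f : V -> R) x v d :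
  is_derive x v f d <-> is_derive (0 : R) 1 (fun h => f (x + h *: v)) d.
Proof.
split=> /is_derive_epsP H; apply/is_derive_epsP => eps /H;
  by apply: filterS => h; rewrite add0r [h *: 1]mulr1 scale0r addr0.
Qed.

Lemma is_derive_outer (R : realType) (V : normedModType R) (g : R -> R)
    (f : V -> R) x v dg df :
  is_derive (f x) 1 g dg -> is_derive x v f df ->
  is_derive x v (g \o f) (dg * df).
Proof.
move=> gD /is_derive_ray fD; apply/is_derive_ray.
apply: (@is_derive1_comp _ g (fun h => f (x + h *: v))).
by rewrite scale0r addr0.
Qed.

Lemma continuous_epsP (R : realType) (T : topologicalType) (f : T -> R) (x : T) :
  {for x, continuous f} <->
  forall eps : R, 0 < eps -> \forall y \near x, `|f y - f x| < eps.
Proof.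
by split=> [/cvgrPdist_lt H|H]; [move=> eps /H|apply/cvgrPdist_lt => eps /H];
  apply: filterS => y; rewrite distrC.
Qed.

Lemma continuous_colP (R : realType) (T : topologicalType) (c : T -> 'cV[R]_3)
    (x : T) :
  {for x, continuous c} <-> forall i, {for x, continuous (fun y => c y i 0)}.
Proof. exact: (@cvg_colP _ _ (nbhs x) c (c x)). Qed.

(** * Stability of C^k functions under operations and composition *)

Section Ck.
Variable R : realType.
Local Notation V3 := 'cV[R]_3.
Local Notation e := (canon_basis R).
Implicit Types (U V : set V3) (k : nat) (i j : 'I_3).

Section General.
Variable W : normedModType R.
Implicit Types f g : V3 -> W.

Lemma Ck_cont k U f x : is_Ck k U f -> U x -> {for x, continuous f}.
Proof. by case: k => [|k] [H _]; exact: H. Qed.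

Lemma Ck_is_derive k U f x i :
  is_Ck k.+1 U f -> U x -> is_derive x (e i) f ('D_(e i) f x).
Proof. by move=> [_ /(_ i)[H _]] /H; exact: derivableP. Qed.

Lemma Ck_D k U f i : is_Ck k.+1 U f -> is_Ck k U ('D_(e i) f).
Proof. by move=> [_ /(_ i)[_]]. Qed.

Lemma CkS k U f : is_Ck k.+1 U f -> is_Ck k U f.
Proof.
elim: k f => [|k IH] f [H1 H2]; first by split.
by split=> // i; have [? /IH] := H2 i.
Qed.

Lemma Ck_sub k U V f : V `<=` U -> is_Ck k U f -> is_Ck k V f.
Proof.
move=> VU; elim: k f => [|k IH] f [H1 H2].
  by split=> // x /VU; exact: H1.
split=> [x /VU|i]; first exact: H1.
by have [H3 /IH] := H2 i; split=> // x /VU; exact: H3.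
Qed.

Lemma open_near U x (P : V3 -> Prop) :
  open U -> U x -> (forall y, U y -> P y) -> \forall y \near x, P y.
Proof. by move=> oU Ux UP; apply: filterS UP _; exact: open_nbhs_nbhs. Qed.

Lemma continuous_eq U f g x : open U -> U x -> (forall y, U y -> f y = g y) ->
  {for x, continuous f} -> {for x, continuous g}.
Proof.
move=> oU Ux fg fC; have E := fg _ Ux.
have : g y @[y --> x] --> f x.
  exact: cvg_trans (near_eq_cvg (open_near oU Ux fg)) fC.
by rewrite E.
Qed.

Lemma Ck_eq k U f g : open U -> (forall x, U x -> f x = g x) ->
  is_Ck k U f -> is_Ck k U g.
Proof.
move=> oU; elim: k f g => [|k IH] f g fg [H1 H2].
  by split=> // x Ux; exact: continuous_eq fg (H1 _ Ux).
split=> [x Ux|i]; first exact: continuous_eq fg (H1 _ Ux).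
have [H3 H4] := H2 i; split=> [x Ux|].
  exact: near_eq_derivable (open_near oU Ux fg) (H3 _ Ux).
by apply: IH H4 => x Ux; exact: near_eq_derive (open_near oU Ux fg).
Qed.

Lemma Ck_intro k U f (d : 'I_3 -> V3 -> W) : open U ->
  (forall x, U x -> {for x, continuous f}) ->
  (forall i x, U x -> is_derive x (e i) f (d i x)) ->
  (forall i, is_Ck k U (d i)) -> is_Ck k.+1 U f.
Proof.
move=> oU fC fD dC; split=> // i; split=> [x Ux|]; first by have [] := fD i x Ux.
by apply: Ck_eq (dC i) => // x Ux; have [_ ->] := fD i x Ux.
Qed.

Lemma Ck_cst k U (w : W) : open U -> is_Ck k U (cst w).
Proof.
move=> oU; elim: k w => [|k IH] w.
  by split=> // x _; exact: cst_continuous.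
apply: (@Ck_intro _ _ _ (fun=> cst 0)) => //.
by move=> x _; exact: cst_continuous.
Qed.

End General.

Lemma CkD k U (f g : V3 -> R) : open U ->
  is_Ck k U f -> is_Ck k U g -> is_Ck k U (fun x => f x + g x).
Proof.
move=> oU; elim: k f g => [|k IH] f g fC gC.
  by split=> // x Ux; exact: (cvgD (Ck_cont fC Ux) (Ck_cont gC Ux)).
apply: (@Ck_intro _ _ _ _ (fun i x => 'D_(e i) f x + 'D_(e i) g x)) => //.
- by move=> x Ux; exact: (cvgD (Ck_cont fC Ux) (Ck_cont gC Ux)).
- move=> i x Ux; exact: (is_deriveD (Ck_is_derive i fC Ux) (Ck_is_derive i gC Ux)).
- by move=> i; apply: IH; apply: Ck_D.
Qed.

Lemma CkM k U (f g : V3 -> R) : open U ->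
  is_Ck k U f -> is_Ck k U g -> is_Ck k U (fun x => f x * g x).
Proof.
move=> oU; elim: k f g => [|k IH] f g fC gC.
  by split=> // x Ux; exact: (cvgM (Ck_cont fC Ux) (Ck_cont gC Ux)).
apply: (@Ck_intro _ _ _ _ (fun i x => f x * 'D_(e i) g x + g x * 'D_(e i) f x))
  => //.
- by move=> x Ux; exact: (cvgM (Ck_cont fC Ux) (Ck_cont gC Ux)).
- move=> i x Ux.
  have Df := Ck_is_derive i fC Ux; have Dg := Ck_is_derive i gC Ux.
  exact: (is_deriveM Df Dg).
- move=> i; apply: CkD => //; apply: IH; try exact: CkS; exact: Ck_D.
Qed.

Lemma CkN k U (f : V3 -> R) : open U -> is_Ck k U f -> is_Ck k U (fun x => - f x).
Proof.
move=> oU fC; apply: (@Ck_eq _ _ _ (fun x => -1 * f x)) => // [x _|].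
  by rewrite mulN1r.
by apply: CkM => //; exact: (@Ck_cst R).
Qed.

Lemma CkB k U (f g : V3 -> R) : open U ->
  is_Ck k U f -> is_Ck k U g -> is_Ck k U (fun x => f x - g x).
Proof. by move=> oU fC gC; apply: CkD => //; exact: CkN. Qed.

Lemma Ck_sum k U (f : 'I_3 -> V3 -> R) : open U ->
  (forall i, is_Ck k U (f i)) -> is_Ck k U (fun x => \sum_i f i x).
Proof.
move=> oU fC; apply: (@Ck_eq _ _ _ (fun x => f i1 x + f i2 x + f i3 x)) => //.
  by move=> x _; rewrite sum3E.
by apply: CkD => //; apply: CkD.
Qed.

Lemma CkV k U (f : V3 -> R) : open U -> (forall x, U x -> f x != 0) ->
  is_Ck k U f -> is_Ck k U (fun x => (f x)^-1).
Proof.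
move=> oU f0 fC; elim: k fC => [|k IH] fC.
  by split=> // x Ux; exact: (cvgV (f0 _ Ux) (Ck_cont fC Ux)).
apply: (@Ck_intro _ _ _ _ (fun i x => - ((f x)^-1 * (f x)^-1) * 'D_(e i) f x))
  => //.
- by move=> x Ux; exact: (cvgV (f0 _ Ux) (Ck_cont fC Ux)).
- move=> i x Ux; have Df := Ck_is_derive i fC Ux.
  apply: (is_derive_outer (g := fun t : R => t^-1)) Df.
  have := @is_deriveV _ id (f x) 1 1 (f0 _ Ux) (is_derive_id _ _).
  by rewrite -exprVn expr2 [_ *: 1]mulr1.
- move=> i; apply: CkM => //; last exact: Ck_D.
  by apply: CkN => //; apply: CkM => //; apply: IH; exact: CkS.
Qed.

Lemma Ck_expR k U (f : V3 -> R) : open U ->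
  is_Ck k U f -> is_Ck k U (fun x => expR (f x)).
Proof.
move=> oU; elim: k => [|k IH] fC.
  split=> // x Ux; apply: continuous_comp; last exact: continuous_expR.
  exact: Ck_cont fC Ux.
apply: (@Ck_intro _ _ _ _ (fun i x => expR (f x) * 'D_(e i) f x)) => //.
- move=> x Ux; apply: continuous_comp; last exact: continuous_expR.
  exact: Ck_cont fC Ux.
- move=> i x Ux; exact: (is_derive_outer (is_derive_expR _) (Ck_is_derive i fC Ux)).
- by move=> i; apply: CkM => //; [apply: IH; exact: CkS|exact: Ck_D].
Qed.

Lemma is_derive_coord (x v : V3) i : is_derive x v (fun y : V3 => y i 0) (v i 0).
Proof.
apply/is_derive_epsP => eps eps0; apply: (@nearW _ (nbhs (0 : R))) => h.
have -> : (x + h *: v) i 0 - x i 0 - h * v i 0 = 0 by rewrite !mxE; ring.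
by rewrite normr0 mulr_ge0// ltW.
Qed.

Lemma Ck_coord k U i : open U -> is_Ck k U (fun x : V3 => x i 0).
Proof.
move=> oU; have cC (x : V3) : {for x, continuous (fun x : V3 => x i 0)}.
  exact: coord_continuous.
case: k => [|k]; first by split=> // x _; exact: cC.
apply: (@Ck_intro _ _ _ _ (fun j => cst (e j i 0))) => //.
- by move=> j x _; exact: is_derive_coord.
- by move=> j; exact: (@Ck_cst R).
Qed.

Lemma Ck_mxP m n k U (M : V3 -> 'M[R]_(m, n)) : open U ->
  is_Ck k U M <->
  (forall (r : 'I_m) (s : 'I_n), is_Ck k U (fun x => M x r s)).
Proof.
move=> oU; have CM (N : V3 -> 'M[R]_(m, n)) (x : V3) : {for x, continuous N} <->
    forall r s, {for x, continuous (fun y : V3 => N y r s)}.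
  exact: (@cvg_mxP _ _ _ _ (nbhs x) _ N (N x)).
elim: k M => [|k IH] M; split.
- move=> MC r s; split=> // x Ux.
  by have /CM := Ck_cont MC Ux; exact.
- move=> MC; split=> // x Ux; apply/CM => r s; exact: Ck_cont (MC r s) Ux.
- move=> MC r s; split=> [x Ux|l].
    by have /CM := Ck_cont MC Ux; exact.
  have [_ /(_ l)[H1 H2]] := MC; split=> [x Ux|].
    by have /derivable_mxP := H1 _ Ux; exact.
  apply: Ck_eq (((IH _).1 H2) r s) => // x Ux.
  by rewrite derive_mx ?mxE//; exact: H1.
- move=> MC; split.
    by move=> x Ux; apply/CM => r s; exact: Ck_cont (MC r s) Ux.
  move=> l; have dM x : U x -> derivable M x (e l).
    by move=> Ux; apply/derivable_mxP => r s; have [_ /(_ l)[H _]] := MC r s;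
      exact: H.
  split=> //; apply/IH => r s.
  apply: Ck_eq (Ck_D l (MC r s)) => // x Ux.
  by rewrite derive_mx ?mxE//; exact: dM.
Qed.

Lemma Ck_comp k U V (f : V3 -> R) (c : V3 -> V3) : open U -> open V ->
  (forall x, U x -> V (c x)) -> is_Ck k V f ->
  (forall i, is_Ck k U (fun x => c x i 0)) -> is_Ck k U (f \o c).
Proof.
move=> oU oV cUV; have cC n x :
    (forall i, is_Ck n U (fun x => c x i 0)) -> U x -> {for x, continuous c}.
  by move=> cn Ux; apply/continuous_colP => i; exact: Ck_cont (cn i) Ux.
have fcC n x (g : V3 -> R) : is_Ck n V g ->
    (forall i, is_Ck n U (fun x => c x i 0)) -> U x -> {for x, continuous (g \o c)}.
  move=> gn cn Ux; apply: continuous_comp; first exact: cC cn Ux.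
  by apply: Ck_cont gn _; exact: cUV.
elim: k f => [|k IH] f fk ck; first by split=> // x; exact: fcC fk ck.
apply: (@Ck_intro _ _ _ _ (fun i x => \sum_l ('D_(e l) f \o c) x *
    'D_(e i) (fun y => c y l 0) x)) => //.
- by move=> x; exact: fcC fk ck.
- move=> i x Ux; apply: (@is_derive_comp3 _ _ _ (fun l => 'D_(e l) f)).
  + apply: (@open_near V) => //; first exact: cUV.
    by move=> y Vy j; exact: Ck_is_derive fk Vy.
  + by move=> l; apply: Ck_cont (Ck_D l fk) _; exact: cUV.
  + by move=> l; exact: Ck_is_derive (ck l) Ux.
- move=> i; apply: Ck_sum => // l; apply: CkM => //.
    by apply: IH; [exact: Ck_D|move=> j; exact: CkS].
  exact: Ck_D (ck l).
Qed.

(** The chain rule with the identity as inner map, whose coordinates have derivatives [v i 0]. *)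
Lemma CkZ_derive U (f : V3 -> R) x v : open U -> is_Ck 1 U f -> U x ->
  is_derive x v f (\sum_i 'D_(e i) f x * v i 0).
Proof.
move=> oU fC Ux; apply: (@is_derive_comp3 _ _ _ (fun i => 'D_(e i) f) id).
- by apply: (@open_near U) => // y Uy i; exact: Ck_is_derive fC Uy.
- by move=> i; exact: Ck_cont (Ck_D i fC) Ux.
- by move=> i; exact: is_derive_coord.
Qed.

End Ck.

(** * Symmetry of second derivatives *)

Section Schwarz.
Variable R : realType.
Local Notation V3 := 'cV[R]_3.
Local Notation e := (canon_basis R).

Lemma half_bounds (r : R) : 0 < r -> 0 < r / 2 < r.
Proof. by move=> r0; rewrite divr_gt0//= ltr_pdivrMr// ltr_pMr ?ltr1n. Qed.

(** The left side is the increment in coordinate [i] of an increment in coordinate [j]; the mean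
    value theorem in direction [i], then in direction [j], turns it into a second derivative. *)
Lemma second_difference (f : V3 -> R) (x : V3) i j (r h : R) :
  i != j -> 0 < h < r -> is_Ck 2 (box x r) f ->
  exists2 z, box x r z &
    f (upd (upd x i (x i 0 + h)) j (x j 0 + h)) - f (upd x i (x i 0 + h)) -
    (f (upd x j (x j 0 + h)) - f x) = 'D_(e j) ('D_(e i) f) z * h * h.
Proof.
move=> ij /andP[h0 hr] fC.
have hd k u : btw (x k 0) (x k 0 + h) u -> `|u - x k 0| < r.
  by move=> /btw_dist /le_lt_trans; apply; rewrite addrC addKr gtr0_norm.
have xr : box x r x by apply: box_center; exact: lt_trans h0 hr.
have hr' k : `|x k 0 + h - x k 0| < r by apply: hd; exact: btw_r.
pose F s := f (upd (upd x i s) j (x j 0 + h)) - f (upd x i s).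
pose dF s := 'D_(e i) f (upd (upd x i s) j (x j 0 + h)) - 'D_(e i) f (upd x i s).
have [u ub|c cb] := @MVT_btw _ F dF (x i 0) (x i 0 + h).
  apply: is_deriveB; last first.
    apply/is_derive_line; apply: Ck_is_derive (CkS fC) _.
    by apply: box_upd => //; exact: hd.
  rewrite updC// (_ : (fun s => _) = (fun s => f (upd (upd x j (x j 0 + h)) i s))).
    apply/is_derive_line; apply: Ck_is_derive (CkS fC) _.
    by apply: box_upd; [exact: box_upd|exact: hd].
  by apply/funext => s; rewrite updC.
rewrite /F /dF upd_id.
have cr : box x r (upd x i c) by apply: box_upd => //; exact: hd.
have cj : upd x i c j 0 = x j 0 by rewrite updE eq_sym (negbTE ij).
have [|d db] := @MVT_upd _ ('D_(e i) f) ('D_(e j) ('D_(e i) f)) (upd x i c) j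
    (x j 0) (x j 0 + h).
  move=> u ub; apply: Ck_is_derive (Ck_D i fC) _.
  by apply: box_upd => //; exact: hd.
have -> : upd (upd x i c) j (x j 0) = upd x i c by rewrite -cj upd_id.
move=> -> ->; exists (upd (upd x i c) j d).
  by apply: box_upd => //; exact: hd.
by ring.
Qed.

Lemma eq_of_near_eq (A B : V3 -> R) x :
  {for x, continuous A} -> {for x, continuous B} ->
  (forall r : R, 0 < r -> exists z w, [/\ box x r z, box x r w & A w = B z]) ->
  A x = B x.
Proof.
move=> cA cB H; apply/eqP; rewrite -subr_eq0; apply/negPn/negP => ne0.
have eps0 : 0 < `|A x - B x| / 2 by rewrite divr_gt0 // normr_gt0.
move/cvgrPdist_lt: cA => /(_ _ eps0) /nbhs_boxP[rA rA0 hA].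
move/cvgrPdist_lt: cB => /(_ _ eps0) /nbhs_boxP[rB rB0 hB].
have r0 : 0 < Num.min rA rB by rewrite lt_min rA0.
have [z [w [zr wr E]]] := H _ r0.
have /hA /= H1 : box x rA w by apply: sub_box wr; rewrite ge_min lexx.
have /hB /= H2 : box x rB z by apply: sub_box zr; rewrite ge_min lexx orbT.
move: H2; rewrite -E distrC => H2.
have := le_lt_trans (ler_normD (A x - A w) (A w - B x)) (ltrD H1 H2).
by rewrite addrA subrK -splitr ltxx.
Qed.

(** The second difference is symmetric in [i] and [j], so one iterated derivative at [z] equals the
    other at [w], with [z] and [w] arbitrarily near [x]; continuity concludes. *)
Lemma schwarz (U : set V3) (f : V3 -> R) x i j : open U -> is_Ck 2 U f -> U x ->
  'D_(e i) ('D_(e j) f) x = 'D_(e j) ('D_(e i) f) x.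
Proof.
move=> oU fC Ux; have [->//|ij] := eqVneq i j.
have ji : j != i by rewrite eq_sym.
apply: (eq_of_near_eq (Ck_cont (Ck_D i (Ck_D j fC)) Ux)
  (Ck_cont (Ck_D j (Ck_D i fC)) Ux)).
move=> r r0; have /nbhs_boxP[rU rU0 hU] : nbhs x U by exact: open_nbhs_nbhs.
have s0 : 0 < Num.min rU r by rewrite lt_min rU0.
have sU : box x (Num.min rU r) `<=` U.
  by apply: subset_trans hU; apply: sub_box; rewrite ge_min lexx.
have sr : box x (Num.min rU r) `<=` box x r.
  by apply: sub_box; rewrite ge_min lexx orbT.
have h2 := half_bounds s0.
have [z /sr zr E1] := second_difference ij h2 (Ck_sub sU fC).
have [w /sr wr E2] := second_difference ji h2 (Ck_sub sU fC).
exists z, w; split; [exact: zr|exact: wr|].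
have h0 : Num.min rU r / 2 != 0 by case/andP: h2 => /lt0r_neq0.
move: E1 E2 h0; rewrite (updC _ _ _ ji).
move: ('D_(e j) _ z) ('D_(e i) _ w) (Num.min rU r / 2) => p q h E1 E2 h0.
apply: (mulIf h0); apply: (mulIf h0); rewrite -E1 -E2.
by move: (f _) (f _) (f _) (f _) => a b c d; ring.
Qed.

End Schwarz.

(** * Primitives along a coordinate *)

Section Primitive.
Variable R : realType.
Local Notation V3 := 'cV[R]_3.
Local Notation e := (canon_basis R).

Lemma MVT_bound (g dg : R -> R) (s t M : R) :
  (forall u, btw s t u -> is_derive u 1 g (dg u)) ->
  (forall u, btw s t u -> `|dg u| <= M) -> `|g t - g s| <= M * `|t - s|.
Proof.
move=> gD gM; have [c cb ->] := MVT_btw gD.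
by rewrite normrM ler_wpM2r// gM.
Qed.

Lemma primitive_unique (P Q h : R -> R) (a t : R) :
  (forall u, btw a t u -> is_derive u 1 P (h u)) ->
  (forall u, btw a t u -> is_derive u 1 Q (h u)) ->
  P a = Q a -> P t = Q t.
Proof.
move=> PD QD PQ; have D0 u : btw a t u -> is_derive u 1 (P - Q) 0.
  move=> ub; rewrite -(subrr (h u)); apply: is_deriveB; [exact: PD|exact: QD].
have [c _] := @MVT_btw _ (P - Q) (fun=> 0) a t D0.
rewrite mul0r => /eqP; rewrite subr_eq0 => /eqP.
rewrite -![(P - Q) _]/(P _ - Q _) PQ subrr => /eqP.
by rewrite subr_eq0 => /eqP.
Qed.

Lemma primitive_segment (h : R -> R) (l r : R) :
  (forall t, l <= t <= r -> {for t, continuous h}) ->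
  exists P : R -> R, forall t, l < t < r -> is_derive t 1 P (h t).
Proof.
move=> hC; pose F x := (\int[lebesgue_measure]_(t in [set` `[l, x]]) (h t))%R.
exists F => t /andP[lt tr].
have hI : lebesgue_measure.-integrable `[l, r] (EFin \o h).
  apply: continuous_compact_integrable; first exact: segment_compact.
  apply: continuous_in_subspaceT => x; rewrite inE/= in_itv/=; exact: hC.
have [] := continuous_FTC1_closed tr hI lt (hC t _).
  by rewrite !ltW.
by rewrite derive1E => H1 H2; split.
Qed.

(** [h] need not be integrable up to the ends, so integrals over compact subsegments are normalized
    at [a] and glued by uniqueness. *)
Lemma primitive_itv (h : R -> R) (l r a : R) : l < a < r ->
  (forall t, l < t < r -> {for t, continuous h}) ->
  exists2 P : R -> R, P a = 0 & forall t, l < t < r -> is_derive t 1 P (h t).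
Proof.
move=> lar hC.
have K t : exists P : R -> R, l < t < r -> [/\ P a = 0,
    forall u, btw a t u -> is_derive u 1 P (h u) &
    \forall s \near t, forall u, btw a s u -> is_derive u 1 P (h u)].
  have [ltr|] := boolP (l < t < r); last by exists (cst 0).
  (* Halfway to the ends, so that [a] and [t] are both interior to a segment on which [h] is
     continuous. *)
  pose l' := (l + Num.min a t) / 2; pose r' := (r + Num.max a t) / 2.
  have [P PD] : exists P : R -> R, forall t, l' < t < r' -> is_derive t 1 P (h t).
    apply: primitive_segment => u; rewrite /l' /r' => ur; apply: hC.
    by case: (leP a t) ur; lra.
  have lr' : [/\ l' < a, a < r', l' < t & t < r'].
    by rewrite /l' /r'; case: (leP a t); split; lra.
  have P'D u : l' < u < r' -> is_derive u 1 (fun s => P s - P a) (h u).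
    move=> /PD H; rewrite -[h u]subr0.
    exact: (is_deriveB H (is_derive_cst _ _ _)).
  exists (fun s => P s - P a) => _; split; first by rewrite subrr.
    by move=> u ub; apply: P'D; case: lr'; move: ub; rewrite /btw; lra.
  have : \forall s \near t, s \in `]l', r'[%R.
    by apply: near_in_itvoo; rewrite in_itv/=; case: lr' => _ _ -> ->.
  apply: filterS => s; rewrite in_itv/= => sr u ub; apply: P'D.
  by case: lr'; move: ub sr; rewrite /btw; lra.
have [Q QP] := choice K.
(* Near [t] this diagonal agrees with [Q t], since all the primitives vanish at [a]. *)
exists (fun t => Q t t).
  by have [] := QP a lar.
move=> t ltr; have [Qa QD QN] := QP t ltr.
apply: (@near_eq_is_derive _ _ _ (Q t)); last by apply: QD; exact: btw_r.
have : \forall s \near t, s \in `]l, r[%R.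
  by apply: near_in_itvoo; rewrite in_itv/=.
apply: filterS2 QN => s QsD; rewrite in_itv/= => lsr.
have [Qsa QsD' _] := QP s lsr.
by apply: (primitive_unique QsD QsD'); rewrite Qa.
Qed.

(** A Heine argument around a compact curve: [z] may lie off the curve, which makes the estimate fit
    for comparing neighbouring lines. *)
Lemma uniform_on_curve (H : V3 -> R) (g : R -> V3) (l r : R) :
  {in `[l, r], continuous g} ->
  (forall s, l <= s <= r -> {for g s, continuous H}) ->
  forall eps : R, 0 < eps -> exists2 d : R, 0 < d &
    forall s z, l <= s <= r -> box (g s) d z -> `|H z - H (g s)| < eps.
Proof.
move=> gC HC eps eps0.
have /compact_near_coveringP cov := @segment_compact R l r.
have : \forall d \near (0 : R)^'+, `[l, r]%classic `<=`
    (fun s => forall z, box (g s) d z -> `|H z - H (g s)| < eps).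
  apply: cov => s; rewrite /= in_itv/= => lsr.
  have eps20 : 0 < eps / 2 by rewrite divr_gt0.
  move/cvgrPdist_lt: (HC s lsr) => /(_ _ eps20) /nbhs_boxP[rho rho0 rhoP].
  have rho20 : 0 < rho / 2 by rewrite divr_gt0.
  have gN : \forall s' \near s, box (g s) (rho / 2) (g s').
    by apply: gC; [rewrite in_itv|exact: nbhs_box].
  have dN : \forall d \near (0 : R)^'+, d < rho / 2 by exact: nbhs_right_lt.
  near=> s' d => z zb.
  have gs' : box (g s) (rho / 2) (g s') by near: s'.
  have dr : d < rho / 2 by near: d.
  have zr : box (g s) rho z.
    move=> k; rewrite -(subrKA (g s' k 0)) (splitr rho).
    by apply: le_lt_trans (ler_normD _ _) _; rewrite ltrD// (lt_trans (zb k)).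
  have gr : box (g s) rho (g s').
    by apply: sub_box gs'; rewrite ler_pdivrMr// ler_peMr ?ler1n// ltW.
  rewrite -(subrKA (H (g s))) (splitr eps).
  apply: le_lt_trans (ler_normD _ _) _; rewrite ltrD//; last exact: rhoP.
  by rewrite distrC; exact: rhoP.
move=> dP; have [d [d0 {}dP]] : exists d : R, 0 < d /\ `[l, r]%classic `<=`
    (fun s => forall z, box (g s) d z -> `|H z - H (g s)| < eps).
  near (0 : R)^'+ => d; exists d; split.
    by near: d; exact: nbhs_right_gt.
  by near: d.
by exists d => // s z lsr; apply: dP; rewrite /= in_itv.
Unshelve. all: by end_near. Qed.

Lemma uniform_on_btw (H : V3 -> R) (g : R -> V3) (s t : R) :
  (forall u, btw s t u -> {for u, continuous g}) ->
  (forall u, btw s t u -> {for g u, continuous H}) ->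
  forall eps : R, 0 < eps -> exists2 d : R, 0 < d &
    forall u z, btw s t u -> box (g u) d z -> `|H z - H (g u)| < eps.
Proof.
move=> gC HC eps eps0.
have E u : btw s t u = (Num.min s t <= u <= Num.max s t).
  by rewrite /btw; case: (leP s t); lra.
have [u|u|d d0 dP] := @uniform_on_curve H g (Num.min s t) (Num.max s t) _ _ _ eps0.
- by rewrite in_itv/= -E => /gC.
- by rewrite -E => /HC.
- by exists d => // u z; rewrite E; exact: dP.
Qed.

(** A relation instead of an integral: continuity and differentiation in the parameters then follow
    from mean value bounds alone. *)
Definition is_prim i (a : V3) (rho : R) (H P : V3 -> R) :=
  (forall x, box a rho x -> x i 0 = a i 0 -> P x = 0) /\
  (forall x, box a rho x -> is_derive x (e i) P (H x)).

Lemma box_line i (a x : V3) (rho u : R) :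
  box a rho x -> btw (a i 0) (x i 0) u -> box a rho (upd x i u).
Proof.
move=> xr ub; apply: box_upd => //; apply: btw_ltr ub _ (xr i).
by rewrite subrr normr0; exact: le_lt_trans (normr_ge0 _) (xr i).
Qed.

Lemma upd_line_continuous (x : V3) i : continuous (fun t : R => upd x i t).
Proof.
move=> t; apply: upd_continuous; last by exact: cvg_id.
exact: cst_continuous.
Qed.

Lemma is_prim_exists i a (rho : R) (H : V3 -> R) : 0 < rho ->
  (forall x, box a rho x -> {for x, continuous H}) ->
  exists P, is_prim i a rho H P.
Proof.
move=> rho0 HC.
have K (x : V3) : exists P : R -> R, (forall k, k != i -> `|x k 0 - a k 0| < rho) ->
    P (a i 0) = 0 /\ forall t, a i 0 - rho < t < a i 0 + rho ->
      is_derive t 1 P (H (upd x i t)).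
  case: (pselect (forall k, k != i -> `|x k 0 - a k 0| < rho)) => [xr|nxr];
    last by exists (cst 0).
  have [||P Pa PD] := @primitive_itv (fun t => H (upd x i t))
    (a i 0 - rho) (a i 0 + rho) (a i 0).
  - by rewrite ltrBlDr ltrDl rho0.
  - move=> t tr; apply: (@continuous_comp _ _ _ (fun t : R => upd x i t) H).
      exact: upd_line_continuous.
    apply: HC => k; rewrite updE; case: eqP => [->|/eqP]; last exact: xr.
    by rewrite ltr_distl.
  - by exists P.
have [Q QP] := choice K.
(* Indexing by the foot of [x] on the hyperplane through [a] gives all points of one [i]-line the
   same primitive. *)
pose x0 (x : V3) := upd x i (a i 0).
exists (fun x => Q (x0 x) (x i 0)); split.
  move=> x xr xa; rewrite xa; apply: (QP (x0 x) _).1 => k ki.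
  by rewrite updE (negbTE ki).
move=> x xr; rewrite -[x in is_derive x](upd_id x i); apply/is_derive_line.
have [|_ /(_ (x i 0))] := QP (x0 x).
  by move=> k ki; rewrite updE (negbTE ki).
rewrite upd_upd upd_id -ltr_distl => /(_ (xr i)).
have -> // : (fun t : R => Q (x0 (upd x i t)) (upd x i t i 0)) = Q (x0 x).
by apply/funext => t; rewrite /x0 upd_upd upd_same.
Qed.

Lemma is_prim_line i a (rho : R) H P x : is_prim i a rho H P -> box a rho x ->
  forall u, btw (a i 0) (x i 0) u ->
  is_derive u 1 (fun t => P (upd x i t)) (H (upd x i u)).
Proof.
move=> [_ PD] xr u ub; apply/is_derive_line; apply: PD; exact: box_line ub.
Qed.

Lemma is_prim_base i a rho H P x : is_prim i a rho H P -> box a rho x ->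
  P (upd x i (a i 0)) = 0.
Proof.
move=> [P0 _] xr; apply: P0; rewrite ?upd_same//.
by apply: box_line => //; exact: btw_l.
Qed.

(** From [x] to [y], change the line and then move on it: the motion costs at most [M] times its
    length ([B1]), and the change of line costs the length of the segment times the uniform
    difference of [H] ([B2]). *)
Lemma is_prim_continuous i a (rho : R) (H P : V3 -> R) : is_prim i a rho H P ->
  (forall x, box a rho x -> {for x, continuous H}) ->
  forall x, box a rho x -> {for x, continuous P}.
Proof.
move=> PP HC x xr; apply/continuous_epsP => eps eps0.
have rho0 : 0 < rho by exact: le_lt_trans (normr_ge0 _) (xr i).
pose M := `|H x| + 1.
have M0 : 0 < M by rewrite ltr_wpDl.
have /(HC x xr)/= HM : nbhs (H x) [set y | `|y| < M].
  apply/nbhs_ballP; exists 1 => //= y; rewrite /ball/= => yH.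
  rewrite -(subrK (H x) y) /M addrC; apply: le_lt_trans (ler_normD _ _) _.
  by rewrite ltrD2l distrC.
have /nbhs_boxP[r r0 rP] : nbhs x (box a rho `&` [set y | `|H y| < M]).
  by apply: filterI => //; apply: open_nbhs_nbhs; split => //; exact: open_box.
have e20 : 0 < eps / 2 by rewrite divr_gt0.
have e30 : 0 < eps / 2 / rho by rewrite divr_gt0.
have [u ub|u ub|d d0 dP] :=
    @uniform_on_btw H (fun t => upd x i t) (a i 0) (x i 0) _ _ _ e30.
- exact: upd_line_continuous.
- by apply: HC; exact: box_line ub.
have : \forall y \near x, [/\ box x r y, box x d y &
    `|(y : V3) i 0 - x i 0| < eps / 2 / M].
  near=> y; split; near: y; try exact: nbhs_box.
  by apply: near_coord; rewrite divr_gt0.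
apply: filterS => y [yr yd yM].
have ya : box a rho y by have [] := rP y yr.
have zr : box a rho (upd y i (x i 0)).
  by apply: box_upd; [exact: ya|exact: xr].
have B1 : `|P y - P (upd y i (x i 0))| < eps / 2.
  rewrite -[in P y](upd_id y i).
  have Py u : btw (x i 0) (y i 0) u -> box x r (upd y i u).
    move=> ub; apply: box_upd => //.
    by apply: le_lt_trans (btw_dist ub) (yr i).
  apply: le_lt_trans (@MVT_bound (fun t => P (upd y i t))
    (fun t => H (upd y i t)) (x i 0) (y i 0) M _ _) _.
  - by move=> u /Py/rP[ur _]; apply/is_derive_line; case: PP => _; exact.
  - by move=> u /Py/rP[_ /ltW].
  - by rewrite mulrC -ltr_pdivlMr.
have B2 : `|P (upd y i (x i 0)) - P x| < eps / 2.
  have := @MVT_bound (fun t => P (upd y i t) - P (upd x i t))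
    (fun t => H (upd y i t) - H (upd x i t)) (a i 0) (x i 0) (eps / 2 / rho) _ _.
  rewrite (is_prim_base PP ya) (is_prim_base PP xr) subrr subr0 upd_id => B.
  apply: le_lt_trans (B _ _) _.
  - move=> u ub; apply: is_deriveB; last exact: (is_prim_line PP xr ub).
    have := is_prim_line PP zr; rewrite upd_same => /(_ u ub).
    rewrite upd_upd; have -> // : (fun t : R => P (upd (upd y i (x i 0)) i t)) =
      (fun t => P (upd y i t)) by apply/funext => t; rewrite upd_upd.
  - move=> u ub; apply: ltW; apply: dP => // k; rewrite !updE.
    by case: eqP => _; rewrite ?subrr ?normr0 ?yd.
  - by rewrite mulrAC ltr_pdivrMr// ltr_pM2l// xr.
rewrite -(subrKA (P (upd y i (x i 0)))) (splitr eps).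
by apply: le_lt_trans (ler_normD _ _) _; rewrite ltrD.
Unshelve. all: by end_near. Qed.

(** Differentiation under the integral sign. The defect [P y - P x - h * Q x] vanishes on the base
    hyperplane, and its derivative along [i] is small compared to [h], uniformly on the segment, by
    the mean value theorem for [H] in direction [k]. *)
Lemma is_prim_derive i k a rho (H P Q : V3 -> R) : k != i -> 
  is_Ck 1 (box a rho) H -> is_prim i a rho H P ->
  is_prim i a rho ('D_(e k) H) Q ->
  forall x, box a rho x -> is_derive x (e k) P (Q x).
Proof.
move=> ki HC PP PQ x xr; apply/is_derive_epsP => eps eps0.
have rho0 : 0 < rho by exact: le_lt_trans (normr_ge0 _) (xr i).
have e30 : 0 < eps / rho by rewrite divr_gt0.
have [u ub|u ub|d d0 dP] :=
    @uniform_on_btw ('D_(e k) H) (fun t => upd x i t) (a i 0) (x i 0) _ _ _ e30.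
- exact: upd_line_continuous.
- by apply: Ck_cont (Ck_D k HC) _; exact: box_line ub.
have r10 : 0 < rho - `|x k 0 - a k 0| by rewrite subr_gt0.
have N1 : \forall h \near (0 : R), `|h| < d by exact: nbhs0_lt.
have N2 : \forall h \near (0 : R), `|h| < rho - `|x k 0 - a k 0| by exact: nbhs0_lt.
apply: filterS2 N1 N2 => h hd hr.
rewrite add_basis; set y := upd x k (x k 0 + h).
have yr : box a rho y.
  apply: box_upd => //; rewrite addrAC; apply: le_lt_trans (ler_normD _ _) _.
  by rewrite -ltrBrDl.
have yi : y i 0 = x i 0 by rewrite updE eq_sym (negbTE ki).
have yE t : upd y i t = upd (upd x i t) k (x k 0 + h).
  by rewrite /y (updC _ _ _ ki).
have := @MVT_bound (fun t => P (upd y i t) - P (upd x i t) - h * Q (upd x i t))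
  (fun t => H (upd y i t) - H (upd x i t) - h * 'D_(e k) H (upd x i t))
  (a i 0) (x i 0) (eps / rho * `|h|) _ _.
rewrite (is_prim_base PP yr) (is_prim_base PP xr) (is_prim_base PQ xr).
rewrite -[in upd y i (x i 0)]yi !upd_id mulr0 !subr0 => B.
apply: le_trans (B _ _) _.
- move=> u ub; apply: is_deriveB.
    apply: is_deriveB; last exact: (is_prim_line PP xr ub).
    by apply: (is_prim_line PP yr); rewrite yi.
  have := is_deriveZ h (is_prim_line PQ xr ub).
  exact.
- move=> u ub; rewrite yE.
  have xur := box_line xr ub.
  have xuk : upd x i u k 0 = x k 0 by rewrite updE (negbTE ki).
  have vb v : btw (x k 0) (x k 0 + h) v -> `|v - x k 0| <= `|h|.
    by move=> /btw_dist; rewrite addrAC subrr add0r.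
  have [v vbv|v vbv] := @MVT_upd _ H ('D_(e k) H) (upd x i u) k (x k 0) (x k 0 + h).
    apply: Ck_is_derive HC _; apply: box_upd => //.
    apply: (btw_ltr vbv); first exact: xr.
    by have := yr k; rewrite upd_same.
  have -> : upd (upd x i u) k (x k 0) = upd x i u by rewrite -xuk upd_id.
  move=> ->; have -> : x k 0 + h - x k 0 = h by ring.
  rewrite [X in X - _]mulrC -mulrBr normrM mulrC ler_wpM2r//.
  apply/ltW/dP => // l; rewrite [upd (upd _ _ _) _ _ _ _]updE.
  case: eqP => [->|_]; last by rewrite subrr normr0.
  by rewrite xuk; exact: le_lt_trans (vb _ vbv) hd.
- by rewrite mulrAC ler_wpM2r// -mulrA ler_piMr ?(ltW eps0)//
    mulrC ler_pdivrMr// mul1r ltW.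
Qed.

(** Along [i] the derivative of [P] is [H]; along [l != i] it is a primitive of ['D_(e l) H], to
    which the induction applies. *)
Lemma is_prim_Ck k i a (rho : R) (H P : V3 -> R) : 0 < rho ->
  is_Ck k (box a rho) H -> is_prim i a rho H P -> is_Ck k (box a rho) P.
Proof.
move=> rho0; elim: k H P => [|k IH] H P HC PP.
  by split=> //; apply: is_prim_continuous PP _ => x; exact: Ck_cont HC.
have K l : exists Q, l != i -> is_prim i a rho ('D_(e l) H) Q.
  have [Q QP] := @is_prim_exists i a rho ('D_(e l) H) rho0
    (fun x => Ck_cont (Ck_D l HC)).
  by exists Q.
have [Q QP] := choice K.
apply: (@Ck_intro _ _ _ _ _ (fun l => if l == i then H else Q l)).
- exact: open_box.
- by apply: is_prim_continuous PP _ => x; exact: Ck_cont HC.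
- move=> l x xr; case: eqP => [->|/eqP li]; first by case: PP => _; exact.
  have HC1 : is_Ck 1 (box a rho) H.
    by elim: (k) HC => // n IHn /CkS.
  exact: is_prim_derive li HC1 PP (QP _ li) x xr.
- move=> l; case: eqP => [_|/eqP li]; first exact: CkS.
  by apply: IH (QP _ li); exact: Ck_D.
Qed.

End Primitive.

(** * Inverting a change of one coordinate *)

Section InverseFunction.
Variable R : realType.
Local Notation V3 := 'cV[R]_3.
Local Notation e := (canon_basis R).

(** Here [D] is the increment of an implicit function, and the error bound involves [D] itself. The
    first entry of the minimum absorbs it, giving [|D| <= K * |h|]; the second then gives the
    tolerance [eps']. *)
Lemma quotient_estimate (p c D h eps' : R) : p != 0 -> 0 < eps' ->
  `|p * D - h * c| <=
    Num.min (`|p| / 2) (eps' * (`|p| / (2 * (`|c| / `|p| + 1) + 1))) *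
    (`|D| + `|h|) ->
  `|D - h * (c / p)| <= eps' * `|h|.
Proof.
move=> p0 eps0; set K := 2 * (`|c| / `|p| + 1).
have pp : 0 < `|p| by rewrite normr_gt0.
have cp : 0 <= `|c| / `|p| by rewrite divr_ge0.
have K0 : 0 < K + 1 by rewrite /K; lra.
set eps := Num.min _ _ => H.
have e1 : eps <= `|p| / 2 by rewrite ge_min lexx.
have e2 : eps <= eps' * (`|p| / (K + 1)) by rewrite ge_min lexx orbT.
have eps1 : 0 < eps.
  by rewrite lt_min divr_gt0//= mulr_gt0// divr_gt0.
have DK : `|D| <= K * `|h|.
  have H1 : `|p| * `|D| <= `|h| * `|c| + `|p| / 2 * (`|D| + `|h|).
    rewrite -normrM; have -> : p * D = h * c + (p * D - h * c) by ring.
    apply: le_trans (ler_normD _ _) _; rewrite normrM lerD//.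
    by apply: le_trans H _; rewrite ler_wpM2r// addr_ge0.
  have H2 : `|p| * (`|D| / 2) <= `|p| * ((`|c| / `|p| + 1) * `|h|).
    have -> : `|p| * ((`|c| / `|p| + 1) * `|h|) = `|h| * `|c| + `|p| * `|h|.
      by field; rewrite gt_eqF.
    have : 0 <= `|p| * `|h| by rewrite mulr_ge0.
    lra.
  by move: H2; rewrite ler_pM2l// /K => H2; lra.
have -> : D - h * (c / p) = (p * D - h * c) / p by field.
rewrite normrM normfV ler_pdivrMr//; apply: le_trans H _.
apply: (@le_trans _ _ (eps * ((K + 1) * `|h|))).
  by rewrite (ler_wpM2l (ltW eps1))// mulrDl mul1r lerD2r.
apply: (@le_trans _ _ (eps' * (`|p| / (K + 1)) * ((K + 1) * `|h|))).
  by rewrite ler_wpM2r// mulr_ge0// ltW.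
rewrite le_eqVlt; apply/orP; left; apply/eqP.
by field; rewrite gt_eqF.
Qed.

Lemma quotient_tolerance_gt0 (p c eps' : R) : p != 0 -> 0 < eps' ->
  0 < Num.min (`|p| / 2) (eps' * (`|p| / (2 * (`|c| / `|p| + 1) + 1))).
Proof.
move=> p0 eps0; have pp : 0 < `|p| by rewrite normr_gt0.
have cp : 0 <= `|c| / `|p| by rewrite divr_ge0.
have K0 : 0 < 2 * (`|c| / `|p| + 1) + 1 by lra.
by rewrite lt_min divr_gt0//= mulr_gt0// divr_gt0.
Qed.

(** [f + A] and [f - B] lie on opposite sides of [f], at distance at least [m], whatever the sign of
    [p]; perturbations below [m / 2] keep the order, as the intermediate value theorem requires. *)
Lemma bracket (p A B m : R) :
  p != 0 -> 0 < m -> 0 < A * p -> 0 < B * p -> m <= `|A| -> m <= `|B| ->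
  forall z zp zm f, `|z - f| < m / 2 -> `|zp - (f + A)| < m / 2 ->
  `|zm - (f - B)| < m / 2 -> Num.min zm zp <= z <= Num.max zm zp.
Proof.
move=> p0 m0; have [p_gt0|p_lt0|p_eq0] := ltgtP 0 p; last first.
- by rewrite -p_eq0 eqxx in p0.
- rewrite !nmulr_lgt0// => A0 B0; rewrite !ltr0_norm// => mA mB z zp zm f.
  rewrite !ltr_distl => /andP[? ?] /andP[? ?] /andP[? ?].
  by rewrite ge_min le_max; apply/andP; split; apply/orP; [right|left]; lra.
- rewrite !pmulr_lgt0// => A0 B0; rewrite !gtr0_norm// => mA mB z zp zm f.
  rewrite !ltr_distl => /andP[? ?] /andP[? ?] /andP[? ?].
  by rewrite ge_min le_max; apply/andP; split; apply/orP; [left|right]; lra.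
Qed.

Lemma cvg_basis_ray (z : V3) k : z + h *: e k @[h --> (0 : R)] --> z.
Proof.
have -> : (fun h : R => z + h *: e k) = (fun h => upd z k (z k 0 + h)).
  by apply/funext => h; rewrite add_basis.
rewrite -[X in _ --> X](upd_id z k) -[X in upd _ _ X]addr0.
apply: (@upd_continuous _ _ (fun=> z) (fun h => z k 0 + h)).
  exact: cst_continuous.
by apply: cvgD; [exact: cvg_cst|exact: cvg_id].
Qed.

Variables (f : V3 -> R) (a : V3) (rho : R) (j : 'I_3).
Hypothesis rho0 : 0 < rho.
Hypothesis fC : forall k, is_Ck k (box a rho) f.
Variable p : R.
Hypothesis p0 : p != 0.
(** [p] stands for the derivative at the centre: along each [j]-line [f] is strictly monotone, with
    slope at least [|p| / 2] in absolute value. *)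
Hypothesis fj : forall x, box a rho x -> `|'D_(e j) f x - p| <= `|p| / 2.

Let theta x := upd x j (f x).

Let fj_pos x : box a rho x ->
  0 < 'D_(e j) f x * p /\ `|p| / 2 <= `|'D_(e j) f x|.
Proof.
move/fj; move: ('D_(e j) f x : R) => q; have [pp|pn|pe] := ltgtP 0 p; last first.
- by move: p0; rewrite -pe eqxx.
- rewrite ler_norml (ltr0_norm pn) => /andP[H1 H2].
  have qn : q < 0 by lra.
  by rewrite (ltr0_norm qn) nmulr_lgt0//; split; lra.
- rewrite ler_norml (gtr0_norm pp) => /andP[H1 H2].
  have qn : 0 < q by lra.
  by rewrite (gtr0_norm qn) pmulr_lgt0//; split; lra.
Qed.

Let fD x k : box a rho x -> is_derive x (e k) f ('D_(e k) f x).
Proof. exact: Ck_is_derive (fC 1). Qed.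

Let fmvt x s t : box a rho x -> `|s - a j 0| < rho -> `|t - a j 0| < rho ->
  exists2 c, btw s t c /\ box a rho (upd x j c) &
    f (upd x j t) - f (upd x j s) = 'D_(e j) f (upd x j c) * (t - s).
Proof.
move=> xr sr tr; have B u : btw s t u -> box a rho (upd x j u).
  by move=> ub; apply: box_upd => //; exact: btw_ltr ub sr tr.
have [u /B/fD|c cb E] := @MVT_upd _ f ('D_(e j) f) x j s t; first exact.
by exists c => //; split => //; exact: B.
Qed.

(** Points with the same image lie on one [j]-line, where [f] is injective. *)
Let theta_inj x y : box a rho x -> box a rho y -> theta x = theta y -> x = y.
Proof.
move=> xr yr E; have xy : upd x j (y j 0) = y.
  apply/colP => k; move/colP: E => /(_ k); rewrite !updE.
  by case: eqP => [->|].
have [c [_ /fj_pos[cp _]]] := fmvt xr (xr j) (yr j).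
rewrite xy upd_id; move/colP: E => /(_ j); rewrite !upd_same => ->.
rewrite subrr => /esym/eqP; rewrite mulf_eq0 => /orP[/eqP E|/eqP E].
  by rewrite E mul0r ltxx in cp.
by rewrite -xy -(subrK (x j 0) (y j 0)) E add0r upd_id.
Qed.

(** An application of the intermediate value theorem on the [j]-line of [z]. Thanks to the bound on
    [s - x j 0] it yields both the openness of the image and the continuity of the inverse. *)
Let theta_solve x eps : box a rho x -> 0 < eps ->
  \forall z \near theta x, exists s, [/\ `|s - x j 0| < eps,
    box a rho (upd z j s) & f (upd z j s) = (z : V3) j 0].
Proof.
move=> xr eps0.
have r10 : 0 < rho - `|x j 0 - a j 0| by rewrite subr_gt0.
(* Less than [eps] and than the distance from [x] to the faces of the box in direction [j]: the ends
   [x j 0 - eta] and [x j 0 + eta] stay inside. *)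
pose eta := Num.min eps (rho - `|x j 0 - a j 0|) / 2.
have m0 : 0 < Num.min eps (rho - `|x j 0 - a j 0|) by rewrite lt_min eps0.
have [eta0 etam] := andP (half_bounds m0); rewrite -/eta in eta0 etam.
have eta1 : eta < eps by apply: lt_le_trans etam _; rewrite ge_min lexx.
have eta2 : eta < rho - `|x j 0 - a j 0|.
  by apply: lt_le_trans etam _; rewrite ge_min lexx orbT.
clearbody eta; clear m0 etam.
have etar s : `|s - x j 0| <= eta -> `|s - a j 0| < rho.
  move=> sx; rewrite -(subrKA (x j 0)).
  apply: le_lt_trans (ler_normD _ _) _.
  by rewrite -ltrBrDr; exact: le_lt_trans sx eta2.
have pr : `|x j 0 + eta - a j 0| < rho.
  by apply: etar; rewrite addrAC subrr add0r gtr0_norm.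
have mr : `|x j 0 - eta - a j 0| < rho.
  by apply: etar; rewrite addrAC subrr add0r normrN gtr0_norm.
have [c [_ /fj_pos[cp cm]]] := fmvt xr (xr j) pr.
have [d [_ /fj_pos[dp dm]]] := fmvt xr mr (xr j).
rewrite upd_id (_ : x j 0 - (x j 0 - eta) = eta); last by ring.
rewrite (_ : x j 0 + eta - x j 0 = eta); last by ring.
move: ('D_(e j) f _) ('D_(e j) f _) dp dm cp cm => q q' dp dm cp cm EB EA.
have pp : 0 < `|p| / 2 by rewrite divr_gt0// normr_gt0.
pose m := `|p| / 2 * eta.
have m0 : 0 < m by rewrite mulr_gt0.
have [A0 B0 mA mB] : [/\ 0 < q * eta * p, 0 < q' * eta * p,
    m <= `|q * eta| & m <= `|q' * eta|].
  split; rewrite ?normrM ?(gtr0_norm eta0) ?ler_wpM2r ?(ltW eta0)//;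
  by rewrite mulrAC mulr_gt0.
have br := bracket p0 m0 A0 B0 mA mB.
have m20 : 0 < m / 2 by rewrite divr_gt0.
have xE s : upd (theta x) j s = upd x j s by rewrite upd_upd.
have C s : `|s - a j 0| < rho ->
    \forall z \near theta x, `|f (upd z j s) - f (upd x j s)| < m / 2.
  move=> sr; rewrite -xE.
  have : {for theta x, continuous (fun z => f (upd z j s))}.
    apply: (@continuous_comp _ _ _ (fun z => upd z j s) f).
      by apply: upd_continuous; [exact: cvg_id|exact: cst_continuous].
    by rewrite xE; apply: Ck_cont (fC 0) _; exact: box_upd.
  by move/continuous_epsP; exact.
have N1 := C _ pr; have N2 := C _ mr; have N3 := near_coord (theta x) j m20.
(* The [j]-th coordinate of [theta x] is [f x], which may lie outside the box, so only the other
   coordinates are kept within it. *)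
have N4 : \forall z \near theta x, forall k, k != j ->
    `|(z : V3) k 0 - a k 0| < rho.
  have r20 : 0 < \big[Num.min/rho]_(k | k != j) (rho - `|x k 0 - a k 0|).
    by apply: lt_bigmin => // k _; rewrite subr_gt0.
  apply: filterS (nbhs_box (theta x) r20) => z zb k kj.
  rewrite -(subrKA (x k 0)); apply: le_lt_trans (ler_normD _ _) _.
  rewrite -ltrBrDr; have := zb k; rewrite /theta updE (negbTE kj).
  by move/lt_le_trans; apply; exact: bigmin_le_cond.
near=> z.
have zm : `|f (upd z j (x j 0 - eta)) - (f x - q' * eta)| < m / 2.
  rewrite -EB (_ : f x - _ = f (upd x j (x j 0 - eta))); last by ring.
  by near: z; exact: N2.
have zp : `|f (upd z j (x j 0 + eta)) - (f x + q * eta)| < m / 2.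
  rewrite -EA (_ : f x + _ = f (upd x j (x j 0 + eta))); last by ring.
  by near: z; exact: N1.
have zz : `|z j 0 - f x| < m / 2.
  rewrite -[f x](upd_same x j); near: z; exact: N3.
have zk : forall k, k != j -> `|z k 0 - a k 0| < rho by near: z; exact: N4.
have zb s : `|s - a j 0| < rho -> box a rho (upd z j s).
  by move=> sr k; rewrite updE; case: eqP => [->//|/eqP]; exact: zk.
have xb s : x j 0 - eta <= s <= x j 0 + eta -> `|s - x j 0| <= eta.
  by rewrite ler_distl.
have [||s sb E] := @IVT R (fun s => f (upd z j s)) (x j 0 - eta) (x j 0 + eta)
  (z j 0) _ _ (br _ _ _ _ zz zp zm).
- by rewrite lerBlDr -addrA lerDl addr_ge0 ?ltW.
- apply: continuous_in_subspaceT => s; rewrite inE/= in_itv/= => sb.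
  apply: (@continuous_comp _ _ _ (fun s => upd z j s) f).
    exact: upd_line_continuous.
  by apply: Ck_cont (fC 0) _; apply: zb; apply: etar; exact: xb.
- move: sb; rewrite in_itv/= => /xb sb; exists s; split => //.
    exact: le_lt_trans sb eta1.
  by apply: zb; exact: etar.
Unshelve. all: by end_near. Qed.

Let O := theta @` box a rho.

Let O_solve z s : box a rho (upd z j s) -> f (upd z j s) = z j 0 -> O z.
Proof.
by move=> zr E; exists (upd z j s) => //; rewrite /theta E upd_upd upd_id.
Qed.

Lemma upd_image_open : open O.
Proof.
rewrite openE => _ [x xr <-]; apply: filterS (theta_solve xr ltr01).
by move=> z [s [_ zr]]; exact: O_solve zr.
Qed.

Lemma upd_inverse : exists g : V3 -> R, [/\
  forall z, O z -> box a rho (upd z j (g z)) /\ f (upd z j (g z)) = z j 0,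
  forall x, box a rho x -> g (theta x) = x j 0 &
  forall k, is_Ck k O g].
Proof.
have K z : exists s, O z -> box a rho (upd z j s) /\ f (upd z j s) = z j 0.
  have [[x xr <-]|nO] := pselect (O z); last by exists 0.
  by exists (x j 0); rewrite /theta upd_upd upd_same upd_id.
have [g gP] := choice K; exists g.
have gE z s : O z -> box a rho (upd z j s) -> f (upd z j s) = z j 0 -> g z = s.
  move=> Oz zr E; have [zr' E'] := gP _ Oz.
  have := theta_inj zr zr'; rewrite /theta E E' !upd_upd => /(_ erefl)/colP.
  by move=> /(_ j); rewrite !upd_same.
have gK x : box a rho x -> g (theta x) = x j 0.
  move=> xr; apply: gE; first by exists x.
    by rewrite /theta upd_upd upd_id.
  by rewrite /theta upd_upd upd_id upd_same.
split=> //.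
pose y z := upd z j (g z).
have yr z : O z -> box a rho (y z) by move=> /gP[].
have gC z : O z -> {for z, continuous g}.
  move=> [x xr <-]; apply/continuous_epsP => eps eps0; rewrite gK//.
  apply: filterS (theta_solve xr eps0) => w [s [sx wr E]].
  by rewrite (gE _ s)//; exact: O_solve E.
have yC z : O z -> {for z, continuous y}.
  by move=> Oz; apply: upd_continuous; [exact: cvg_id|exact: gC].
have fj0 z : O z -> 'D_(e j) f (y z) != 0.
  move=> /yr/fj_pos[H _]; apply: contraTneq H => ->.
  by rewrite mul0r ltxx.
(* Obtained by differentiating [f (upd z j (g z)) = z j 0] in direction [k]. *)
pose dg k z := ((k == j)%:R - (k != j)%:R * 'D_(e k) f (y z)) /
               'D_(e j) f (y z).
have gD k z : O z -> is_derive z (e k) g (dg k z).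
  move=> Oz; apply/is_derive_epsP => eps eps0.
  have pz0 := fj0 _ Oz.
  set q := 'D_(e j) f (y z) in pz0.
  set c := (k == j)%:R - (k != j)%:R * 'D_(e k) f (y z).
  set m := Num.min (`|q| / 2) (eps * (`|q| / (2 * (`|c| / `|q| + 1) + 1))).
  have m0 : 0 < m by exact: quotient_tolerance_gt0.
  (* Since [f (y z) = z j 0], the Taylor estimate of [f] at [y z] is an approximate linear equation
     for the increment of [g]. *)
  have T : \forall h \near (0 : R), `|f (y (z + h *: e k)) - f (y z) -
      \sum_i 'D_(e i) f (y z) * (y (z + h *: e k) i 0 - y z i 0)| <=
      m * \sum_i `|y (z + h *: e k) i 0 - y z i 0|.
    have yh : y (z + h *: e k) @[h --> (0 : R)] --> y z.
      by move=> A /(yC _ Oz) /(@cvg_basis_ray z k).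
    apply: (yh [set w | `|f w - f (y z) - \sum_i 'D_(e i) f (y z) * (w i 0 - y z i 0)|
       <= m * \sum_i `|w i 0 - y z i 0|]).
    apply: (@taylor1 _ f (fun i => 'D_(e i) f) (y z) _ _ m m0).
      apply: (open_near (@open_box _ a rho)); first exact: yr.
      by move=> w wr i; exact: fD.
    by move=> i; apply: Ck_cont (Ck_D i (fC 1)) _; exact: yr.
  have ON : \forall h \near (0 : R), O (z + h *: e k).
    apply: cvg_basis_ray; apply: open_nbhs_nbhs; split => //.
    exact: upd_image_open.
  apply: filterS2 T ON => h T Oh.
  apply: quotient_estimate => //; rewrite -/m.
  set D := g (z + h *: e k) - g z.
  have yD i : y (z + h *: e k) i 0 - y z i 0 =
      if i == j then D else if i == k then h else 0.
    rewrite /y !updE; case: eqP => // _; rewrite add_basis updE.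
    by case: eqP => [->|_]; ring.
  have [_ fh] := gP _ Oh; have [_ fz] := gP _ Oz.
  move: T; rewrite fh fz; under eq_bigr do rewrite yD.
  under [X in _ <= _ * X]eq_bigr do rewrite yD.
  rewrite add_basis updE.
  rewrite (bigD1 j)//= eqxx [X in _ <= _ * X](bigD1 j)//= eqxx -/q.
  have [<-|jk] := eqVneq j k.
    rewrite big1 ?addr0 => [|i ij]; last first.
      by rewrite (negbTE ij) mulr0.
    rewrite big1 ?addr0 => [|i ij]; last by rewrite (negbTE ij) normr0.
    rewrite /= mul0r subr0 mulr1 => T.
    have -> : q * D - h = - (z j 0 + h - z j 0 - q * D) by ring.
    by rewrite normrN; apply: le_trans T _; rewrite (ler_wpM2l (ltW m0))// lerDl.
  have kj : k != j by rewrite eq_sym.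
  rewrite (bigD1 k)//= (negbTE kj) eqxx big1 ?addr0; last first.
    by move=> i /andP[ij ik]; rewrite (negbTE ij) (negbTE ik) mulr0.
  rewrite (bigD1 k)//= (negbTE kj) eqxx big1 ?addr0; last first.
    by move=> i /andP[ij ik]; rewrite (negbTE ij) (negbTE ik) normr0.
  rewrite /= mul1r sub0r => T.
  rewrite (_ : q * D - _ = - (z j 0 - z j 0 - (q * D + 'D_(e k) f (y z) * h))).
    by rewrite normrN.
  by move: ('D_(e k) f (y z)) => w; ring.
have OO := upd_image_open.
(* [dg] involves only [g] and derivatives of [f], so a C^k inverse is C^(k+1). *)
elim=> [|k IH]; first by split=> // z; exact: gC.
have yk i : is_Ck k O (fun z => y z i 0).
  apply: (@Ck_eq _ _ _ _ (fun z => if i == j then g z else z i 0)) => //.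
    by move=> z _; rewrite updE.
  by case: eqP => // _; exact: Ck_coord.
have fyk l : is_Ck k O (fun z => 'D_(e l) f (y z)).
  apply: (@Ck_comp _ _ _ _ ('D_(e l) f) y OO (@open_box _ a rho)) => //.
  exact: Ck_D (fC k.+1).
apply: (@Ck_intro _ _ _ _ _ dg) => // l.
apply: CkM => //; last by apply: CkV.
apply: CkB => //; first exact: (@Ck_cst _ R).
by apply: CkM => //; exact: (@Ck_cst _ R).
Qed.

End InverseFunction.

(** * Scalar differential equations with parameters *)

Section Picard.
Variable R : realType.
Local Notation V3 := 'cV[R]_3.
Local Notation e := (canon_basis R).

Lemma geometric_small (K eps : R) : 0 < eps -> exists n, K / 2 ^+ n < eps.
Proof.
move=> eps0; have [n nK] : exists n : nat, K / eps < n%:R.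
  exists (Num.truncn `|K / eps|).+1.
  by apply: le_lt_trans (ler_norm _) _; exact: truncnS_gt.
exists n; rewrite ltr_pdivrMr ?exprn_gt0// mulrC -ltr_pdivrMr//.
by apply: lt_trans nK _; rewrite -natrX ltr_nat ltn_expl.
Qed.

Lemma le_geometric (K x y : R) : (forall n, x <= y + K / 2 ^+ n) -> x <= y.
Proof.
move=> H; rewrite leNgt; apply/negP => yx.
rewrite -subr_gt0 in yx; have [n] := geometric_small K yx.
by rewrite ltrBrDl ltNge H.
Qed.

(** The limit is the supremum of the lower bounds [u n - 2 * C / 2 ^+ n], each of which is below
    every upper bound [u m + 2 * C / 2 ^+ m]; the rate of convergence comes with it. *)
Lemma geometric_limit (u : nat -> R) (C : R) :
  (forall n, `|u n.+1 - u n| <= C / 2 ^+ n) ->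
  exists l, forall n, `|l - u n| <= 2 * C / 2 ^+ n.
Proof.
move=> uC; have H m n : `|u (n + m)%N - u n| <= 2 * C / 2 ^+ n.
  have C0 : 0 <= C.
    by have := uC 0%N; rewrite expr0 divr1; exact: le_trans.
  elim: m n => [|m IH] n.
    by rewrite addn0 subrr normr0 divr_ge0 ?exprn_ge0 ?mulr_ge0.
  rewrite addnS -addSn -(subrKA (u n.+1)).
  apply: le_trans (ler_normD _ _) (le_trans (lerD (IH _) (uC _)) _).
  rewrite le_eqVlt; apply/orP; left; apply/eqP; rewrite exprS; field.
  by rewrite expf_neq0.
have {}H m n : `|u m - u n| <= 2 * C / 2 ^+ n + 2 * C / 2 ^+ m.
  have C0 : 0 <= C.
    by have := uC 0%N; rewrite expr0 divr1; exact: le_trans.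
  have P k : 0 <= 2 * C / 2 ^+ k by rewrite divr_ge0 ?exprn_ge0 ?mulr_ge0.
  have [mn|nm] := leP m n.
    by rewrite distrC -(subnKC mn); apply: le_trans (H _ _) _; rewrite lerDr.
  by rewrite -(subnKC (ltnW nm)); apply: le_trans (H _ _) _; rewrite lerDl.
pose S := [set u n - 2 * C / 2 ^+ n | n in setT].
have S0 : S !=set0 by exists (u 0%N - 2 * C / 2 ^+ 0); exists 0%N.
have Sub n : ubound S (u n + 2 * C / 2 ^+ n).
  move=> _ [m _ <-]; have := H m n; rewrite ler_norml => /andP[_].
  by rewrite lerBlDr addrAC -lerBlDr => /le_trans; apply; rewrite addrC.
exists (sup S) => n; rewrite ler_distl; apply/andP; split.
  by apply: ub_le_sup; [exists (u 0%N + 2 * C / 2 ^+ 0); exact: Sub|exists n].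
by apply: sup_le_ub.
Qed.

Variables (F : V3 -> R) (a : V3) (r rho M L : R) (i j : 'I_3).
Hypothesis rho0 : 0 < rho.
Hypothesis M0 : 0 <= M.
Hypothesis L0 : 0 <= L.
(** Initial values lie within [rho] of [a j 0] and iterates within [2 * (rho * M)] of them, so [F]
    is evaluated only in the box of radius [r]. The bound [rhoL] makes the Picard operator a
    contraction of ratio 1/2. *)
Hypothesis rhor : rho * (1 + 2 * M) < r.
Hypothesis rhoL : rho * L <= 1 / 2.
Hypothesis FC : forall x, box a r x -> {for x, continuous F}.
Hypothesis FM : forall x, box a r x -> `|F x| <= M.
Hypothesis FL : forall x s t, box a r x -> `|s - a j 0| < r ->
  `|t - a j 0| < r -> `|F (upd x j t) - F (upd x j s)| <= L * `|t - s|.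

(** Equal to [x j 0] if [i != j] and to the constant [a j 0] if [i = j]: the two kinds of initial
    value are treated at once. *)
Let init (x : V3) := upd x i (a i 0) j 0.

Let init_box x : box a rho x -> `|init x - a j 0| < rho.
Proof.
move=> xr; rewrite /init updE; case: eqP => [->|_]; last exact: xr.
by rewrite subrr normr0.
Qed.

(** The Picard operator lands within [rho * M] of [init]; the factor 2 leaves room for the limit,
    whose distance to [init] is bounded by a geometric series. *)
Let admissible (f : V3 -> R) := forall x, box a rho x ->
  {for x, continuous f} /\ `|f x - init x| <= 2 * (rho * M).

Let admissible_box f x : admissible f -> box a rho x -> `|f x - a j 0| < r.
Proof.
move=> fA xr; rewrite -(subrKA (init x)); apply: le_lt_trans (ler_normD _ _) _.
have [_ H1] := fA _ xr; have H2 := init_box xr.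
apply: le_lt_trans _ rhor; apply: (le_trans (lerD H1 (ltW H2))).
by rewrite le_eqVlt; apply/orP; left; apply/eqP; ring.
Qed.

Let rho_r x : box a rho x -> box a r x.
Proof.
apply: sub_box; apply: le_trans (ltW rhor).
by rewrite ler_peMr ?(ltW rho0)// lerDl mulr_ge0.
Qed.

Let G f x := F (upd x j (f x)).

Let Gbox f x : admissible f -> box a rho x -> box a r (upd x j (f x)).
Proof. by move=> fA xr; apply: box_upd; [exact: rho_r|exact: admissible_box]. Qed.

Let G_continuous f x : admissible f -> box a rho x -> {for x, continuous (G f)}.
Proof.
move=> fA xr; apply: (@continuous_comp _ _ _ (fun x => upd x j (f x)) F).
  by apply: upd_continuous; [exact: cvg_id|have [] := fA _ xr].
by apply: FC; exact: Gbox.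
Qed.

Let init_continuous (x : V3) : {for x, continuous init}.
Proof.
apply: (@continuous_comp _ _ _ (fun x => upd x i (a i 0)) (fun y => y j 0)).
  by apply: upd_continuous; [exact: cvg_id|exact: cst_continuous].
exact: coord_continuous.
Qed.

Let dist_le x : box a rho x -> `|x i 0 - a i 0| <= rho.
Proof. by move=> /(_ i)/ltW. Qed.

(** The clause [is_prim] contains both the differential equation and the initial condition. *)
Lemma picard : exists phi : V3 -> R,
  (forall x, box a rho x -> {for x, continuous phi} /\ `|phi x - a j 0| < r) /\
  is_prim i a rho (G phi) (fun x => phi x - init x).
Proof.
have K (f : V3 -> R) : exists P, admissible f -> is_prim i a rho (G f) P.
  have [fA|] := pselect (admissible f); last by exists f.
  have [P PP] := @is_prim_exists _ i a rho (G f) rho0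
    (fun x => G_continuous fA).
  by exists P.
have [Pr PrP] := choice K.
pose T f x := init x + Pr f x.
have TA f : admissible f -> admissible (T f) /\
    forall x, box a rho x -> `|T f x - init x| <= rho * M.
  move=> fA; have PP := PrP _ fA.
  have B x : box a rho x -> `|T f x - init x| <= rho * M.
    move=> xr; rewrite /T addrAC subrr add0r.
    have := @MVT_bound _ (fun t => Pr f (upd x i t))
      (fun t => G f (upd x i t)) (a i 0) (x i 0) M (is_prim_line PP xr).
    rewrite (is_prim_base PP xr) subr0 upd_id => /(_ _)/le_trans; apply.
      by move=> u ub; apply: FM; apply: Gbox => //; exact: box_line ub.
    by rewrite mulrC ler_wpM2r// dist_le.
  split=> // x xr; split.
    have PC := is_prim_continuous PP (fun x => G_continuous fA) xr.
    exact: (cvgD (@init_continuous x) PC).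
  by apply: le_trans (B _ xr) _; rewrite ler_peMl ?ler1n ?mulr_ge0 ?(ltW rho0).
(* The integrands differ by at most [L * c], over a length at most [rho]. *)
have TC f g c : admissible f -> admissible g ->
    (forall x, box a rho x -> `|f x - g x| <= c) ->
    forall x, box a rho x -> `|T f x - T g x| <= c / 2.
  move=> fA gA fg x xr; have Pf := PrP _ fA; have Pg := PrP _ gA.
  have -> : T f x - T g x = Pr f x - Pr g x by rewrite /T; ring.
  have := @MVT_bound _ (fun t => Pr f (upd x i t) - Pr g (upd x i t))
    (fun t => G f (upd x i t) - G g (upd x i t)) (a i 0) (x i 0) (L * c) _ _.
  rewrite (is_prim_base Pf xr) (is_prim_base Pg xr) subrr subr0 upd_id => B.
  apply: le_trans (B _ _) _.
  - move=> u ub; apply: is_deriveB; first exact: (is_prim_line Pf xr ub).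
    exact: (is_prim_line Pg xr ub).
  - move=> u ub; have ur := box_line xr ub.
    apply: le_trans (FL (rho_r ur) (admissible_box gA ur) (admissible_box fA ur)) _.
    by rewrite ler_wpM2l// fg.
  - have c0 : 0 <= c by exact: le_trans (fg _ xr).
    apply: (@le_trans _ _ (rho * L * c)).
      by rewrite mulrC mulrA ler_wpM2r// ler_wpM2r// dist_le.
    by apply: le_trans (ler_wpM2r c0 rhoL) _; rewrite mul1r mulrC.
pose u n := iter n T init.
have uA n : admissible (u n).
  elim: n => [|n IH]; last exact: (TA _ IH).1.
  move=> x xr; split; first exact: init_continuous.
  by rewrite subrr normr0 !mulr_ge0 ?(ltW rho0).
have uD n x : box a rho x -> `|u n.+1 x - u n x| <= rho * M / 2 ^+ n.
  elim: n x => [|n IH] x xr.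
    by rewrite expr0 divr1; exact: (TA _ (uA 0%N)).2.
  by rewrite exprSr invfM mulrA; exact: (TC _ _ _ (uA _) (uA _) IH).
have lim_ex x : exists l, box a rho x -> forall n,
    `|l - u n x| <= 2 * (rho * M) / 2 ^+ n.
  have [xr|] := pselect (box a rho x); last by exists 0.
  have [l lP] := @geometric_limit (fun n => u n x) (rho * M) (fun n => uD n x xr).
  by exists l.
have [phi phiP] := choice lim_ex.
have phiC x : box a rho x -> {for x, continuous phi}.
  move=> xr; apply/continuous_epsP => eps eps0.
  have e3 : 0 < eps / 3 by rewrite divr_gt0.
  have [n nP] := geometric_small (2 * (rho * M)) e3.
  have [/continuous_epsP/(_ _ e3) N1 _] := uA n x xr.
  have N2 := open_nbhs_nbhs (conj (@open_box _ a rho) xr).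
  apply: filterS2 N1 N2 => y uy yr.
  have -> : phi y - phi x = (phi y - u n y) + (u n y - u n x) + (u n x - phi x).
    by ring.
  have H1 := le_lt_trans (phiP _ yr n) nP.
  have H2 := le_lt_trans (phiP _ xr n) nP; rewrite distrC in H2.
  have -> : eps = eps / 3 + eps / 3 + eps / 3 by field.
  apply: le_lt_trans (ler_normD _ _) _; rewrite ltrD//.
  by apply: le_lt_trans (ler_normD _ _) _; rewrite ltrD.
have phiA : admissible phi.
  move=> x xr; split; first exact: phiC.
  by have := phiP _ xr 0%N; rewrite expr0 divr1.
(* Both sides are within a geometric error of [u n.+1]: [phi] as its limit, [T phi] by
   contraction. *)
have phiT x : box a rho x -> phi x = T phi x.
  move=> xr; apply/eqP; rewrite -subr_eq0 -normr_eq0 eq_le normr_ge0 andbT.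
  apply: (@le_geometric (2 * (rho * M))) => n; rewrite add0r.
  have H1 := phiP _ xr n.+1.
  have H2 : `|u n.+1 x - T phi x| <= 2 * (rho * M) / 2 ^+ n / 2.
    by apply: TC xr => // y yr; rewrite distrC phiP.
  rewrite -(subrKA (u n.+1 x)); apply: le_trans (ler_normD _ _) _.
  apply: le_trans (lerD H1 H2) _; rewrite le_eqVlt; apply/orP; left; apply/eqP.
  by rewrite exprS; field; rewrite expf_neq0.
exists phi; split=> [x xr|].
  by split; [exact: phiC|exact: admissible_box].
have [P1 P2] := PrP _ phiA; split=> x xr.
  by rewrite phiT// /T addrAC subrr add0r; exact: P1.
apply: near_eq_is_derive (P2 _ xr).
apply: (open_near (@open_box _ a rho) xr) => y yr.
by rewrite [in RHS]phiT// /T addrAC subrr add0r.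
Qed.

End Picard.

(** * Dependence of solutions on initial value and parameters *)

Section OdeSmooth.
Variable R : realType.
Local Notation V3 := 'cV[R]_3.
Local Notation e := (canon_basis R).

Lemma btw_minmax (s t u : R) : btw s t u = (Num.min s t <= u <= Num.max s t).
Proof. by rewrite /btw; case: (leP s t); lra. Qed.

Lemma bounded_btw (z : R -> R) (s t : R) :
  (forall u, btw s t u -> {for u, continuous z}) ->
  exists2 c, btw s t c & forall u, btw s t u -> `|z u| <= `|z c|.
Proof.
move=> zC; have st : Num.min s t <= Num.max s t.
  by rewrite ge_min !le_max lexx.
have [|c cb cM] := @EVT_max R (fun u => `|z u|) _ _ st.
  apply: continuous_in_subspaceT => u; rewrite inE/= in_itv/= -btw_minmax => /zC.
  exact: cvg_norm.
exists c; first by move: cb; rewrite btw_minmax in_itv.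
by move=> u; rewrite btw_minmax => ub; apply: cM; rewrite in_itv.
Qed.

Lemma gronwall (z dz : R -> R) (s t L K : R) :
  (forall u, btw s t u -> is_derive u 1 z (dz u)) ->
  (forall u, btw s t u -> `|dz u| <= L * `|z u| + K) ->
  0 <= L -> 0 <= K -> `|t - s| * L <= 1 / 2 -> z s = 0 ->
  `|z t| <= 2 * K * `|t - s|.
Proof.
move=> zD dzB L0 K0 stL zs.
have [|c cb cM] := @bounded_btw z s t.
  by move=> u /zD[dz1 _]; apply/differentiable_continuous/derivable1_diffP.
have H : `|z c| <= (L * `|z c| + K) * `|t - s|.
  have := @MVT_bound _ z dz s c (L * `|z c| + K).
  rewrite zs subr0 => B; apply: le_trans (B _ _) _.
  - by move=> u ub; apply: zD; exact: btw_trans cb ub.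
  - move=> u ub; have ub' := btw_trans cb ub.
    by apply: le_trans (dzB _ ub') _; rewrite lerD2r ler_wpM2l// cM.
  - by rewrite ler_wpM2l ?addr_ge0 ?mulr_ge0//; exact: btw_dist.
apply: le_trans (cM _ (btw_r _ _)) _.
have H2 : `|t - s| * L * `|z c| <= 1 / 2 * `|z c| by rewrite ler_wpM2r.
move: H H2; rewrite mulrDl; move: `|z c| `|t - s| => p q H1 H2.
have H3 : L * p * q = q * L * p by ring.
rewrite H3 in H1; lra.
Qed.

Variables (F : V3 -> R) (a : V3) (r rho L : R) (i j : 'I_3).
Hypothesis rho0 : 0 < rho.
Hypothesis rho_r : rho <= r.
Hypothesis L0 : 0 <= L.
Hypothesis rhoL : rho * L <= 1 / 2.
Hypothesis FC : forall k, is_Ck k (box a r) F.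
Hypothesis FL : forall x, box a r x -> `|'D_(e j) F x| <= L.
Variable phi : V3 -> R.
Hypothesis phiC :
  forall x, box a rho x -> {for x, continuous phi} /\ `|phi x - a j 0| < r.
Hypothesis phiP : is_prim i a rho (fun x => F (upd x j (phi x)))
  (fun x => phi x - upd x i (a i 0) j 0).

Let Phi x := upd x j (phi x).
(** Coefficients of the linearized equation [w' = A w + B k]; the factor [(k != j)%:R] is there
    because [Phi] overwrites the [j]-th coordinate. *)
Let A x := 'D_(e j) F (Phi x).
Let B k x := (k != j)%:R * 'D_(e k) F (Phi x).

Let Phi_box x : box a rho x -> box a r (Phi x).
Proof.
by move=> xr; apply: box_upd; [exact: sub_box xr|exact: (phiC xr).2].
Qed.

Let Phi_continuous x : box a rho x -> {for x, continuous Phi}.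
Proof.
by move=> xr; apply: upd_continuous; [exact: cvg_id|exact: (phiC xr).1].
Qed.

Let FD x k : box a r x -> is_derive x (e k) F ('D_(e k) F x).
Proof. exact: Ck_is_derive (FC 1). Qed.

Let FDC x k : box a r x -> {for x, continuous ('D_(e k) F)}.
Proof. exact: Ck_cont (Ck_D k (FC 1)). Qed.

(** Two mean value steps from [Phi g] to [Phi y]: in coordinate [k] at the old value of [phi], then
    in coordinate [j]. When [k = j] the first step is empty and [d] is a default value. *)
Let increment k x h u : box a rho x -> btw (a i 0) (x i 0) u -> k != i ->
  box a rho (upd x k (x k 0 + h)) ->
  let g := upd x i u in let y := upd (upd x k (x k 0 + h)) i u in
  exists c d, [/\ btw (phi g) (phi y) c, btw (x k 0) (x k 0 + h) d &
    F (Phi y) - F (Phi g) = 'D_(e j) F (upd y j c) * (phi y - phi g) +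
      h * ((k != j)%:R * 'D_(e k) F (upd (Phi g) k d))].
Proof.
move=> xr ub ki yr g y.
have gr : box a rho g := box_line xr ub.
have yi : y = upd g k (x k 0 + h) by rewrite /y /g updC.
have gk : g k 0 = x k 0 by rewrite /g updE (negbTE ki).
have yr' : box a rho y.
  by apply: box_line yr _; rewrite updE eq_sym (negbTE ki).
have [c cb Ec] : exists2 c, btw (phi g) (phi y) c & F (Phi y) - F (upd y j (phi g)) =
    'D_(e j) F (upd y j c) * (phi y - phi g).
  apply: (@MVT_upd _ F ('D_(e j) F) y j (phi g) (phi y)) => v vb.
  apply: FD; apply: box_upd; first exact: sub_box yr'.
  by apply: btw_ltr vb _ _; [have [] := phiC gr|have [] := phiC yr'].
have [kj|kj] := eqVneq k j.
  exists c, (x k 0); split => //; first exact: btw_l.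
  rewrite mul0r mulr0 addr0 -Ec; congr (_ - F _).
  by rewrite yi kj upd_upd.
have jk : j != k by rewrite eq_sym.
have Pk : Phi g k 0 = x k 0 by rewrite /Phi updE (negbTE kj).
have mE : upd y j (phi g) = upd (Phi g) k (x k 0 + h).
  by rewrite /Phi yi updC.
have [v vb|d db Ed] := @MVT_upd _ F ('D_(e k) F) (Phi g) k (x k 0) (x k 0 + h).
  apply: FD; apply: box_upd; first exact: Phi_box.
  apply: lt_le_trans _ rho_r; apply: btw_ltr vb (xr k) _.
  by have := yr k; rewrite upd_same.
exists c, d; split => //; rewrite mul1r -(subrKA (F (upd y j (phi g)))) Ec.
congr (_ + _); rewrite mE; move: Ed.
have -> : upd (Phi g) k (x k 0) = Phi g by rewrite -Pk upd_id.
by move=> ->; rewrite mulrC; congr (_ * _); ring.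
Qed.

(* [w] solves the equation linearized along [phi]; Gronwall's inequality bounds
   the increment of [phi] minus [h * w]. *)
Lemma ode_derive k (w : V3 -> R) : k != i ->
  (forall x, box a rho x -> is_derive x (e i) w (A x * w x + B k x)) ->
  (forall x, box a rho x -> {for x, continuous w}) ->
  (forall x, box a rho x -> x i 0 = a i 0 -> w x = (k == j)%:R) ->
  forall x, box a rho x -> is_derive x (e k) phi (w x).
Proof.
move=> ki wD wC w0 x xr; apply/is_derive_epsP => eps eps0.
have lC u : {for u, continuous (fun t : R => upd x i t)}.
  exact: upd_line_continuous.
have gC u : btw (a i 0) (x i 0) u -> {for u, continuous (fun t => Phi (upd x i t))}.
  move=> ub; apply: (@continuous_comp _ _ _ (fun t => upd x i t) Phi) => //.
  by apply: Phi_continuous; exact: box_line ub.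
have [cW cWb cWM] := @bounded_btw (fun u => w (upd x i u)) (a i 0) (x i 0)
   (fun u ub => @continuous_comp _ _ _ (fun t => upd x i t) w u (lC u)
     (wC _ (box_line xr ub))).
pose W : R := `|w (upd x i cW)|.
have W0 : 0 <= W by exact: normr_ge0.
(* Chosen so that the final bound [2 * (|h| * (eta * (W + 1))) * rho] equals [eps * |h|]. *)
pose eta : R := eps / (2 * rho * (W + 1)).
have W1 : 0 < W + 1 by rewrite ltr_wpDl.
have eta0 : 0 < eta by rewrite divr_gt0// !mulr_gt0.
have Pb u : btw (a i 0) (x i 0) u -> box a r (Phi (upd x i u)).
  by move=> ub; apply: Phi_box; exact: box_line ub.
have [d1 d10 d1P] := @uniform_on_btw _ ('D_(e j) F) (fun t => Phi (upd x i t))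
  (a i 0) (x i 0) gC (fun u ub => FDC (k := j) (Pb u ub)) _ eta0.
have [d2 d20 d2P] := @uniform_on_btw _ ('D_(e k) F) (fun t => Phi (upd x i t))
  (a i 0) (x i 0) gC (fun u ub => FDC (k := k) (Pb u ub)) _ eta0.
(* [d3] turns a small [h] into a change of [phi] below [d1], which keeps the intermediate value [c]
   in the range of the first estimate. *)
have [d3 d30 d3P] := @uniform_on_btw _ phi (fun t => upd x i t)
  (a i 0) (x i 0) (fun u _ => lC u) (fun u ub => (phiC (box_line xr ub)).1) _ d10.
have r10 : 0 < rho - `|x k 0 - a k 0| by rewrite subr_gt0.
have m0 : 0 < Num.min (Num.min d1 d2) (Num.min d3 (rho - `|x k 0 - a k 0|)).
  by rewrite !lt_min d10 d20 d30 r10.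
have N : \forall h \near (0 : R),
    `|h| < Num.min (Num.min d1 d2) (Num.min d3 (rho - `|x k 0 - a k 0|)).
  exact: nbhs0_lt.
apply: filterS N => h; rewrite !lt_min => /andP[/andP[hd1 hd2] /andP[hd3 hr]].
rewrite add_basis; set y := upd x k (x k 0 + h).
have yr : box a rho y.
  apply: box_upd => //; rewrite addrAC; apply: le_lt_trans (ler_normD _ _) _.
  by rewrite -ltrBrDl.
have yi : y i 0 = x i 0 by rewrite updE eq_sym (negbTE ki).
have yu u : upd y i u = upd (upd x i u) k (x k 0 + h) by rewrite /y (updC _ _ _ ki).
have near_y u : box (upd x i u) d3 (upd y i u).
  move=> l; rewrite yu updE; case: eqP => [->|_]; last by rewrite subrr normr0.
  by rewrite updE (negbTE ki) addrAC subrr add0r.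
pose z u := phi (upd y i u) - phi (upd x i u) - h * w (upd x i u).
pose dz u := F (Phi (upd y i u)) - F (Phi (upd x i u)) -
  h * (A (upd x i u) * w (upd x i u) + B k (upd x i u)).
have phiD v : box a rho v -> forall u, btw (a i 0) (v i 0) u ->
    is_derive u 1 (fun t => phi (upd v i t)) (F (Phi (upd v i u))).
  move=> vr u ub; have H := is_prim_line phiP vr ub.
  have H' := is_deriveD H (is_derive_cst (upd v i (a i 0) j 0) u (1 : R)).
  rewrite addr0 in H'; move: H'; congr is_derive; apply/funext => t.
  by rewrite -[LHS]/(_ - _ + _) upd_upd subrK.
have zx : z (x i 0) = phi y - phi x - h * w x.
  by rewrite /z -[in upd y i _]yi !upd_id.
have D0 : 0 <= `|h| * (eta * (W + 1)).
  apply: mulr_ge0 => //; apply: mulr_ge0; exact: ltW.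
have G := @gronwall z dz (a i 0) (x i 0) L (`|h| * (eta * (W + 1))) _ _ L0 D0 _ _.
rewrite -zx; apply: le_trans (G _ _ _ _) _.
- move=> u ub; apply: is_deriveB.
    apply: is_deriveB; last exact: phiD.
    by apply: phiD => //; rewrite yi.
  have := is_deriveZ h ((is_derive_line _ _ _ _ _).1 (wD _ (box_line xr ub))).
  by [].
- move=> u ub; rewrite /dz.
  have [c [d [cb db ->]]] := increment xr ub ki yr.
  rewrite -/y.
  have cd : box (Phi (upd x i u)) d1 (upd (upd y i u) j c).
    move=> l; rewrite /Phi !(updE _ j); case: eqP => [_|_].
      apply: le_lt_trans (btw_dist cb) _.
      by apply: d3P => //.
    rewrite yu updE; case: eqP => [->|_]; last by rewrite subrr normr0.
    by rewrite updE (negbTE ki) addrAC subrr add0r.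
  have dd : (k != j) -> box (Phi (upd x i u)) d2 (upd (Phi (upd x i u)) k d).
    move=> kj l; rewrite [upd (Phi _) _ _ _ _]updE.
    case: eqP => [->|_]; last by rewrite subrr normr0.
    rewrite /Phi updE (negbTE kj) updE (negbTE ki).
    by apply: le_lt_trans (btw_dist db) _; rewrite addrAC subrr add0r.
  have H1 := d1P _ _ ub cd.
  have H2 : `|(k != j)%:R * 'D_(e k) F (upd (Phi (upd x i u)) k d) -
      B k (upd x i u)| <= eta.
    rewrite /B -mulrBr; case: eqP dd => [_ _|_ /(_ isT) dd]; last first.
      by rewrite mul1r; apply: ltW; exact: d2P ub dd.
    by rewrite mul0r normr0 ltW.
  have H3 : `|'D_(e j) F (upd (upd y i u) j c)| <= L.
    apply: FL; apply: box_upd.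
      apply: (sub_box rho_r); apply: box_line yr _.
      by rewrite yi.
    apply: btw_ltr cb _ _; first exact: (phiC (box_line xr ub)).2.
    by apply: (phiC _).2; apply: box_line yr _; rewrite yi.
  have H4 : `|w (upd x i u)| <= W by exact: cWM.
  move: H1 H2 H3 H4; rewrite -/(A (upd x i u)) /z.
  move: (phi (upd y i u) - phi (upd x i u)) => dphi.
  move: ('D_(e j) F _) (_ * 'D_(e k) F _) (A _) (B k _) (w _) => p b q b' v.
  move=> H1 H2 H3 H4.
  (* [p] is a derivative of [F] at an intermediate point and [q] the coefficient [A]: the first term
     is at most [L * |z u|], the second at most [|h| * (eta * (W + 1))]. *)
  have -> : p * dphi + h * b - h * (q * v + b') =
    p * (dphi - h * v) + h * ((p - q) * v + (b - b')) by ring.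
  apply: le_trans (ler_normD _ _) _; rewrite !normrM lerD//.
    by rewrite ler_wpM2r.
  rewrite ler_wpM2l//; apply: le_trans (ler_normD _ _) _.
  rewrite mulrDr mulr1 lerD// normrM; apply: ler_pM => //; exact: ltW.
- apply: le_trans _ rhoL; rewrite ler_wpM2r//; exact: ltW (xr i).
- rewrite /z; have := phiP.1 (upd y i (a i 0)) (box_line yr (btw_l _ _)).
  rewrite upd_same => /(_ erefl)/eqP; rewrite subr_eq0 => /eqP ->.
  have := phiP.1 (upd x i (a i 0)) (box_line xr (btw_l _ _)).
  rewrite upd_same => /(_ erefl)/eqP; rewrite subr_eq0 => /eqP ->.
  rewrite w0 ?upd_same ?upd_upd//; last by apply: box_line => //; exact: btw_l.
  rewrite yu updE [j == k]eq_sym; case: (eqVneq k j) => [kj|_].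
    2: by rewrite mulr0 subr0 subrr.
  by rewrite updE -kj (negbTE ki) mulr1; ring.
- rewrite (_ : eps * `|h| = 2 * (`|h| * (eta * (W + 1))) * rho).
    by apply: ler_wpM2l; [exact: mulr_ge0|exact: ltW (xr i)].
  by rewrite /eta; field; rewrite !gt_eqF.
Qed.

Lemma ode_derive_time x : box a rho x -> is_derive x (e i) phi (F (Phi x)).
Proof.
move=> xr; have initD : is_derive x (e i) (fun x => upd x i (a i 0) j 0) (0 : R).
  rewrite -[x in is_derive x](upd_id x i); apply/is_derive_line.
  have -> : (fun t : R => upd (upd x i t) i (a i 0) j 0) = cst (upd x i (a i 0) j 0).
    by apply/funext => t; rewrite upd_upd.
  exact: is_derive_cst.
have := is_deriveD (phiP.2 _ xr) initD; rewrite addr0.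
by congr is_derive; apply/funext => y; rewrite -[LHS]/(_ - _ + _) subrK.
Qed.

(** In the second claim the inhomogeneity [B k] and the initial value of the linearized solution
    both vanish. This claim lets a later change of coordinates keep a field already straightened. *)
Lemma ode_smooth : (forall n, is_Ck n (box a rho) phi) /\
  (forall k, k != i -> k != j -> (forall x, box a r x -> 'D_(e k) F x = 0) ->
   forall x, box a rho x -> 'D_(e k) phi x = 0).
Proof.
have oB := @open_box R a rho.
have phiC0 : is_Ck 0 (box a rho) phi by split=> // x /phiC[].
have compC n (f : V3 -> R) : is_Ck n (box a rho) phi -> is_Ck n (box a r) f ->
    is_Ck n (box a rho) (fun x => f (Phi x)).
  move=> phin fC; apply: (@Ck_comp _ _ _ _ f Phi oB (@open_box R a r)) => // l.
  apply: (@Ck_eq _ _ _ _ (fun x => if l == j then phi x else x l 0)) => //.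
    by move=> x _; rewrite /Phi updE.
  by case: eqP => // _; exact: Ck_coord.
have DFC n k : is_Ck n (box a rho) phi ->
    is_Ck n (box a rho) (fun x => 'D_(e k) F (Phi x)).
  by move=> phin; exact: (compC n ('D_(e k) F) phin (Ck_D k (FC n.+1))).
have [PA PAP] : exists P, is_prim i a rho A P.
  apply: is_prim_exists => // x; exact: Ck_cont (DFC _ j phiC0).
pose E x := expR (PA x).
have EC n : is_Ck n (box a rho) phi -> is_Ck n (box a rho) E.
  by move=> phin; apply: Ck_expR => //; exact: (is_prim_Ck rho0 (DFC _ j phin) PAP).
have E0 x : E x != 0 by rewrite gt_eqF// expR_gt0.
(* Variation of constants: [E] solves the homogeneous linearized equation. *)
pose BE k x := (E x)^-1 * B k x.
have BEC n k : is_Ck n (box a rho) phi -> is_Ck n (box a rho) (BE k).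
  move=> phin; apply: CkM => //; first by apply: CkV => //; exact: EC.
  by apply: CkM => //; [exact: (@Ck_cst _ R)|exact: DFC].
have QE k : exists Q, is_prim i a rho (BE k) Q.
  by apply: is_prim_exists => // x; exact: Ck_cont (BEC _ k phiC0).
have [Q QP] := choice QE.
pose w k x := E x * ((k == j)%:R + Q k x).
have wC n k : is_Ck n (box a rho) phi -> is_Ck n (box a rho) (w k).
  move=> phin; apply: CkM => //; first exact: EC.
  apply: CkD => //; first exact: (@Ck_cst _ R).
  exact: (is_prim_Ck rho0 (BEC _ k phin) (QP k)).
have ED x : box a rho x -> is_derive x (e i) E (E x * A x).
  by move=> xr; exact: (is_derive_outer (is_derive_expR _) (PAP.2 _ xr)).
have wD k x : box a rho x -> is_derive x (e i) (w k) (A x * w k x + B k x).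
  move=> xr; have H0 := is_derive_cst ((k == j)%:R : R) x (e i).
  have H1 := is_deriveD H0 ((QP k).2 _ xr).
  have H2 := is_deriveM (ED _ xr) H1.
  apply: is_derive_eq H2 _; rewrite -[(cst _ + Q k) x]/(_ + _) /cst add0r.
  rewrite /GRing.scale /= /w /BE; have := E0 x.
  by move: (E x) (A x) (Q k x) (B k x) => p q s t p0; field.
have w0 k x : box a rho x -> x i 0 = a i 0 -> w k x = (k == j)%:R.
  move=> xr xa; rewrite /w /E (PAP.1 _ xr xa) ((QP k).1 _ xr xa) expR0.
  by rewrite mul1r addr0.
have phiD k x : k != i -> box a rho x -> is_derive x (e k) phi (w k x).
  move=> ki; exact: (ode_derive ki (fun x => @wD k x)
    (fun x => Ck_cont (wC _ k phiC0)) (fun x => @w0 k x)).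
split; last first.
  move=> k ki kj Fk x xr; have [_ ->] := phiD k x ki xr.
  have := @MVT_bound _ (fun t => Q k (upd x i t)) (fun t => BE k (upd x i t))
    (a i 0) (x i 0) 0 (is_prim_line (QP k) xr).
  rewrite (is_prim_base (QP k) xr) subr0 upd_id mul0r /w (negbTE kj) add0r.
  move=> H; have : `|Q k x| <= 0.
    apply: H => u ub; rewrite /BE /B Fk ?mulr0 ?normr0//.
    by apply: Phi_box; exact: box_line ub.
  by rewrite normr_le0 => /eqP ->; rewrite mulr0.
elim=> [//|n IH].
apply: (@Ck_intro _ _ _ _ _ (fun l => if l == i then F \o Phi else w l)) => //.
- by move=> x /phiC[].
- move=> l x xr; case: eqP => [->|/eqP li]; first exact: ode_derive_time.
  exact: phiD.
- by move=> l; case: eqP => _; [exact: compC|exact: wC].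
Qed.

End OdeSmooth.

(* For [i != j], [x_j] is the initial value of the solution and the other
   coordinates are time and parameter; for [i = j] the equation is autonomous, the
   initial value is the constant [a_j], and [x_j] is the time. *)
Lemma scalar_ode (R : realType) (U : set 'cV[R]_3) (F : 'cV[R]_3 -> R) a i j :
  open U -> U a -> (forall k, is_Ck k U F) ->
  exists (rho : R) phi, let Phi x := upd x j (phi x) in
  [/\ 0 < rho, forall k, is_Ck k (box a rho) phi,
      forall x, box a rho x -> U (Phi x) /\ (x i 0 = a i 0 -> phi x = x j 0),
      forall x, box a rho x -> is_derive x (canon_basis R i) phi (F (Phi x)) &
      forall k, k != i -> k != j ->
        (forall x, U x -> 'D_(canon_basis R k) F x = 0) ->
        forall x, box a rho x -> 'D_(canon_basis R k) phi x = 0].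
Proof.
move=> oU Ua FC.
have bnd (f : 'cV[R]_3 -> R) : {for a, continuous f} ->
    nbhs a [set x | `|f x| <= `|f a| + 1].
  move/continuous_epsP => /(_ 1 ltr01); apply: filterS => x fx /=.
  rewrite -(subrK (f a) (f x)) addrC; apply: le_trans (ler_normD _ _) _.
  by rewrite lerD2l ltW.
have N1 := bnd _ (Ck_cont (FC 0%N) Ua).
have N2 := bnd _ (Ck_cont (Ck_D j (FC 1%N)) Ua).
have N3 := open_nbhs_nbhs (conj oU Ua).
have [r r0 rP] := (nbhs_boxP _ _).1 (filterI N3 (filterI N1 N2)).
set M := `|F a| + 1 in rP; set L := `|'D_(canon_basis R j) F a| + 1 in rP.
have M0 : 0 < M by rewrite ltr_wpDl.
have L0 : 0 < L by rewrite ltr_wpDl.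
have rU : box a r `<=` U by move=> x /rP[].
have rM x : box a r x -> `|F x| <= M by move=> /rP[_ []].
have rL x : box a r x -> `|'D_(canon_basis R j) F x| <= L by move=> /rP[_ []].
clearbody M L; clear N1 N2 N3 rP.
(* The first entry gives [rho * (1 + 2 * M) <= r / 2], the second [rho * L <= 1 / 2]. *)
pose rho := Num.min (r / (1 + 2 * M) / 2) (1 / (2 * L)).
have M1 : 0 < 1 + 2 * M by rewrite addr_gt0// mulr_gt0.
have rho0 : 0 < rho by rewrite lt_min !divr_gt0// mulr_gt0.
have rhor : rho * (1 + 2 * M) < r.
  have H : rho <= r / (1 + 2 * M) / 2 by rewrite ge_min lexx.
  have [_ H2] := andP (half_bounds r0).
  apply: le_lt_trans H2; apply: le_trans (ler_wpM2r (ltW M1) H) _.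
  by rewrite le_eqVlt; apply/orP; left; apply/eqP; field; rewrite gt_eqF.
have rhoL : rho * L <= 1 / 2.
  have H : rho <= 1 / (2 * L) by rewrite ge_min lexx orbT.
  apply: le_trans (ler_wpM2r (ltW L0) H) _.
  by rewrite le_eqVlt; apply/orP; left; apply/eqP; field; rewrite gt_eqF.
have rho_r : rho <= r.
  apply: le_trans (ltW rhor); rewrite ler_peMr ?(ltW rho0)// lerDl.
  by rewrite mulr_ge0 ?(ltW M0).
have FCr k : is_Ck k (box a r) F by exact: Ck_sub rU (FC k).
have Flip x s t : box a r x -> `|s - a j 0| < r -> `|t - a j 0| < r ->
    `|F (upd x j t) - F (upd x j s)| <= L * `|t - s|.
  move=> xr sr tr; have B u : btw s t u -> box a r (upd x j u).
    by move=> ub; apply: box_upd => //; exact: btw_ltr ub sr tr.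
  apply: (@MVT_bound _ (fun t => F (upd x j t))
    (fun t => 'D_(canon_basis R j) F (upd x j t))).
    by move=> u /B ur; apply/is_derive_line; exact: Ck_is_derive (FCr 1%N) ur.
  by move=> u /B; exact: rL.
have [phi [phiC phiP]] := picard i rho0 (ltW M0) (ltW L0) rhor rhoL
  (fun x => Ck_cont (FCr 0%N)) rM Flip.
have [phiS phi0] := ode_smooth rho0 rho_r (ltW L0) rhoL FCr rL phiC phiP.
exists rho, phi => Phi; split => //.
- move=> x xr; split.
    apply: rU; apply: box_upd; [exact: sub_box xr|exact: (phiC _ xr).2].
  move=> xa; have /eqP := phiP.1 _ xr xa; rewrite subr_eq0 => /eqP ->.
  by rewrite -xa upd_id.
- by move=> x xr; exact: (ode_derive_time phiP).
- move=> k ki kj Fk x xr; apply: phi0 => // y /rU; exact: Fk.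
Qed.

Lemma det3E (R : comRingType) (A : 'M[R]_3) :
  \det A = A i1 i1 * (A i2 i2 * A i3 i3 - A i2 i3 * A i3 i2)
         - A i1 i2 * (A i2 i1 * A i3 i3 - A i2 i3 * A i3 i1)
         + A i1 i3 * (A i2 i1 * A i3 i2 - A i2 i2 * A i3 i1).
Proof.
pose f m n := A (inord m) (inord n).
have AE x y : A x y = f x y by rewrite /f !inord_val.
rewrite (expand_det_row _ ord0) !big_ord_recl big_ord0 /cofactor.
rewrite !(expand_det_row _ ord0) !big_ord_recl !big_ord0 /cofactor !det_mx11.
rewrite !mxE !AE /i1 /i2 /i3 !inordK//= /bump /= !addn0 !expr0 ?expr1.
by rewrite expr2; ring.
Qed.

(** * Local diffeomorphisms *)

Section LocalDiffeo.
Variable R : realType.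
Local Notation V3 := 'cV[R]_3.
Local Notation e := (canon_basis R).

Definition csmooth (U : set V3) (c : V3 -> V3) :=
  forall l k, is_Ck k U (fun x => c x l 0).

Lemma csmooth_continuous U c x : csmooth U c -> U x -> {for x, continuous c}.
Proof.
by move=> cC Ux; apply/continuous_colP => l; exact: Ck_cont (cC l 0%N) Ux.
Qed.

Lemma csmooth_sub U V c : V `<=` U -> csmooth U c -> csmooth V c.
Proof. by move=> VU cC l k; apply: Ck_sub VU _; exact: cC. Qed.

Lemma csmooth_comp U V c d : open U -> open V -> (forall x, U x -> V (c x)) ->
  csmooth U c -> csmooth V d -> csmooth U (d \o c).
Proof.
move=> oU oV UV cC dC l k.
exact: (@Ck_comp _ _ _ _ (fun y => d y l 0) c oU oV UV (dC l k) (fun m => cC m k)).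
Qed.

Lemma csmooth_upd U j (f : V3 -> R) : open U -> (forall k, is_Ck k U f) ->
  csmooth U (fun x => upd x j (f x)).
Proof.
move=> oU fC l k.
apply: (@Ck_eq _ _ _ _ (fun x => if l == j then f x else x l 0)) => //.
  by move=> x _; rewrite updE.
by case: eqP => // _; exact: Ck_coord.
Qed.

Lemma open_preimage U V (c : V3 -> V3) : open U -> open V ->
  (forall x, U x -> {for x, continuous c}) -> open (U `&` c @^-1` V).
Proof.
move=> oU oV cC; rewrite openE => x [Ux Vx].
apply: filterI; first exact: open_nbhs_nbhs.
by apply: cC => //; exact: open_nbhs_nbhs.
Qed.

(** [psi] maps new coordinates to old ones, so that the columns of its Jacobian are the new
    coordinate fields; [y] is a total function, constrained on the image only. *)
Definition local_diffeo (W : set V3) (psi y : V3 -> V3) :=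
  [/\ open W, open (psi @` W), csmooth W psi, csmooth (psi @` W) y &
      forall x, W x -> y (psi x) = x].

(** The image of a smaller open set is cut out by a preimage under the continuous map [y], hence
    open. *)
Lemma local_diffeo_sub W V psi y : open V -> V `<=` W ->
  local_diffeo W psi y -> local_diffeo V psi y.
Proof.
move=> oV VW [oW oI psiC yC yK].
have sI : psi @` V `<=` psi @` W by apply: image_subset.
split => //.
- have -> : psi @` V = psi @` W `&` y @^-1` V.
    apply/seteqP; split=> [_ [x Vx <-]|_ [[x Wx <-] Vx]].
      by split; [exists x => //; exact: VW|rewrite /preimage/= yK//; exact: VW].
    by exists x => //; rewrite /preimage/= yK in Vx.
  by apply: open_preimage => // x Ix; exact: csmooth_continuous yC Ix.
- exact: csmooth_sub psiC.
- exact: csmooth_sub yC.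
- by move=> x /VW; exact: yK.
Qed.

Lemma local_diffeo_comp W1 psi1 y1 W2 psi2 y2 :
  local_diffeo W1 psi1 y1 -> local_diffeo W2 psi2 y2 ->
  (forall x, W2 x -> W1 (psi2 x)) ->
  local_diffeo W2 (psi1 \o psi2) (y2 \o y1).
Proof.
move=> D1 [oW2 oI2 psi2C y2C y2K] W21.
have sI : psi2 @` W2 `<=` W1 by move=> _ [x Wx <-]; exact: W21.
have [oW1 _ psi1C _ _] := D1.
have [_ oI1 _ y1C y1K] := local_diffeo_sub oI2 sI D1.
have IE : (psi1 \o psi2) @` W2 = psi1 @` (psi2 @` W2) by rewrite image_comp.
split => //.
- by rewrite IE.
- exact: csmooth_comp W21 psi2C psi1C.
- rewrite IE; apply: csmooth_comp y1C y2C => // _ [x Ix <-].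
  by rewrite y1K.
- by move=> x Wx /=; rewrite y1K ?y2K//; exists x.
Qed.

Lemma upd_local_diffeo U a j (f : V3 -> R) : open U -> U a ->
  (forall k, is_Ck k U f) -> 'D_(e j) f a != 0 ->
  exists W y, [/\ W a, W `<=` U, local_diffeo W (fun x => upd x j (f x)) y &
    forall x, W x -> 'D_(e j) f x != 0].
Proof.
move=> oU Ua fC p0; set p := 'D_(e j) f a in p0.
have pp : 0 < `|p| / 2 by rewrite divr_gt0 ?normr_gt0.
have N1 := (continuous_epsP _ _).1 (Ck_cont (Ck_D j (fC 1%N)) Ua) _ pp.
have N2 := open_nbhs_nbhs (conj oU Ua).
have [rho rho0 rhoP] := (nbhs_boxP _ _).1 (filterI N1 N2).
have rU : box a rho `<=` U by move=> x /rhoP[].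
have fCr k : is_Ck k (box a rho) f by exact: Ck_sub rU (fC k).
have fj x : box a rho x -> `|'D_(e j) f x - p| <= `|p| / 2.
  by move=> /rhoP[/ltW].
have oI := upd_image_open rho0 fCr p0 fj.
have [g [gP gK gC]] := upd_inverse rho0 fCr p0 fj.
exists (box a rho), (fun z => upd z j (g z)); split => //.
- exact: box_center.
- split => //; first exact: open_box.
  + by apply: csmooth_upd => //; exact: open_box.
  + exact: csmooth_upd.
  + by move=> x xr; rewrite gK// upd_upd upd_id.
- move=> x xr; apply: contraTneq (rhoP _ xr).1 => ->.
  by rewrite sub0r normrN ltNge ler_pdivrMr// ler_peMr ?ler1n.
Qed.

(** At [a] the derivative of [phi] along [j] is 1 if [i != j], where [x j 0] is the initial value,
    and [F a] if [i = j], where [x j 0] is the time; hence the premise on [F a]. *)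
Lemma flow_diffeo U (F : V3 -> R) a i j : open U -> U a ->
  (forall k, is_Ck k U F) -> (i = j -> F a != 0) ->
  exists W phi y, let Phi x := upd x j (phi x) in
  [/\ W a /\ phi a = a j 0, local_diffeo W Phi y,
      (forall k, is_Ck k W phi) /\
      (forall x, W x -> 'D_(e j) phi x != 0 /\ U (Phi x)),
      forall x, W x -> 'D_(e i) phi x = F (Phi x) &
      forall k, k != i -> k != j -> (forall x, U x -> 'D_(e k) F x = 0) ->
        forall x, W x -> 'D_(e k) phi x = 0].
Proof.
move=> oU Ua FC Fa; have [rho [phi [rho0 phiC phiU phiD phi0]]] :=
  scalar_ode i j oU Ua FC.
have ar : box a rho a by exact: box_center.
have phia : phi a = a j 0 by apply: (phiU _ ar).2.
have Dj : 'D_(e j) phi a != 0.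
  have [ij|ij] := eqVneq i j.
    have [_ H] := phiD _ ar; rewrite -ij H phia -ij upd_id; exact: Fa.
  have H : is_derive a (e j) phi (1 : R).
    rewrite -[a in is_derive a](upd_id a j); apply/is_derive_line.
    have H := is_derive_id (a j 0) (1 : R); apply: near_eq_is_derive H.
    have N : \forall t \near a j 0, `|t - a j 0| < rho.
      apply/nbhs_ballP; exists rho => // t; rewrite /ball/=.
      by rewrite distrC.
    apply: filterS N => t tr; rewrite (phiU _ _).2 ?upd_same//.
      exact: box_upd.
    by rewrite updE (negbTE ij).
  by have [_ ->] := H; exact: oner_neq0.
have [W [y [Wa WU WD Wj]]] := upd_local_diffeo (@open_box _ a rho) ar phiC Dj.
exists W, phi, y => Phi; split => //.
- split=> [k|x Wx]; first exact: Ck_sub WU (phiC k).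
  by split; [exact: Wj|apply: (phiU _ _).1; exact: WU].
- by move=> x /WU/phiD[].
- by move=> k ki kj Fk x /WU; exact: phi0.
Qed.

Definition jac (psi : V3 -> V3) x : 'M[R]_3 :=
  \matrix_(l, k) 'D_(e k) (fun y => psi y l 0) x.

Lemma derive_comp U (f : V3 -> R) (c : V3 -> V3) x v (dc : 'I_3 -> R) :
  open U -> is_Ck 1 U f -> U (c x) ->
  (forall l, is_derive x v (fun y => c y l 0) (dc l)) ->
  is_derive x v (f \o c) (\sum_l 'D_(e l) f (c x) * dc l).
Proof.
move=> oU fC Ux cD.
apply: (@is_derive_comp3 _ _ f (fun l => 'D_(e l) f)) => //.
- by apply: (open_near oU Ux) => y Uy l; exact: Ck_is_derive fC Uy.
- by move=> l; exact: Ck_cont (Ck_D l fC) Ux.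
Qed.

Lemma csmooth_is_derive U c x k l : csmooth U c -> U x ->
  is_derive x (e k) (fun y => c y l 0) ('D_(e k) (fun y => c y l 0) x).
Proof. by move=> cC; exact: Ck_is_derive (cC l 1%N). Qed.

Lemma jac_comp U V psi1 psi2 x : open V -> csmooth V psi1 ->
  csmooth U psi2 -> U x -> V (psi2 x) ->
  jac (psi1 \o psi2) x = jac psi1 (psi2 x) *m jac psi2 x.
Proof.
move=> oV C1 C2 Ux Vx; apply/matrixP => l k; rewrite !mxE.
have [_ ->] := @derive_comp V (fun y => psi1 y l 0) psi2 x (e k)
  (fun m => 'D_(e k) (fun y => psi2 y m 0) x) oV (C1 l 1%N) Vx
  (fun m => csmooth_is_derive k m C2 Ux).
by apply: eq_bigr => m _; rewrite !mxE.
Qed.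

Lemma jac_id x : jac id x = 1%:M.
Proof.
apply/matrixP => l k; rewrite !mxE.
by have [_ ->] := is_derive_coord x (e k) l; rewrite mxE eqxx andbT.
Qed.

Lemma jac_diffeo W psi y x : local_diffeo W psi y -> W x ->
  jac y (psi x) *m jac psi x = 1%:M.
Proof.
move=> [oW oI psiC yC yK] Wx; have Ix : (psi @` W) (psi x) by exists x.
rewrite -(jac_comp oI yC psiC Wx Ix) -(jac_id x).
apply/matrixP => l k; rewrite !mxE; apply: near_eq_derive.
by apply: (open_near oW Wx) => z Wz /=; rewrite yK.
Qed.

Lemma derive_comp_upd U (f phi : V3 -> R) j k x (d : R) :
  open U -> is_Ck 1 U f -> U (upd x j (phi x)) -> is_derive x (e k) phi d ->
  'D_(e k) (fun y => f (upd y j (phi y))) x =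
  'D_(e j) f (upd x j (phi x)) * d +
  (k != j)%:R * 'D_(e k) f (upd x j (phi x)).
Proof.
move=> oU fC Ux phiD.
have cD l : is_derive x (e k) (fun y => upd y j (phi y) l 0)
    (if l == j then d else (l == k)%:R).
  have -> : (fun y => upd y j (phi y) l 0) = (fun y => if l == j then phi y else y l 0).
    by apply/funext => y; rewrite updE.
  case: eqP => // _; have := is_derive_coord x (e k) l.
  by rewrite mxE eqxx andbT.
have [_ ->] := derive_comp oU fC Ux cD.
rewrite (bigD1 j)//= eqxx; congr (_ + _).
have [->|kj] := eqVneq k j.
  by rewrite mul0r big1// => l lj; rewrite (negbTE lj) mulr0.
rewrite (bigD1 k)//= (negbTE kj) eqxx mulr1 mul1r big1 ?addr0// => l /andP[lj lk].
by rewrite (negbTE lj) (negbTE lk) mulr0.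
Qed.

End LocalDiffeo.

(** * Straightening a distribution, a field and a volume *)

Section Frobenius.
Variable R : realType.
Local Notation V3 := 'cV[R]_3.
Local Notation e := (canon_basis R).
Implicit Types (U : set V3) (f g : V3 -> R).

Lemma derive_eq_on U f g x v : open U -> U x -> (forall y, U y -> f y = g y) ->
  'D_v f x = 'D_v g x.
Proof. by move=> oU Ux fg; apply: near_eq_derive; exact: open_near oU Ux fg. Qed.

Lemma Ck_deriveM U f g x k : open U -> is_Ck 1 U f -> is_Ck 1 U g -> U x ->
  'D_(e k) (fun y => f y * g y) x = f x * 'D_(e k) g x + g x * 'D_(e k) f x.
Proof.
move=> oU fC gC Ux.
by have [_ ->] := is_deriveM (Ck_is_derive k fC Ux) (Ck_is_derive k gC Ux).
Qed.

Lemma Ck_deriveB U f g x k : open U -> is_Ck 1 U f -> is_Ck 1 U g -> U x ->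
  'D_(e k) (fun y => f y - g y) x = 'D_(e k) f x - 'D_(e k) g x.
Proof.
move=> oU fC gC Ux.
by have [_ ->] := is_deriveB (Ck_is_derive k fC Ux) (Ck_is_derive k gC Ux).
Qed.

Lemma smooth_comp U N f c : open U -> open N -> (forall x, U x -> N (c x)) ->
  smooth N f -> csmooth U c -> smooth U (fun x => f (c x)).
Proof.
by move=> oU oN UN fC cC k; apply: (@Ck_comp _ _ _ _ f c oU oN UN (fC k)) => l.
Qed.

Lemma smooth_D U f k : smooth U f -> smooth U ('D_(e k) f).
Proof. by move=> fC n; exact: Ck_D (fC n.+1). Qed.

(** Here [p1] and [p3] are derivatives of [phi], [q] is [Q1] and [q2] its derivative along [x2], [p]
    and [r] are the values of [P] and [Q], and [Qx], [Qy], [Px], [Pz] their partial derivatives. The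
    last equation is the first one differentiated along [x2]. *)
Lemma frobenius_identity (Qx Qy Px Pz p1 p3 q2 q p r : R) : p1 != 0 ->
  q * p1 = r - p3 -> Qy + p * Qx = Pz + r * Px ->
  q * (Px * p1 + 0 * Px) + p1 * q2 = Qx * p + 1 * Qy - (Px * p3 + 1 * Pz) ->
  q2 = 0.
Proof.
move=> p10 E1 E2 E3; apply: (mulfI p10); rewrite mulr0.
have Er : r = q * p1 + p3 by rewrite E1; ring.
have EQ : Qy = Pz + r * Px - p * Qx by rewrite -E2; ring.
have -> : p1 * q2 = Qx * p + 1 * Qy - (Px * p3 + 1 * Pz) - q * (Px * p1 + 0 * Px).
  by rewrite -E3; ring.
by rewrite EQ Er; ring.
Qed.

(** The equation on [P] and [Q] says that [e2 + P e1] and [e3 + Q e1] commute. The leaves of the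
    plane field they span are graphs over (x2, x3), and [Psi] labels them by its first argument
    coordinate. *)
Lemma frobenius (N : set V3) (P Q : V3 -> R) b :
  open N -> N b -> smooth N P -> smooth N Q ->
  (forall x, N x -> 'D_(e i2) Q x + P x * 'D_(e i1) Q x =
                    'D_(e i3) P x + Q x * 'D_(e i1) P x) ->
  exists W eta y, let Psi x := upd x i1 (eta x) in
  [/\ W b /\ eta b = b i1 0, local_diffeo W Psi y, smooth W eta,
      forall x, W x -> N (Psi x) &
      forall x, W x -> 'D_(e i2) eta x = P (Psi x) /\
                       'D_(e i3) eta x = Q (Psi x)].
Proof.
move=> oN Nb PC QC PQ.
(* The indices differ, so the premise of [flow_diffeo] for the autonomous case is vacuous. *)
have n21 : i2 = i1 -> P b != 0 by move=> E; have := I3E.1.1.1.2; rewrite E eqxx.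
have [W1 [phi [y1 [[W1b phib] D1 [phiC phiU] phi2 _]]]] :=
  flow_diffeo oN Nb PC n21.
set Phi := fun x => upd x i1 (phi x) in D1 phiU phi2.
have [oW1 oI1 PhiC _ _] := D1.
have PhiN x : W1 x -> N (Phi x) by move=> /phiU[].
(* The second spanning field is [e3 + Q1 e1] in the coordinates [Phi], and the
   integrability condition says that [Q1] does not depend on [x2]. *)
pose Q1 x := (Q (Phi x) - 'D_(e i3) phi x) / 'D_(e i1) phi x.
have QPhiC : smooth W1 (fun x => Q (Phi x)) by exact: smooth_comp PhiN QC PhiC.
have Q1C : smooth W1 Q1.
  move=> k; apply: CkM => //.
    by apply: CkB => //; exact: smooth_D.
  by apply: CkV => //; [move=> x /phiU[]|exact: smooth_D].
have Q1E x : W1 x -> Q1 x * 'D_(e i1) phi x = Q (Phi x) - 'D_(e i3) phi x.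
  by move=> /phiU[H _]; rewrite divfK.
have D2Q1 x : W1 x -> 'D_(e i2) Q1 x = 0.
  move=> Wx; have [phi10 Nx] := phiU _ Wx.
  have dphi k := Ck_is_derive k (phiC 1%N) Wx.
  have E := derive_eq_on (e i2) oW1 Wx Q1E.
  have EM := Ck_deriveM i2 oW1 (Q1C 1%N) (smooth_D i1 phiC 1%N) Wx.
  have EB := Ck_deriveB i2 oW1 (QPhiC 1%N) (smooth_D i3 phiC 1%N) Wx.
  have S1 := schwarz i2 i1 oW1 (phiC 2%N) Wx.
  have S3 := schwarz i2 i3 oW1 (phiC 2%N) Wx.
  have F1 := derive_eq_on (e i1) oW1 Wx phi2.
  have F3 := derive_eq_on (e i3) oW1 Wx phi2.
  have G2 := derive_comp_upd oN (QC 1%N) Nx (dphi i2).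
  have G1 := derive_comp_upd oN (PC 1%N) Nx (dphi i1).
  have G3 := derive_comp_upd oN (PC 1%N) Nx (dphi i3).
  have H2 := phi2 _ Wx.
  rewrite -/(Phi x) H2 !I3E eqxx in G1 G2 G3.
  rewrite EB S3 F3 G2 G3 in E; rewrite E S1 F1 G1 in EM.
  by apply: (frobenius_identity phi10 (Q1E _ Wx) (PQ _ Nx)); rewrite -EM.
have n31 : i3 = i1 -> Q1 b != 0 by move=> E; have := I3E.1.2; rewrite E eqxx.
have [W2 [psi [y2 [[W2b psib] D2 [psiC psiU] psi3 psi0]]]] :=
  flow_diffeo oW1 W1b Q1C n31.
set Psi2 := fun x => upd x i1 (psi x) in D2 psiU psi3.
(* As [Q1] does not depend on [x2], neither does [psi], and the field straightened first stays
   straight. *)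
have psi2 x : W2 x -> 'D_(e i2) psi x = 0.
  by apply: (psi0 i2); rewrite ?I3E// => z; exact: D2Q1.
have [oW2 _ Psi2C _ _] := D2.
have PsiE x : upd x i1 (phi (Psi2 x)) = Phi (Psi2 x).
  by rewrite /Phi /Psi2 upd_upd.
exists W2, (fun x => phi (Psi2 x)), (y2 \o y1) => Psi; split => //.
- by split=> //; rewrite /Psi2 psib upd_id.
- have -> : Psi = Phi \o Psi2 by apply/funext => x; rewrite /Psi PsiE.
  by apply: local_diffeo_comp D1 D2 _ => x /psiU[].
- by apply: (smooth_comp oW2 oW1) => // x /psiU[].
- by move=> x /psiU[_ /PhiN]; rewrite /Psi PsiE.
- move=> x Wx; have [psi10 W1x] := psiU _ Wx; rewrite /Psi PsiE.
  have G k := derive_comp_upd oW1 (phiC 1%N) W1x (Ck_is_derive k (psiC 1%N) Wx).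
  rewrite -/(Psi2 x) in G.
  split.
    by rewrite (G i2) psi2// !I3E mulr0 add0r mul1r phi2.
  by rewrite (G i3) psi3// !I3E mul1r mulrC Q1E// subrK.
Qed.

End Frobenius.

(** * Determinants, volume densities and divergence *)

Section Divergence.
Variable R : realType.
Local Notation V3 := 'cV[R]_3.
Local Notation e := (canon_basis R).

(** Liouville's formula for [A' = B A]. *)
Lemma is_derive_det3 (V : normedModType R) (A : V -> 'M[R]_3) (B : 'M[R]_3) x v :
  (forall l k, is_derive x v (fun y => A y l k) ((B *m A x) l k)) ->
  is_derive x v (fun y => \det (A y)) (\tr B * \det (A x)).
Proof.
move=> AD.
have dM (f g : V -> R) a b : is_derive x v f a -> is_derive x v g b ->
    is_derive x v (fun y => f y * g y) (f x * b + g x * a).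
  by move=> H1 H2; exact: (is_deriveM H1 H2).
have dB (f g : V -> R) a b : is_derive x v f a -> is_derive x v g b ->
    is_derive x v (fun y => f y - g y) (a - b).
  by move=> H1 H2; exact: (is_deriveB H1 H2).
have dD (f g : V -> R) a b : is_derive x v f a -> is_derive x v g b ->
    is_derive x v (fun y => f y + g y) (a + b).
  by move=> H1 H2; exact: (is_deriveD H1 H2).
have M2 a b c d := dB _ _ _ _ (dM _ _ _ _ (AD i2 a) (AD i3 b))
  (dM _ _ _ _ (AD i2 c) (AD i3 d)).
have H := dD _ _ _ _ (dB _ _ _ _ (dM _ _ _ _ (AD i1 i1) (M2 i2 i3 i3 i2))
  (dM _ _ _ _ (AD i1 i2) (M2 i1 i3 i3 i1)))
  (dM _ _ _ _ (AD i1 i3) (M2 i1 i2 i2 i1)).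
have -> : (fun y => \det (A y)) = (fun y =>
  A y i1 i1 * (A y i2 i2 * A y i3 i3 - A y i2 i3 * A y i3 i2)
  - A y i1 i2 * (A y i2 i1 * A y i3 i3 - A y i2 i3 * A y i3 i1)
  + A y i1 i3 * (A y i2 i1 * A y i3 i2 - A y i2 i2 * A y i3 i1)).
  by apply/funext => y; rewrite det3E.
apply: is_derive_eq H _; rewrite det3E /mxtrace !mxE !sum3E.
ring.
Qed.

Lemma smooth_det_jac (U : set V3) psi : open U -> csmooth U psi ->
  smooth U (fun x => \det (jac psi x)).
Proof.
move=> oU psiC n; have JC l k : is_Ck n U (fun x => jac psi x l k).
  apply: (@Ck_eq _ _ _ _ ('D_(e k) (fun y => psi y l 0))) => //.
    by move=> x _; rewrite mxE.
  exact: Ck_D (psiC l n.+1).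
have -> : (fun x => \det (jac psi x)) = (fun x => let A := jac psi x in
  A i1 i1 * (A i2 i2 * A i3 i3 - A i2 i3 * A i3 i2)
  - A i1 i2 * (A i2 i1 * A i3 i3 - A i2 i3 * A i3 i1)
  + A i1 i3 * (A i2 i1 * A i3 i2 - A i2 i2 * A i3 i1)).
  by apply/funext => x; rewrite det3E.
apply: CkD => //; first apply: CkB => //.
- by apply: CkM => //; apply: CkB => //; apply: CkM.
- by apply: CkM => //; apply: CkB => //; apply: CkM.
- by apply: CkM => //; apply: CkB => //; apply: CkM.
Qed.

(* [L_X Omega = 0] read in coordinates whose third field is [X]: the density does
   not depend on the third coordinate. *)
Lemma derive_density (W N : set V3) psi X (g : V3 -> R) x :
  open W -> csmooth W psi -> open N -> csmooth N X -> smooth N g ->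
  (forall x, W x -> N (psi x)) ->
  (forall x l, W x -> 'D_(e i3) (fun y => psi y l 0) x = X (psi x) l 0) ->
  W x ->
  'D_(e i3) (fun y => g (psi y) * \det (jac psi y)) x =
  (\sum_l X (psi x) l 0 * 'D_(e l) g (psi x) +
   g (psi x) * \sum_l 'D_(e l) (fun y => X y l 0) (psi x)) * \det (jac psi x).
Proof.
move=> oW psiC oN XC gC WN psi3 Wx; have Nx := WN _ Wx.
have psiD k l := csmooth_is_derive k l psiC Wx.
have JD l k : is_derive x (e i3) (fun y => jac psi y l k)
    ((jac X (psi x) *m jac psi x) l k).
  have -> : (fun y => jac psi y l k) = 'D_(e k) (fun y => psi y l 0).
    by apply/funext => y; rewrite mxE.
  have H := Ck_is_derive i3 (Ck_D k (psiC l 2%N)) Wx.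
  apply: is_derive_eq H _.
  (* By symmetry of second derivatives each column of the Jacobian satisfies the equation linearized
     along [X], which is the hypothesis of Liouville's formula. *)
  rewrite (schwarz i3 k oW (psiC l 2%N) Wx).
  rewrite (derive_eq_on _ oW Wx (fun y Wy => psi3 y l Wy)).
  have [_ ->] := derive_comp oN (XC l 1%N) Nx (psiD k).
  by rewrite mxE; apply: eq_bigr => m _; rewrite !mxE.
have gD := derive_comp oN (gC 1%N) Nx (psiD i3).
have [_ ->] := is_deriveM gD (is_derive_det3 JD).
have -> : \sum_l X (psi x) l 0 * 'D_(e l) g (psi x) =
    \sum_l 'D_(e l) g (psi x) * 'D_(e i3) (fun y => psi y l 0) x.
  by apply: eq_bigr => l _; rewrite psi3// mulrC.
have -> : \tr (jac X (psi x)) = \sum_l 'D_(e l) (fun y => X y l 0) (psi x).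
  by apply: eq_bigr => l _; rewrite mxE.
rewrite /GRing.scale /=.
by move: (\sum_l _) (\sum_l _) (g _) (\det _) => p q r s; ring.
Qed.

End Divergence.

(** * Straightening the field in the leaves and normalizing the volume *)

Section Straighten.
Variable R : realType.
Local Notation V3 := 'cV[R]_3.
Local Notation e := (canon_basis R).

Lemma det_jac_diffeo (W : set V3) psi y x : local_diffeo W psi y -> W x ->
  \det (jac psi x) != 0.
Proof.
move=> D Wx; have := congr1 determinant (jac_diffeo D Wx).
rewrite det_mulmx det1 => E; apply/eqP => d0; move: E; rewrite d0 mulr0.
by move/esym/eqP; rewrite oner_eq0.
Qed.

Lemma det_jac_upd U (phi : V3 -> R) j x : is_Ck 1 U phi -> U x ->
  \det (jac (fun y => upd y j (phi y)) x) = 'D_(e j) phi x.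
Proof.
move=> phiC Ux; pose d k := 'D_(e k) phi x.
have -> : jac (fun y => upd y j (phi y)) x =
    \matrix_(l, k) (if l == j then d k else (l == k)%:R).
  apply/matrixP => l k; rewrite !mxE.
  have -> : (fun y => upd y j (phi y) l 0) =
      (fun y => if l == j then phi y else y l 0).
    by apply/funext => y; rewrite updE.
  case: eqP => // _; have [_ ->] := is_derive_coord x (e k) l.
  by rewrite mxE eqxx andbT.
rewrite -/(d j); clearbody d; rewrite det3E !mxE.
by move: j; apply: I3P; rewrite !I3E !eqxx /=; ring.
Qed.

(* After Frobenius, [x2] and [x3] are coordinates on each leaf: one flow in the
   leaves makes [X] a multiple of the third coordinate field, and reparametrizing
   [x3] removes the factor. *)
Lemma rectify (N : set V3) (P Q : V3 -> R) X b :
  open N -> N b -> smooth N P -> smooth N Q -> csmooth N X ->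
  (forall x, N x -> 'D_(e i2) Q x + P x * 'D_(e i1) Q x =
                    'D_(e i3) P x + Q x * 'D_(e i1) P x) ->
  (forall x, N x -> X x i1 0 = P x * X x i2 0 + Q x * X x i3 0) ->
  (forall x, N x -> X x i3 0 != 0) ->
  exists W psi y, [/\ W b /\ psi b = b, local_diffeo W psi y,
    forall x, W x -> N (psi x),
    forall x l, W x -> 'D_(e i3) (fun z => psi z l 0) x = X (psi x) l 0 &
    forall x, W x -> 'D_(e i2) (fun z => psi z i1 0) x =
      P (psi x) * 'D_(e i2) (fun z => psi z i2 0) x +
      Q (psi x) * 'D_(e i2) (fun z => psi z i3 0) x].
Proof.
move=> oN Nb PC QC XC PQ X1 X3.
have [W0 [eta [y0 [[W0b etab] D0 etaC PsiN deta]]]] := frobenius oN Nb PC QC PQ.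
set Psi := fun x => upd x i1 (eta x) in D0 PsiN deta.
have [oW0 _ PsiC _ _] := D0.
have XPC l : smooth W0 (fun x => X (Psi x) l 0).
  by apply: (@smooth_comp _ W0 N (fun y => X y l 0)) => // n; exact: XC.
pose F3 x := X (Psi x) i2 0 / X (Psi x) i3 0.
have F3C : smooth W0 F3.
  move=> n; apply: CkM => //; first exact: XPC.
  by apply: CkV; [|move=> x /PsiN/X3|exact: XPC].
have n32 : i3 = i2 -> F3 b != 0 by move=> E; have := I3E.2; rewrite E eqxx.
have [W3 [phi3 [y3 [[W3b phi3b] D3 [phi3C phi3U] phi33 _]]]] :=
  flow_diffeo oW0 W0b F3C n32.
set Phi3 := fun x => upd x i2 (phi3 x) in D3 phi3U phi33.
have [oW3 _ Phi3C _ _] := D3.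
have Phi3W x : W3 x -> W0 (Phi3 x) by move=> /phi3U[].
pose F4 x := X (Psi (Phi3 x)) i3 0.
have F4C : smooth W3 F4 by exact: (smooth_comp oW3 oW0 Phi3W (XPC i3) Phi3C).
(* The autonomous case of [flow_diffeo]: the speed along [x3] has to be nonzero at [b]. *)
have F4b : i3 = i3 -> F4 b != 0 by move=> _; apply: X3; apply: PsiN; exact: Phi3W.
have [W4 [phi4 [y4 [[W4b phi4b] D4 [phi4C phi4U] phi43 _]]]] :=
  flow_diffeo oW3 W3b F4C F4b.
set Phi4 := fun x => upd x i3 (phi4 x) in D4 phi4U phi43.
have [oW4 _ Phi4C _ _] := D4.
have Phi4W x : W4 x -> W3 (Phi4 x) by move=> /phi4U[].
have D34 := local_diffeo_comp D3 D4 Phi4W.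
pose psi := Psi \o (Phi3 \o Phi4).
have D := local_diffeo_comp D0 D34 (fun x Wx => Phi3W _ (Phi4W _ Wx)).
have [_ _ Phi34C _ _] := D34.
have c2E : (fun z => (Phi3 \o Phi4) z i2 0) = (fun z => phi3 (Phi4 z)).
  by apply/funext => z; rewrite /Phi3/= upd_same.
have c3E : (fun z => (Phi3 \o Phi4) z i3 0) = phi4.
  by apply/funext => z; rewrite /Phi3/Phi4/= updE I3E upd_same.
have c1E : (fun z => (Phi3 \o Phi4) z i1 0) = (fun z => z i1 0).
  by apply/funext => z; rewrite /Phi3/Phi4/= !updE !I3E.
have p1E : (fun z => psi z i1 0) = eta \o (Phi3 \o Phi4).
  by apply/funext => z; rewrite /psi/Psi/= upd_same.
have p2E : (fun z => psi z i2 0) = (fun z => phi3 (Phi4 z)).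
  by rewrite -c2E; apply/funext => z; rewrite /psi/Psi/= updE I3E.
have p3E : (fun z => psi z i3 0) = phi4.
  by rewrite -c3E; apply/funext => z; rewrite /psi/Psi/= updE I3E.
(* [Phi3] and [Phi4] preserve the first coordinate, which labels the leaves, so the coordinate
   fields along [x2] and [x3] remain tangent to them. *)
have leaf x k : W4 x -> k != i1 -> 'D_(e k) (fun z => psi z i1 0) x =
    P (psi x) * 'D_(e k) (fun z => psi z i2 0) x +
    Q (psi x) * 'D_(e k) (fun z => psi z i3 0) x.
  move=> Wx ki; have W0x : W0 ((Phi3 \o Phi4) x) by exact/Phi3W/Phi4W.
  have [_ H] := derive_comp oW0 (etaC 1%N) W0x
    (fun l => csmooth_is_derive k l Phi34C Wx).
  have [dc1] := is_derive_coord x (e k) i1; rewrite mxE eqxx andbT => dc1E.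
  rewrite p1E H sum3E c1E c2E c3E dc1E eq_sym (negbTE ki) mulr0 add0r p2E p3E.
  by have [-> ->] := deta _ W0x.
have d3 x : W4 x -> 'D_(e i3) (fun z => psi z i3 0) x = X (psi x) i3 0.
  by move=> Wx; rewrite p3E phi43.
have d2 x : W4 x -> 'D_(e i3) (fun z => psi z i2 0) x = X (psi x) i2 0.
  move=> Wx; have W3x := Phi4W _ Wx.
  have H := derive_comp_upd oW3 (phi3C 1%N) W3x (Ck_is_derive i3 (phi4C 1%N) Wx).
  rewrite p2E H eqxx mul0r addr0 phi43// phi33// /F3 /F4 divfK//.
  by apply: X3; apply: PsiN; exact: Phi3W.
have Nx x : W4 x -> N (psi x) by move=> Wx; apply/PsiN/Phi3W/Phi4W.
exists W4, psi, ((y4 \o y3) \o y0); split => //.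
- split=> //; rewrite /psi /Phi4/= phi4b upd_id /Phi3 phi3b upd_id.
  by rewrite /Psi etab upd_id.
- move=> x l Wx; move: l; apply: I3P; [|exact: d2|exact: d3].
  by rewrite leaf ?I3E// d2// d3// -X1//; exact: Nx.
- by move=> x Wx; rewrite leaf// I3E.
Qed.

(** The last five hypotheses read: the plane field is integrable, [X] is tangent to it and
    transverse to the planes of constant [x3], the density [g] has no zeros, and [X] preserves the
    volume. *)
Lemma straighten (N : set V3) (P Q g : V3 -> R) X b :
  open N -> N b -> smooth N P -> smooth N Q -> csmooth N X -> smooth N g ->
  (forall x, N x -> 'D_(e i2) Q x + P x * 'D_(e i1) Q x =
                    'D_(e i3) P x + Q x * 'D_(e i1) P x) ->
  (forall x, N x -> X x i1 0 = P x * X x i2 0 + Q x * X x i3 0) ->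
  (forall x, N x -> X x i3 0 != 0) ->
  (forall x, N x -> g x != 0) ->
  (forall x, N x -> \sum_l X x l 0 * 'D_(e l) g x +
                    g x * \sum_l 'D_(e l) (fun y => X y l 0) x = 0) ->
  exists W psi y, [/\ W b /\ psi b = b, local_diffeo W psi y,
    forall x, W x -> N (psi x),
    forall x l, W x -> 'D_(e i3) (fun z => psi z l 0) x = X (psi x) l 0 &
    forall x, W x -> 'D_(e i2) (fun z => psi z i1 0) x =
      P (psi x) * 'D_(e i2) (fun z => psi z i2 0) x +
      Q (psi x) * 'D_(e i2) (fun z => psi z i3 0) x /\
      g (psi x) * \det (jac psi x) = 1].
Proof.
move=> oN Nb PC QC XC gC PQ X1 X3 g0 divX.
have [W [psi [y [[Wb psib] D psiN psi3 psi2]]]] :=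
  rectify oN Nb PC QC XC PQ X1 X3.
have [oW _ psiC _ _] := D.
pose h x := g (psi x) * \det (jac psi x).
have h0 x : W x -> h x != 0.
  move=> Wx; rewrite mulf_neq0 ?(det_jac_diffeo D)//.
  by apply: g0; exact: psiN.
have hC : smooth W h.
  move=> n; apply: CkM => //; last exact: smooth_det_jac.
  exact: (smooth_comp oW oN psiN gC psiC).
have h3 x : W x -> 'D_(e i3) h x = 0.
  move=> Wx; rewrite (derive_density oW psiC oN XC gC psiN psi3 Wx) divX ?mul0r//.
  exact: psiN.
(* A map altering only [x2] by [phi] has Jacobian determinant ['D_(e i2) phi]; solving the equation
   with right side [1 / h] along [x2] therefore cancels the density [h]. *)
pose F x := (h x)^-1.
have FC : smooth W F by move=> n; apply: CkV => //; exact: hC.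
have F3 x : W x -> 'D_(e i3) F x = 0.
  move=> Wx; have hD := Ck_is_derive i3 (hC 1%N) Wx.
  have VD := @is_deriveV _ id (h x) 1 1 (h0 _ Wx) (is_derive_id _ _).
  have [_ ->] := is_derive_outer VD hD.
  by rewrite h3// mulr0.
have Fb : i2 = i2 -> F b != 0 by move=> _; rewrite invr_eq0 h0.
have [W5 [phi [y5 [[W5b phib] D5 [phiC phiU] phi2 phi0]]]] :=
  flow_diffeo oW Wb FC Fb.
set Phi := fun x => upd x i2 (phi x) in D5 phiU phi2.
have [oW5 _ PhiC _ _] := D5.
have PhiW x : W5 x -> W (Phi x) by move=> /phiU[].
(* [h] is independent of [x3], hence so is [phi], and the third coordinate field is still [X]. *)
have phi3 x : W5 x -> 'D_(e i3) phi x = 0 by apply: (phi0 i3); rewrite ?I3E.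
have dE k l x : W5 x -> 'D_(e k) (fun z => psi (Phi z) l 0) x =
    'D_(e i2) (fun z => psi z l 0) (Phi x) * 'D_(e k) phi x +
    (k != i2)%:R * 'D_(e k) (fun z => psi z l 0) (Phi x).
  move=> Wx; exact: (derive_comp_upd oW (psiC l 1%N) (PhiW _ Wx)
    (Ck_is_derive k (phiC 1%N) Wx)).
exists W5, (psi \o Phi), (y5 \o y); split.
- by split=> //; rewrite /Phi/= phib upd_id.
- exact: local_diffeo_comp D D5 PhiW.
- by move=> x /PhiW/psiN.
- move=> x l Wx; rewrite dE// phi3// mulr0 add0r I3E mul1r psi3//.
  exact: PhiW.
- move=> x Wx; split.
    rewrite !dE// eqxx !mul0r !addr0 psi2; last exact: PhiW.
    by rewrite mulrDl !mulrA.
  rewrite (jac_comp oW psiC PhiC Wx (PhiW _ Wx)) det_mulmx.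
  rewrite (det_jac_upd i2 (phiC 1%N) Wx) phi2// mulrA -/(h (Phi x)).
  by rewrite /F divff// h0//; exact: PhiW.
Qed.

End Straighten.

(** * Frames, spans and alternating forms *)

Section LinearAlgebra.
Variable R : realType.
Local Notation V3 := 'cV[R]_3.
Local Notation e := (canon_basis R).
Implicit Types (u v w : V3) (J K : 'M[R]_3).

Definition triple u v w : 'M[R]_3 :=
  \matrix_(l, k) (if k == i1 then u l 0 else if k == i2 then v l 0 else w l 0).

Lemma triple_col J : triple (col i1 J) (col i2 J) (col i3 J) = J.
Proof.
apply/matrixP => l k; rewrite !mxE.
by move: k; apply: I3P; rewrite ?I3E ?eqxx.
Qed.

Lemma det_tripleE u v w : \det (triple u v w) =
  u i1 0 * (v i2 0 * w i3 0 - w i2 0 * v i3 0)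
  - v i1 0 * (u i2 0 * w i3 0 - w i2 0 * u i3 0)
  + w i1 0 * (u i2 0 * v i3 0 - v i2 0 * u i3 0).
Proof. by rewrite det3E !mxE !I3E !eqxx. Qed.

Lemma mulmx_colE J w :
  J *m w = w i1 0 *: col i1 J + (w i2 0 *: col i2 J + w i3 0 *: col i3 J).
Proof. by apply/colP => l; rewrite !mxE sum3E; ring. Qed.

Lemma cV3E w : w = w i1 0 *: e i1 + (w i2 0 *: e i2 + w i3 0 *: e i3).
Proof.
apply/colP; apply: I3P; rewrite !mxE !I3E !eqxx /=; ring.
Qed.

Lemma mem_span2 u v w :
  w \in <<[:: u; v]>>%VS <-> exists s t, w = s *: u + t *: v.
Proof.
rewrite span_cons span_seq1; split.
  move=> /memv_addP[x /vlineP[s ->] [y /vlineP[t ->] ->]].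
  by exists s, t.
by move=> [s [t ->]]; apply: memv_add; apply/vlineP; [exists s|exists t].
Qed.

(** [(K *m v) i1 0] is the first component of [v] in the frame [J]; for a Jacobian frame it is the
    differential of the first coordinate. *)
Lemma mem_frame_span J K v : K *m J = 1%:M ->
  v \in <<[:: col i2 J; col i3 J]>>%VS <-> (K *m v) i1 0 = 0.
Proof.
move=> KJ; have JK := mulmx1C KJ; split.
  move=> /mem_span2[s [t ->]].
  have -> : s *: col i2 J + t *: col i3 J = J *m (s *: e i2 + t *: e i3).
    by rewrite mulmxDr -!scalemxAr !colE.
  by rewrite mulmxA KJ mul1mx !mxE !I3E /=; ring.
move=> Kv; apply/mem_span2; exists ((K *m v) i2 0), ((K *m v) i3 0).
by rewrite -{1}(mul1mx v) -JK -mulmxA mulmx_colE Kv scale0r add0r.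
Qed.

(** A criterion without the inverse of [J]: the plane is the kernel of a one-form polynomial in the
    two spanning vectors. *)
Lemma det_frame_span J v : J \in unitmx ->
  v \in <<[:: col i2 J; col i3 J]>>%VS <->
  \det (triple v (col i2 J) (col i3 J)) = 0.
Proof.
move=> uJ; rewrite (mem_frame_span v (mulVmx uJ)).
have {2}-> : v = J *m (invmx J *m v) by rewrite mulmxA mulmxV// mul1mx.
move: (invmx J *m v) => w.
have -> : \det (triple (J *m w) (col i2 J) (col i3 J)) = w i1 0 * \det J.
  by rewrite mulmx_colE (det3E J) det_tripleE !mxE; ring.
split=> [->|/eqP]; first by rewrite mul0r.
move: uJ; rewrite unitmxE unitfE mulf_eq0 => /negbTE ->; rewrite orbF.
by move/eqP.
Qed.

Lemma det_triple_mulmx J w v v' : \det (triple (J *m w) v v') =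
  \sum_k w k 0 * \det (triple (col k J) v v').
Proof. by rewrite mulmx_colE sum3E !det_tripleE !mxE; ring. Qed.

(** The infinitesimal form of the multiplicativity of the determinant; through it the divergence
    enters the Lie derivative. *)
Lemma det_triple_trace J u v w :
  \det (triple (J *m u) v w) + \det (triple u (J *m v) w) +
  \det (triple u v (J *m w)) = \tr J * \det (triple u v w).
Proof. by rewrite /mxtrace sum3E !det_tripleE !mxE !sum3E; ring. Qed.

Lemma scalar3 (f : V3 -> R) w : scalar f ->
  f w = w i1 0 * f (e i1) + (w i2 0 * f (e i2) + w i3 0 * f (e i3)).
Proof.
move=> fS; have f0 : f 0 = 0.
  by have := fS 1 0 0; rewrite scale1r addr0 mul1r => /eqP;
    rewrite -subr_eq subrr eq_sym => /eqP.
rewrite {1}(cV3E w) fS fS -[w i3 0 *: _]addr0 fS f0; ring.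
Qed.

Lemma form_det (f : V3 -> V3 -> V3 -> R) :
  (forall v w, (scalar (fun u => f u v w) /\ scalar (fun u => f v u w)) /\
               scalar (fun u => f v w u)) ->
  (forall u v, [/\ f u u v = 0, f u v u = 0 & f v u u = 0]) ->
  forall u v w, f u v w = f (e i1) (e i2) (e i3) * \det (triple u v w).
Proof.
move=> fS f0.
have D1 u u' v w : f (u + u') v w = f u v w + f u' v w.
  by have := (fS v w).1.1 1 u u'; rewrite scale1r mul1r.
have D2 u u' v w : f v (u + u') w = f v u w + f v u' w.
  by have := (fS v w).1.2 1 u u'; rewrite scale1r mul1r.
have D3 u u' v w : f v w (u + u') = f v w u + f v w u'.
  by have := (fS v w).2 1 u u'; rewrite scale1r mul1r.
have A12 u v w : f u v w = - f v u w.
  have [H _ _] := f0 (u + v) w; have [Hu _ _] := f0 u w; have [Hv _ _] := f0 v w.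
  move: H; rewrite D1 !D2 Hu Hv add0r addr0 => /eqP.
  by rewrite addr_eq0 => /eqP.
have A23 u v w : f u v w = - f u w v.
  have [_ _ H] := f0 (v + w) u; have [_ _ Hu] := f0 v u; have [_ _ Hv] := f0 w u.
  move: H; rewrite D2 !D3 Hu Hv add0r addr0 => /eqP.
  by rewrite addr_eq0 => /eqP.
have Z u v : (f u u v = 0) * (f u v u = 0) * (f v u u = 0).
  by have [-> -> ->] := f0 u v.
move=> u v w; set g := f (e i1) (e i2) (e i3).
have E132 : f (e i1) (e i3) (e i2) = - g by rewrite A23.
have E213 : f (e i2) (e i1) (e i3) = - g by rewrite A12.
have E231 : f (e i2) (e i3) (e i1) = g by rewrite A23 E213 opprK.
have E312 : f (e i3) (e i1) (e i2) = g by rewrite A12 E132 opprK.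
have E321 : f (e i3) (e i2) (e i1) = - g by rewrite A12 E231.
rewrite (scalar3 u (fS v w).1.1).
rewrite !(scalar3 v (fS _ w).1.2) !(scalar3 w (fS _ _).2) !Z.
rewrite E132 E213 E231 E312 E321 -/g det_tripleE; ring.
Qed.

End LinearAlgebra.

(** * Fields and forms read in the global chart *)

Section Chart.
Variables (R : realType) (B : body R).
Local Notation V3 := 'cV[R]_3.
Local Notation e := (canon_basis R).
Local Notation c := (chart B).
Implicit Types (V : set B) (Y : B -> V3).

Lemma in_chartE (W : zmodType) (f : B -> W) p : in_chart f (c p) = f p.
Proof.
rewrite /in_chart; case: pselect => [H|[]]; last by exists p.
by congr f; apply: (@chart_inj _ B); case: cid.
Qed.

Lemma smooth_csmooth (O : set V3) (Y : V3 -> V3) : open O ->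
  smooth O Y <-> csmooth O Y.
Proof.
move=> oO; split=> [YC l k|YC k].
  by have := (Ck_mxP k Y oO).1 (YC k) l 0.
by apply/(Ck_mxP k Y oO) => l m; rewrite (ord1 m); exact: YC.
Qed.

Lemma derive_jac (O : set V3) (Y : V3 -> V3) x v : open O -> csmooth O Y ->
  O x -> 'D_v Y x = jac Y x *m v.
Proof.
move=> oO YC Ox; have YD l := CkZ_derive v oO (YC l 1%N) Ox.
have dY : derivable Y x v.
  by apply/derivable_mxP => l m; rewrite (ord1 m); have [] := YD l.
apply/colP => l; rewrite derive_mx// !mxE; have [_ ->] := YD l.
by apply: eq_bigr => k _; rewrite mxE.
Qed.

Lemma range_open : open (range c).
Proof. by apply: chart_open; exact: openT. Qed.

(** The bracket of [X] with a constant field [u] is minus the Jacobian of [X] applied to [u], so the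
    three bracket terms of the definition add up to a trace. *)
Lemma lie_derivativeE (X : B -> V3) (Omega : form3 B) p u v w :
  smooth_on setT X -> volume_form Omega ->
  let g := in_chart (fun q => Omega q (e i1) (e i2) (e i3)) in
  lie_derivative X Omega p u v w =
  (\sum_l X p l 0 * 'D_(e l) g (c p) +
   g (c p) * \sum_l 'D_(e l) (fun y => in_chart X y l 0) (c p)) *
  \det (triple u v w).
Proof.
move=> XC [OS O0 _ OC] g.
have XC' : csmooth (range c) (in_chart X).
  by apply/smooth_csmooth; [exact: range_open|exact: XC].
have cp : range c (c p) by exists p.
have OE q u' v' w' : Omega q u' v' w' = g (c q) * \det (triple u' v' w').
  by rewrite /g in_chartE; apply: form_det; [exact: OS|exact: O0].
have bracketE u' : lie_bracket X (cst u') p = - (jac (in_chart X) (c p) *m u').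
  rewrite /lie_bracket /dir_derive -(derive_jac u' range_open XC' cp).
  have -> : 'D_(X p) (in_chart (cst u' : B -> V3)) (c p) = 0.
    rewrite -(derive_cst u' (c p) (X p)); apply: near_eq_derive.
    by apply: (open_near range_open cp) => _ [q _ <-]; rewrite in_chartE.
  by rewrite sub0r.
have gD : dir_derive p (X p) (fun q => Omega q u v w) =
    (\sum_l X p l 0 * 'D_(e l) g (c p)) * \det (triple u v w).
  have gC : smooth (range c) g by exact: OC.
  have [dg Eg] := CkZ_derive (X p) range_open (gC 1%N) cp.
  transitivity ('D_(X p) (fun z => g z * \det (triple u v w)) (c p)).
    apply: near_eq_derive; apply: (open_near range_open cp) => _ [q _ <-].
    by rewrite in_chartE OE.
  have [_ ->] := is_deriveM (derivableP dg)
    (is_derive_cst (\det (triple u v w)) (c p) (X p)).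
  rewrite Eg scaler0 add0r [LHS]mulrC; congr (_ * _).
  by apply: eq_bigr => l _; rewrite mulrC.
have -> : \sum_l 'D_(e l) (fun y => in_chart X y l 0) (c p) =
    \tr (jac (in_chart X) (c p)).
  by apply: eq_bigr => l _; rewrite mxE.
rewrite /lie_derivative gD !bracketE !OE mulrDl -[in RHS]mulrA -det_triple_trace.
rewrite -!mulmxN !mulmxN.
have N1 a b d : \det (triple (- a) b d) = - \det (triple a b d).
  by rewrite !det_tripleE !mxE; ring.
have N2 a b d : \det (triple b (- a) d) = - \det (triple b a d).
  by rewrite !det_tripleE !mxE; ring.
have N3 a b d : \det (triple b d (- a)) = - \det (triple b d a).
  by rewrite !det_tripleE !mxE; ring.
rewrite N1 N2 N3.
move: (\det _) (\det _) (\det _) (\det _) (g _) (\sum_l _) => a1 a2 a3 a4 a5 a6.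
ring.
Qed.

End Chart.

(** * The two implications *)

Section Forward.
Variables (R : realType) (B : body R).
Local Notation V3 := 'cV[R]_3.
Local Notation e := (canon_basis R).
Local Notation c := (chart B).

Lemma derive_sum_mul_eq0 (O : set V3) (a b : 'I_3 -> V3 -> R)
    (da db : 'I_3 -> R) x v : open O -> O x ->
  (forall l, is_derive x v (a l) (da l)) ->
  (forall l, is_derive x v (b l) (db l)) ->
  (forall z, O z -> \sum_l a l z * b l z = 0) ->
  \sum_l a l x * db l = - \sum_l b l x * da l.
Proof.
move=> oO Ox aD bD ab0.
have abD l : is_derive x v (fun z => a l z * b l z) (a l x * db l + b l x * da l).
  exact: (is_deriveM (aD l) (bD l)).
have [_ SD] := is_deriveD (is_deriveD (abD i1) (abD i2)) (abD i3).
have S0 : 'D_v (fun z => a i1 z * b i1 z + a i2 z * b i2 z + a i3 z * b i3 z) x = 0.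
  rewrite -(derive_cst (0 : R) x v); apply: (derive_eq_on _ oO Ox) => z Oz.
  by have := ab0 _ Oz; rewrite sum3E.
have {}SD : 0 = _ := etrans (esym S0) SD.
apply/eqP; rewrite -subr_eq0 opprK; apply/eqP; rewrite [RHS]SD !sum3E.
by ring.
Qed.

Lemma kernel_bracket (O : set V3) (f : V3 -> R) (Y Z : V3 -> V3) x : open O ->
  smooth O f -> csmooth O Y -> csmooth O Z -> O x ->
  (forall z, O z -> \sum_l 'D_(e l) f z * Y z l 0 = 0) ->
  (forall z, O z -> \sum_l 'D_(e l) f z * Z z l 0 = 0) ->
  \sum_l 'D_(e l) f x * ('D_(Y x) Z x - 'D_(Z x) Y x) l 0 = 0.
Proof.
move=> oO fC YC ZC Ox fY fZ.
rewrite (derive_jac (Y x) oO ZC Ox) (derive_jac (Z x) oO YC Ox).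
pose a l := 'D_(e l) f x; pose H k l := 'D_(e k) ('D_(e l) f) x.
have S k l : H k l = H l k := schwarz k l oO (fC 2%N) Ox.
(* Differentiating [df(T) = 0] along [k] trades derivatives of [T] for second derivatives of [f],
   which cancel in the bracket by [S]. *)
have K (T : V3 -> V3) k : csmooth O T ->
    (forall z, O z -> \sum_l 'D_(e l) f z * T z l 0 = 0) ->
    \sum_l a l * jac T x l k = - \sum_l T x l 0 * H k l.
  move=> TC fT; apply: (derive_sum_mul_eq0 (v := e k) oO Ox _ _ fT) => l.
    exact: Ck_is_derive (smooth_D l fC 1%N) Ox.
  by rewrite mxE; exact: csmooth_is_derive TC Ox.
have KY k := K Y k YC fY; have KZ k := K Z k ZC fZ.
change (\sum_l a l * (jac Z x *m Y x - jac Y x *m Z x) l 0 = 0).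
move: KY KZ; move: (Y x) (Z x) (jac Y x) (jac Z x) => y z JY JZ KY KZ.
clear K; clearbody a H.
have -> : \sum_l a l * (JZ *m y - JY *m z) l 0 =
    \sum_k y k 0 * (\sum_l a l * JZ l k) - \sum_k z k 0 * (\sum_l a l * JY l k).
  by rewrite !sum3E !mxE !sum3E; ring.
under eq_bigr do rewrite KZ; under [X in _ - X]eq_bigr do rewrite KY.
by rewrite !sum3E (S i2 i1) (S i3 i1) (S i3 i2); ring.
Qed.

Lemma coordinates_diffeo (V : set B) y psi : local_coordinates V y psi ->
  local_diffeo (y @` V) psi (in_chart y) /\ psi @` (y @` V) = c @` V.
Proof.
move=> [oV oyV yC psiC psiK].
have IE : psi @` (y @` V) = c @` V.
  rewrite image_comp; apply/seteqP; split=> _ [q Vq <-]; exists q => //=;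
    by rewrite ?psiK.
split=> //; split => //.
- by rewrite IE; exact: chart_open.
- by apply/(smooth_csmooth psi oyV).
- by rewrite IE; apply/smooth_csmooth => //; exact: chart_open.
- by move=> _ [q Vq <-]; rewrite psiK// in_chartE.
Qed.

Lemma coordinate_frameE (V : set B) y psi q : local_coordinates V y psi -> V q ->
  coordinate_frame y psi q = jac psi (y q).
Proof.
move=> LC Vq; have [[oV _ psiC _ _] _] := coordinates_diffeo LC.
apply/matrixP => l k; rewrite mxE (derive_jac _ oV psiC); last by exists q.
by rewrite -colE mxE.
Qed.

Variables (D : B -> {vspace V3}) (X : B -> V3) (Omega : form3 B).
Variable P : G_structure B (G1B R).
Hypothesis hP : forall p u, P p u <-> adapted_frame D X Omega p u.
Hypothesis intP : integrable_G_structure P.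

Lemma integrable_involutive : involutive_distribution D.
Proof.
move=> V Y Z oV YC ZC YD ZD q Vq.
have [V' [y [psi [V'q LC HP]]]] := intP q.
have [Dpsi IE] := coordinates_diffeo LC.
have [oV' _ _ _ _] := LC; have [_ _ _ ycC _] := Dpsi.
rewrite IE in ycC.
have memD q' v : V' q' -> v \in D q' <->
    \sum_l 'D_(e l) (fun z => in_chart y z i1 0) (c q') * v l 0 = 0.
  move=> V'q'; have [_ _ <- _] := (hP _ _).1 (HP _ V'q').
  rewrite (coordinate_frameE LC V'q').
  have yq : (y @` V') (y q') by exists q'.
  have := jac_diffeo Dpsi yq; have [_ _ _ _ ->] := LC => // KJ.
  rewrite (mem_frame_span v KJ) mxE.
  by under eq_bigr do rewrite mxE.
have oO : open (c @` (V `&` V')) by apply: chart_open; exact: openI.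
have sV : c @` (V `&` V') `<=` c @` V by apply: image_subset => ? [].
have sV' : c @` (V `&` V') `<=` c @` V' by apply: image_subset => ? [].
apply/(memD _ _ V'q).
have := @kernel_bracket (c @` (V `&` V')) (fun z => in_chart y z i1 0)
  (in_chart Y) (in_chart Z) (c q) oO.
rewrite !in_chartE; apply.
- by move=> k; apply: Ck_sub sV' (ycC i1 k).
- apply: csmooth_sub sV _; apply/smooth_csmooth => //; exact: chart_open.
- apply: csmooth_sub sV _; apply/smooth_csmooth => //; exact: chart_open.
- by exists q.
- by move=> _ [q' [Vq' V'q'] <-]; rewrite in_chartE; apply/(memD _ _ V'q')/YD.
- by move=> _ [q' [Vq' V'q'] <-]; rewrite in_chartE; apply/(memD _ _ V'q')/ZD.
Qed.

Lemma integrable_lie (XC : smooth_on setT X) (OV : volume_form Omega) p u v w :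
  lie_derivative X Omega p u v w = 0.
Proof.
have [V [y [psi [Vp LC HP]]]] := intP p.
have [Dpsi IE] := coordinates_diffeo LC.
have [oV oyV _ _ psiK] := LC; have [_ _ psiC _ _] := Dpsi.
rewrite lie_derivativeE//; set g := in_chart _.
have [OS O0 _ OC] := OV.
have yp : (y @` V) (y p) by exists p.
have gC : smooth (range c) g by exact: OC.
have XC' : csmooth (range c) (in_chart X).
  by apply/smooth_csmooth; [exact: range_open|exact: XC].
have psiR x : (y @` V) x -> range c (psi x).
  by move=> [q Vq <-]; rewrite psiK//; exists q.
have psi3 x l : (y @` V) x ->
    'D_(e i3) (fun z => psi z l 0) x = in_chart X (psi x) l 0.
  move=> [q Vq <-]; rewrite psiK// in_chartE.
  have [_ <- _ _] := (hP _ _).1 (HP _ Vq).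
  by rewrite (coordinate_frameE LC Vq) !mxE.
have h1 x : (y @` V) x -> g (psi x) * \det (jac psi x) = 1.
  move=> [q Vq <-]; rewrite psiK//.
  have [_ _ _ E] := (hP _ _).1 (HP _ Vq).
  rewrite -E (coordinate_frameE LC Vq) (form_det (OS q) (O0 q)) triple_col.
  by rewrite /g in_chartE.
(* Here the density is constantly 1, so its derivative is zero, and the nonzero Jacobian determinant
   cancels. *)
have := derive_density oyV psiC (@range_open _ B) XC' gC psiR psi3 yp.
rewrite (derive_eq_on _ oyV yp h1) derive_cst psiK// in_chartE => /esym/eqP.
rewrite mulf_eq0 (negbTE (det_jac_diffeo Dpsi yp)) orbF => /eqP ->.
by rewrite mul0r.
Qed.

End Forward.

(** * Linear changes of coordinates *)

Section LinearChange.
Variable R : realType.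
Local Notation V3 := 'cV[R]_3.
Local Notation e := (canon_basis R).
Implicit Types (U : set V3) (A : 'M[R]_3).

Lemma open_neq0 U (f : V3 -> R) : open U -> smooth U f ->
  open (U `&` [set x | f x != 0]).
Proof.
move=> oU fC; rewrite openE => x [Ux fx0].
apply: filterI; first exact: open_nbhs_nbhs.
have f0 : 0 < `|f x| by rewrite normr_gt0.
have := (continuous_epsP _ _).1 (Ck_cont (fC 0%N) Ux) _ f0.
apply: filterS => y; apply: contraTneq => ->.
by rewrite sub0r normrN ltxx.
Qed.

Lemma csmooth_mulmx U A Y : open U -> csmooth U Y ->
  csmooth U (fun z => A *m Y z).
Proof.
move=> oU YC l n; apply: (@Ck_eq _ _ _ _ (fun z => \sum_m A l m * Y z m 0)) => //.
  by move=> z _; rewrite mxE.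
by apply: Ck_sum => // m; apply: CkM => //; exact: (@Ck_cst _ R).
Qed.

Lemma jac_mulmx U A Y x : open U -> csmooth U Y -> U x ->
  jac (fun z => A *m Y z) x = A *m jac Y x.
Proof.
move=> oU YC Ux; apply/matrixP => l k; rewrite !mxE.
have YD m := csmooth_is_derive k m YC Ux.
have AD m : is_derive x (e k) (fun z => A l m * Y z m 0) (A l m * jac Y x m k).
  by rewrite mxE; exact: is_deriveZ (YD m).
have [_ SD] := is_deriveD (is_deriveD (AD i1) (AD i2)) (AD i3).
rewrite sum3E -[RHS]SD; apply: (derive_eq_on _ oU Ux) => z _.
by rewrite mxE sum3E.
Qed.

Lemma csmooth_id U : open U -> csmooth U id.
Proof. by move=> oU l k; exact: Ck_coord. Qed.

Lemma mulmx_local_diffeo A : A \in unitmx ->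
  local_diffeo setT (mulmx A : V3 -> V3) (mulmx (invmx A)).
Proof.
move=> uA; have IE : (mulmx A : V3 -> V3) @` setT = setT.
  apply/seteqP; split=> // z _; exists (invmx A *m z) => //.
  by rewrite mulmxA mulmxV// mul1mx.
split; rewrite ?IE; try exact: openT.
- by apply: csmooth_mulmx; [exact: openT|apply: csmooth_id; exact: openT].
- by apply: csmooth_mulmx; [exact: openT|apply: csmooth_id; exact: openT].
- by move=> x _; rewrite mulmxA mulVmx// mul1mx.
Qed.

Lemma smooth_det_triple U a b d : open U -> csmooth U a -> csmooth U b ->
  csmooth U d -> smooth U (fun z => \det (triple (a z) (b z) (d z))).
Proof.
move=> oU aC bC dC n.
apply: (@Ck_eq _ _ _ _ (fun z => a z i1 0 * (b z i2 0 * d z i3 0 - d z i2 0 * b z i3 0)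
  - b z i1 0 * (a z i2 0 * d z i3 0 - d z i2 0 * a z i3 0)
  + d z i1 0 * (a z i2 0 * b z i3 0 - b z i2 0 * a z i3 0))) => //.
  by move=> z _; rewrite det_tripleE.
have M2 (f g h k : V3 -> V3) i j l m : csmooth U f -> csmooth U g -> csmooth U h ->
    csmooth U k -> is_Ck n U (fun z => f z i 0 * g z j 0 - h z l 0 * k z m 0).
  by move=> fC gC hC kC; apply: CkB => //; apply: CkM.
apply: CkD => //; first apply: CkB => //.
- by apply: CkM => //; exact: M2.
- by apply: CkM => //; exact: M2.
- by apply: CkM => //; exact: M2.
Qed.

Lemma csmooth_cst U (w : V3) : open U -> csmooth U (fun=> w).
Proof. by move=> oU l n; exact: (@Ck_cst _ R). Qed.

Lemma csmooth_line U (f : V3 -> R) (u v : V3) : open U -> smooth U f ->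
  csmooth U (fun z => v + f z *: u).
Proof.
move=> oU fC l n; apply: (@Ck_eq _ _ _ _ (fun z => v l 0 + f z * u l 0)) => //.
  by move=> z _; rewrite !mxE.
apply: CkD => //; first exact: (@Ck_cst _ R).
by apply: CkM => //; exact: (@Ck_cst _ R).
Qed.

(** Such a field varies in direction [u] only, so the bracket of two of them is a multiple of
    [u]. *)
Lemma jac_line U (f : V3 -> R) (u v w : V3) x : open U -> smooth U f -> U x ->
  jac (fun z => v + f z *: u) x *m w = (\sum_k 'D_(e k) f x * w k 0) *: u.
Proof.
move=> oU fC Ux; apply/colP => l; rewrite !mxE mulr_suml; apply: eq_bigr => k _.
have fD := Ck_is_derive k (fC 1%N) Ux.
have H := is_deriveD (is_derive_cst (v l 0) x (e k))
  (is_deriveM fD (is_derive_cst (u l 0) x (e k))).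
have [_] := H; rewrite scaler0 !add0r => {}H.
rewrite !mxE mulrAC; congr (_ * _); transitivity (u l 0 * 'D_(e k) f x).
  rewrite -[RHS]H; apply: (derive_eq_on _ oU Ux) => z _.
  by rewrite !mxE.
by rewrite mulrC.
Qed.

End LinearChange.

(** * Construction of adapted coordinates *)

Section Backward.
Variables (R : realType) (B : body R).
Local Notation V3 := 'cV[R]_3.
Local Notation e := (canon_basis R).
Local Notation c := (chart B).
Variables (D : B -> {vspace V3}) (X : B -> V3) (Omega : form3 B).
Variable P : G_structure B (G1B R).
Hypothesis XC : smooth_on setT X.
Hypothesis OV : volume_form Omega.
Hypothesis hP : forall p u, P p u <-> adapted_frame D X Omega p u.

Let g := in_chart (fun q => Omega q (e i1) (e i2) (e i3)).

(** The bracket of the two fields is a multiple of [u] and lies in [D], whereas [u] does not: the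
    coefficient vanishes. *)
Lemma involutive_commutator (U : set V3) (f h : V3 -> R) (u v w : V3) :
  open U -> U `<=` range c -> smooth U f -> smooth U h ->
  involutive_distribution D ->
  (forall q, U (c q) -> u \notin D q) ->
  (forall q, U (c q) -> v + f (c q) *: u \in D q) ->
  (forall q, U (c q) -> w + h (c q) *: u \in D q) ->
  forall z, U z -> \sum_k 'D_(e k) h z * (v + f z *: u) k 0 =
                   \sum_k 'D_(e k) f z * (w + h z *: u) k 0.
Proof.
move=> oU UR fC hC invD uD YD ZD z Uz.
pose V := c @^-1` U.
have oV : open V by move/continuousP: (@chart_continuous _ B); apply.
have VE : c @` V = U.
  apply/seteqP; split=> [_ [q Uq <-]//|x Ux].
  by have [q _ qx] := UR _ Ux; exists q => //; rewrite /V/preimage/= qx.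
pose Y (q : B) := v + f (c q) *: u; pose Z (q : B) := w + h (c q) *: u.
have YE x : U x -> v + f x *: u = in_chart Y x.
  by move=> /UR[q _ <-]; rewrite in_chartE.
have ZE x : U x -> w + h x *: u = in_chart Z x.
  by move=> /UR[q _ <-]; rewrite in_chartE.
have YC := csmooth_line u v oU fC; have ZC := csmooth_line u w oU hC.
have sY : smooth_on V Y.
  rewrite /smooth_on VE => k; apply: (Ck_eq oU YE).
  exact: ((smooth_csmooth _ oU).2 YC k).
have sZ : smooth_on V Z.
  rewrite /smooth_on VE => k; apply: (Ck_eq oU ZE).
  exact: ((smooth_csmooth _ oU).2 ZC k).
have [q _ qz] := UR _ Uz.
have Vq : V q by rewrite /V/preimage/= qz.
have := invD V Y Z oV sY sZ YD ZD q Vq.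
rewrite /lie_bracket /dir_derive qz.
have -> : 'D_(Y q) (in_chart Z) z = 'D_(Y q) (fun x => w + h x *: u) z.
  by apply: near_eq_derive; apply: (open_near oU Uz) => x /ZE.
have -> : 'D_(Z q) (in_chart Y) z = 'D_(Z q) (fun x => v + f x *: u) z.
  by apply: near_eq_derive; apply: (open_near oU Uz) => x /YE.
rewrite (derive_jac _ oU ZC Uz) (derive_jac _ oU YC Uz).
rewrite (jac_line _ _ _ oU hC Uz) (jac_line _ _ _ oU fC Uz) -scalerBl /Y /Z qz.
move: (\sum_k _) (\sum_k _) => s t st.
apply/eqP; rewrite -subr_eq0; apply/negPn/negP => st0.
have := uD q; rewrite qz => /(_ Uz)/negP; apply.
by rewrite -(scalerK st0 u); exact: memvZ.
Qed.

Hypothesis invD : involutive_distribution D.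
Hypothesis XD : forall p, X p \in D p.
Hypothesis lie0 : forall p u v w, lie_derivative X Omega p u v w = 0.

Let XC' : csmooth (range c) (in_chart X).
Proof. by apply/smooth_csmooth; [exact: range_open|exact: XC]. Qed.

Let gC : smooth (range c) g.
Proof. by have [_ _ _] := OV; exact. Qed.

Let OmegaE q u v w : Omega q u v w = g (c q) * \det (triple u v w).
Proof.
have [OS O0 _ _] := OV; rewrite /g in_chartE.
exact: form_det (OS q) (O0 q) _ _ _.
Qed.

Let divX z : range c z -> \sum_l in_chart X z l 0 * 'D_(e l) g z +
  g z * \sum_l 'D_(e l) (fun y => in_chart X y l 0) z = 0.
Proof.
move=> [q _ <-]; have := lie0 q (e i1) (e i2) (e i3).
have d1 : \det (triple (e i1) (e i2) (e i3)) = 1 :> R.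
  by rewrite det_tripleE !mxE !I3E !eqxx /=; ring.
by rewrite lie_derivativeE// d1 mulr1 (in_chartE X).
Qed.

Lemma involutive_integrable : integrable_G_structure P.
Proof.
move=> p; have [V0 [sigma [oV0 V0p sC sP]]] := frames_section P p.
set A := sigma p; have [uA A3 _ _] := (hP _ _).1 (sP _ V0p); rewrite -/A in uA A3.
pose U0 := c @` V0.
have oU0 : open U0 by exact: chart_open.
have U0R : U0 `<=` range c by apply: image_subset.
pose s2 z := col i2 (in_chart sigma z).
have s2C : csmooth U0 s2.
  move=> l n; apply: (@Ck_eq _ _ _ _ (fun z => in_chart sigma z l i2)) => //.
    by move=> z _; rewrite /s2 mxE.
  exact: (Ck_mxP n (in_chart sigma) oU0).1 (sC n) l i2.
have XCU0 : csmooth U0 (in_chart X) by exact: csmooth_sub U0R XC'.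
(* The one-form [det (_, s2, X)] has kernel [D]; its values on the constant frame
   [A] are the [om k]. *)
pose om k z := \det (triple (col k A) (s2 z) (in_chart X z)).
have omC k : smooth U0 (om k).
  by apply: smooth_det_triple => //; exact: csmooth_cst.
have memD q v : U0 (c q) -> v \in D q <->
    \sum_k (invmx A *m v) k 0 * om k (c q) = 0.
  move=> [q' V0q' /(@chart_inj _ B) qq']; rewrite -{}qq'.
  have [uq q3 <- _] := (hP _ _).1 (sP _ V0q').
  rewrite (det_frame_span _ uq) q3.
  have {1}-> : v = A *m (invmx A *m v) by rewrite mulmxA mulmxV// mul1mx.
  by rewrite det_triple_mulmx /om /s2 !in_chartE.
(* At [c p] the value of [om i1] is the determinant of [A]. Where it is nonzero, [D] is transverse
   to the first column of [A] and is a graph over the other two. *)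
pose U1 := U0 `&` [set z | om i1 z != 0].
have oU1 : open U1 by exact: open_neq0.
have U1R : U1 `<=` range c by move=> z [/U0R].
have om10 z : U1 z -> om i1 z != 0 by move=> [].
have U1p : U1 (c p).
  split; first by exists p.
  rewrite /= /om /s2 !in_chartE -A3 -/A triple_col.
  by move: uA; rewrite unitmxE unitfE.
pose f z := - om i2 z / om i1 z; pose h z := - om i3 z / om i1 z.
have omC1 k n : is_Ck n U1 (om k) by apply: Ck_sub (omC k n) => z [].
have fC : smooth U1 f.
  by move=> n; apply: CkM => //; [exact: CkN|exact: CkV].
have hC : smooth U1 h.
  by move=> n; apply: CkM => //; [exact: CkN|exact: CkV].
have memD1 q v : U1 (c q) -> v \in D q <-> (invmx A *m v) i1 0 =
    f (c q) * (invmx A *m v) i2 0 + h (c q) * (invmx A *m v) i3 0.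
  move=> U1q; have [U0q om0] := U1q; rewrite (memD q v U0q) sum3E /f /h.
  have {}om0 := om10 _ U1q.
  move: (om i1 _) (om i2 _) (om i3 _) om0 => o1 o2 o3 o10.
  move: (invmx A *m v) => w; split => E.
    apply: (mulIf o10); apply/eqP; rewrite -subr_eq0; apply/eqP; rewrite -[RHS]E.
    by field.
  by rewrite E; field.
clearbody f h.
have AK v : A *m (invmx A *m v) = v by rewrite mulmxA mulmxV// mul1mx.
have KA v : invmx A *m (A *m v) = v by rewrite mulmxA mulVmx// mul1mx.
have comm := @involutive_commutator U1 f h (A *m e i1) (A *m e i2) (A *m e i3)
  oU1 U1R fC hC invD.
have {}comm z : U1 z -> \sum_k 'D_(e k) h z * (A *m e i2 + f z *: (A *m e i1)) k 0 =
                       \sum_k 'D_(e k) f z * (A *m e i3 + h z *: (A *m e i1)) k 0.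
  apply: comm => q U1q.
  - apply/negP => /(memD1 _ _ U1q); rewrite KA !mxE !I3E !eqxx /= !mulr0 addr0.
    by move/eqP; rewrite oner_eq0.
  - apply/(memD1 _ _ U1q); rewrite mulmxDr -scalemxAr !KA !mxE !I3E !eqxx /=.
    by ring.
  - apply/(memD1 _ _ U1q); rewrite mulmxDr -scalemxAr !KA !mxE !I3E !eqxx /=.
    by ring.
pose lin : V3 -> V3 := mulmx A.
have linD := mulmx_local_diffeo uA; rewrite -/lin in linD.
have oT : open [set: V3] by exact: openT.
have linC : csmooth setT lin by have [] := linD.
pose N1 := setT `&` lin @^-1` U1.
have oN1 : open N1.
  exact: (open_preimage oT oU1 (fun x Tx => csmooth_continuous linC Tx)).
have N1U x : N1 x -> U1 (lin x) by move=> [].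
have linC1 : csmooth N1 lin by apply: csmooth_sub linC.
have linJ k l x : is_derive x (e k) (fun y => lin y l 0) (A l k).
  have H := csmooth_is_derive k l linC (I : [set: V3] x).
  apply: is_derive_eq H _; transitivity (jac lin x l k); first by rewrite mxE.
  by rewrite (jac_mulmx A oT (csmooth_id oT) (I : [set: V3] x)) jac_id mulmx1.
have AE l k : A l k = (A *m e k) l 0 by rewrite -colE mxE.
have AL s k m l : (A *m e k + s *: (A *m e m)) l 0 = A l k + s * A l m.
  by rewrite !AE [LHS]mxE; congr (_ + _); rewrite [LHS]mxE.
have D_lin (F : V3 -> R) k x : smooth U1 F -> N1 x ->
    'D_(e k) (fun y => F (lin y)) x = \sum_l 'D_(e l) F (lin x) * A l k.
  move=> FC Nx.
  by have [_ ->] := derive_comp oU1 (FC 1%N) (N1U _ Nx) (fun l => linJ k l x).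
pose X' x := invmx A *m in_chart X (lin x).
have XlinC : csmooth N1 (fun x => in_chart X (lin x)).
  apply: (csmooth_comp oN1 (@range_open _ B) _ linC1 XC').
  by move=> x /N1U/U1R.
have X'C : csmooth N1 X' by exact: csmooth_mulmx.
(* The last column of [A] is [X p], so at the point over [p] the field [X'] is the third basis
   vector. *)
pose N := N1 `&` [set x | X' x i3 0 != 0].
have oN : open N by apply: open_neq0 => // n; exact: X'C.
have NN1 : N `<=` N1 by move=> x [].
pose b := invmx A *m c p.
have linb : lin b = c p by exact: AK.
have Nb : N b.
  split; first by split=> //; rewrite /preimage/= linb.
  rewrite /= /X' linb in_chartE -A3 colE KA mxE eqxx; exact: oner_neq0.
(* The density of [Omega] in the linear coordinates given by [A]. *)
pose g' x := \det A * g (lin x).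
have gC1 : smooth U1 g by move=> n; apply: Ck_sub U1R (gC n).
have glinC : smooth N1 (fun x => g (lin x)).
  exact: (smooth_comp oN1 oU1 N1U gC1 linC1).
have g'C : smooth N1 g'.
  by move=> n; apply: CkM => //; exact: (@Ck_cst _ R).
have flinC : smooth N1 (fun x => f (lin x)).
  exact: (smooth_comp oN1 oU1 N1U fC linC1).
have hlinC : smooth N1 (fun x => h (lin x)).
  exact: (smooth_comp oN1 oU1 N1U hC linC1).
have NC (F : V3 -> R) : smooth N1 F -> smooth N F.
  by move=> FC n; apply: Ck_sub NN1 (FC n).
have U1V q : U1 (c q) -> V0 q.
  by move=> [[q' V0q' /(@chart_inj _ B) qq'] _]; rewrite -qq'.
have H1 x : N x -> 'D_(e i2) (fun x => h (lin x)) x +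
      f (lin x) * 'D_(e i1) (fun x => h (lin x)) x =
      'D_(e i3) (fun x => f (lin x)) x +
      h (lin x) * 'D_(e i1) (fun x => f (lin x)) x.
  move=> /NN1 Nx; rewrite (D_lin h i2 x hC Nx) (D_lin h i1 x hC Nx).
  rewrite (D_lin f i3 x fC Nx) (D_lin f i1 x fC Nx).
  have H := comm _ (N1U _ Nx).
  transitivity (\sum_k 'D_(e k) h (lin x) *
      (A *m e i2 + f (lin x) *: (A *m e i1)) k 0).
    rewrite mulr_sumr -big_split/=; apply: eq_bigr => k _.
    rewrite AL.
    by move: ('D_(e k) h _) => d; ring.
  rewrite {}H mulr_sumr -big_split/=; apply: eq_bigr => k _.
  rewrite AL.
  by move: ('D_(e k) f _) => d; ring.
have H2 x : N x -> X' x i1 0 = f (lin x) * X' x i2 0 + h (lin x) * X' x i3 0.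
  move=> /NN1/N1U U1x; have [q _ qx] := U1R _ U1x.
  rewrite /X' -qx in_chartE; apply/memD1; last exact: XD.
  by rewrite qx.
have g0 z : U1 z -> g z != 0.
  move=> U1z; have [q _ qz] := U1R _ U1z; rewrite -qz.
  have V0q : V0 q by apply: U1V; rewrite qz.
  have [_ _ _ E] := (hP _ _).1 (sP _ V0q).
  apply/eqP => gz; move: E; rewrite OmegaE gz mul0r => /esym/eqP.
  by rewrite oner_eq0.
have dA : \det A != 0 by move: uA; rewrite unitmxE unitfE.
have H4 x : N x -> g' x != 0.
  by move=> /NN1/N1U U1x; rewrite mulf_neq0// g0.
have H5 x : N x -> \sum_l X' x l 0 * 'D_(e l) g' x +
    g' x * \sum_l 'D_(e l) (fun y => X' y l 0) x = 0.
  move=> /NN1 Nx; have U1x := N1U _ Nx.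
  have Dg l : 'D_(e l) g' x = \det A * \sum_m 'D_(e m) g (lin x) * A m l.
    rewrite -(D_lin g l x gC1 Nx).
    have [_ H] := is_deriveZ (\det A) (Ck_is_derive l (glinC 1%N) Nx).
    exact: H.
  have S1 : \sum_l X' x l 0 * 'D_(e l) g' x =
      \det A * \sum_m in_chart X (lin x) m 0 * 'D_(e m) g (lin x).
    have XE m : in_chart X (lin x) m 0 = \sum_l A m l * X' x l 0.
      have E := congr1 (fun w : V3 => w m 0) (AK _ (in_chart X (lin x))).
      by rewrite -[LHS]E mxE.
    under eq_bigr do rewrite Dg; under [in RHS]eq_bigr do rewrite XE.
    move: (X' x) => w; rewrite !sum3E.
    move: ('D_(e i1) g _) ('D_(e i2) g _) ('D_(e i3) g _) => d1 d2 d3.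
    by ring.
  (* The divergence is a trace, invariant under conjugation by [A]. *)
  have S2 : \sum_l 'D_(e l) (fun y => X' y l 0) x =
      \sum_l 'D_(e l) (fun y => in_chart X y l 0) (lin x).
    transitivity (\tr (jac X' x)); first by apply: eq_bigr => l _; rewrite mxE.
    transitivity (\tr (jac (in_chart X) (lin x))); last first.
      by apply: eq_bigr => l _; rewrite mxE.
    rewrite (jac_mulmx (invmx A) oN1 XlinC Nx).
    rewrite -[fun x => in_chart X (lin x)]/(in_chart X \o lin).
    rewrite (jac_comp (@range_open _ B) XC' linC1 Nx (U1R _ U1x)).
    have -> : jac lin x = A.
      by rewrite (jac_mulmx A oT (csmooth_id oT) (I : [set: V3] x)) jac_id mulmx1.
    by rewrite mulmxA mxtrace_mulC mulmxA mulmxV// mul1mx.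
  have := divX (U1R _ U1x); rewrite S1 S2 /g'.
  move: (\sum_m _) (g _) (\sum_l _) => a1 a2 a3 E.
  by rewrite -mulrA -mulrDr E mulr0.
have H3 x : N x -> X' x i3 0 != 0 by case.
have [W [psi [y [[Wb psib] Dpsi psiN psi3 psi2]]]] :=
  straighten oN Nb (NC _ flinC) (NC _ hlinC) (csmooth_sub NN1 X'C) (NC _ g'C)
   H1 H2 H3 H4 H5.
have D0 := local_diffeo_comp linD Dpsi (fun x _ => I).
pose psi0 := lin \o psi; pose yc := y \o mulmx (invmx A).
rewrite -/psi0 -/yc in D0.
have [oW oO psi0C ycC ycK] := D0; have [_ _ psiC _ _] := Dpsi.
have psi0U x : W x -> U1 (psi0 x) by move=> /psiN/NN1/N1U.
pose V := c @^-1` (psi0 @` W).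
have oV : open V by move/continuousP: (@chart_continuous _ B); apply.
have VE : c @` V = psi0 @` W.
  apply/seteqP; split=> [_ [q Vq <-]//|_ [x Wx <-]].
  have [q _ qx] := U1R _ (psi0U _ Wx).
  by exists q => //; rewrite /V/preimage/= qx; exists x.
have YE : (yc \o c) @` V = W.
  apply/seteqP; split=> [_ [q [x Wx xq] <-]|x Wx].
    by rewrite /= -xq ycK.
  have [q _ qx] := U1R _ (psi0U _ Wx).
  by exists q; [rewrite /V/preimage/= qx; exists x|rewrite /= qx ycK].
have LC : local_coordinates V (yc \o c) psi0.
  split => //.
  - by rewrite YE.
  - rewrite /smooth_on VE => n; apply: (@Ck_eq _ _ _ _ yc) => //.
      move=> _ [x Wx <-]; have [q _ qx] := U1R _ (psi0U _ Wx).
      by rewrite -qx in_chartE.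
    exact: ((smooth_csmooth yc oO).2 ycC).
  - by rewrite YE; exact: ((smooth_csmooth psi0 oW).2 psi0C).
  - by move=> q [x Wx xq]; rewrite /= -xq ycK.
exists V, (yc \o c), psi0; split => //.
  by exists b => //; rewrite /psi0/= psib linb.
move=> q Vq; apply/hP; have [x Wx xq] := Vq.
rewrite (coordinate_frameE LC Vq) /= -xq ycK//.
have U1x := psi0U _ Wx.
have JE : jac psi0 x = A *m jac psi x by exact: (jac_mulmx A oW psiC Wx).
have [psi2x detx] := psi2 _ Wx.
have gdet : g (c q) * \det (jac psi0 x) = 1.
  by rewrite -detx JE det_mulmx /g' -xq /psi0/=; ring.
have col3 : col i3 (jac psi0 x) = X q.
  rewrite JE -[X q]in_chartE -xq -(AK _ (in_chart X (psi0 x))) colE -mulmxA -colE.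
  congr (A *m _); apply/colP => l; rewrite [LHS]mxE [LHS]mxE.
  exact: psi3.
have mem2 : col i2 (jac psi0 x) \in D q.
  apply/memD1; first by rewrite -xq.
  by rewrite JE colE -mulmxA KA -colE -xq [LHS]mxE [LHS]mxE psi2x !mxE.
have uJ : jac psi0 x \in unitmx.
  rewrite unitmxE unitfE; apply/eqP => d0.
  by move/eqP: gdet; rewrite d0 mulr0 eq_sym oner_eq0.
split => //.
- have mem3 : col i3 (jac psi0 x) \in D q by rewrite col3 XD.
  have V0q : V0 q by apply: U1V; rewrite -xq.
  apply/vspaceP => v; apply/idP/idP => [/mem_span2[s [t ->]]|vD].
    by rewrite memvD ?memvZ.
  apply/(mem_frame_span v (mulVmx uJ)); set k := _ i1 0.
  apply/eqP; apply: contraT => k0.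
  (* If the component [k] were nonzero, [D q] would contain all columns of an invertible matrix,
     hence the first column of [sigma q], against the invertibility of that frame. *)
  have mem1 : col i1 (jac psi0 x) \in D q.
    rewrite -(scalerK k0 (col i1 _)); apply: memvZ.
    have := mulmx_colE (jac psi0 x) (invmx (jac psi0 x) *m v).
    rewrite mulmxA mulmxV// mul1mx -/k => /esym/(canRL (addrK _)) ->.
    by rewrite memvB// memvD ?memvZ.
  have [uq _ Dq _] := (hP _ _).1 (sP _ V0q).
  have : col i1 (sigma q) \in D q.
    rewrite -(mul1mx (col i1 _)) -(mulmxV uJ) -mulmxA mulmx_colE.
    by rewrite !memvD ?memvZ.
  rewrite -Dq (det_frame_span _ uq) triple_col => d0.
  by move: uq; rewrite unitmxE unitfE d0 eqxx.
- by rewrite OmegaE triple_col.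
Qed.

End Backward.

Theorem proposition6p7 (R : realType) (B : body R)
    (D : B -> {vspace 'cV[R]_3}) (X : B -> 'cV[R]_3) (Omega : form3 B)
    (P : G_structure B (G1B R))
    (hD : distribution2 D)
    (hX : smooth_on setT X)
    (hX0 : forall p, X p <> 0)
    (hXD : forall p, X p \in D p)
    (hOmega : volume_form Omega)
    (hP : forall p u, P p u <-> adapted_frame D X Omega p u) :
  integrable_G_structure P <->
  (involutive_distribution D /\ forall p u v w, lie_derivative X Omega p u v w = 0).
Proof.
split=> [intP|[invD lie0]].
  split; first exact: integrable_involutive hP intP.
  by move=> p u v w; exact: integrable_lie hP intP hX hOmega p u v w.
exact: involutive_integrable hX hOmega hP invD hXD lie0.
Qed.
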